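(* Let $k\ge1$, $n_0\ge0$ be integers, $0<\alpha\le1$, and let $\lambda_{(n)_i}>0$ ($n\ge n_0$, $1\le i\le k$). Let $p(n,t)$ and $p^{\alpha}(n,t)$ be the state probabilities of the generalized birth process and of the generalized fractional birth process with these rates. Suppose that for every $m\ge1$ and every tuple $(x_1,\dots,x_m)\in\Theta_m^{k}$ the numbers $\mu_l=\sum_{i=1}^{k}\lambda_{(n_0+(j)_l)_i}$, $l=1,\dots,m^*$, where $m^*=|\Lambda_m|$, are distinct. Then for all $m\ge n_0$ and $t>0$ $$p^{\alpha}(m,t)=\int_0^{\infty}p(m,\xi)f_{T_{2\alpha}}(\xi,t)\,\mathrm{d}\xi .$$ Consequently, $\sum_{m=n_0}^{\infty}p^{\alpha}(m,t)=1$ for all $t>0$ if and only if $\sum_{m=n_0}^{\infty}p(m,t)=1$ for all $t>0$; and if $$\sum_{m=n_0}^{\infty}\left(\sum_{i=1}^{k}\sum_{j=1}^{i}\lambda_{(m-j+1)_i}^{2}\right)^{-1/2}=\infty,$$ then $\sum_{m=n_0}^{\infty}p^{\alpha}(m,t)=1$ for all $t>0$.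
   Context: Caputo derivative: for $0<\alpha<1$, $\frac{\mathrm{d}^{\alpha}}{\mathrm{d}t^{\alpha}}f(t)=\frac{1}{\Gamma(1-\alpha)}\int_0^t(t-s)^{-\alpha}f'(s)\,\mathrm{d}s$; for $\alpha=1$ it is $f'(t)$ (and for orders in $(1,2]$ it is the usual Caputo derivative). The generalized fractional birth process (GFBP) $\{\mathcal{X}^{\alpha}(t)\}_{t\ge0}$ is the process whose state probabilities $p^{\alpha}(n,t)=\mathrm{Pr}\{\mathcal{X}^{\alpha}(t)=n\}$ satisfy $$\frac{\mathrm{d}^{\alpha}}{\mathrm{d}t^{\alpha}}p^{\alpha}(n,t)=-\sum_{i=1}^{k}\lambda_{(n)_i}p^{\alpha}(n,t)+\sum_{i=1}^{\min\{n,k\}}\lambda_{(n-i)_i}p^{\alpha}(n-i,t),\quad n\ge n_0,$$ with $p^{\alpha}(n_0,0)=1$, $p^{\alpha}(n,0)=0$ for $n>n_0$, and $p^{\alpha}(n,t)=0$ for $n<n_0$. The generalized birth process (GBP) $\{\mathcal{X}(t)\}_{t\ge0}$ is the case $\alpha=1$: it starts at $n_0$ and from state $n$ jumps to $n+i$, $1\le i\le k$, with rate $\lambda_{(n)_i}$; its state probabilities $p(n,t)=\mathrm{Pr}\{\mathcal{X}(t)=n\}$ satisfy $$\frac{\mathrm{d}}{\mathrm{d}t}p(n,t)=-\sum_{i=1}^{k}\lambda_{(n)_i}p(n,t)+\sum_{i=1}^{\min\{n,k\}}\lambda_{(n-i)_i}p(n-i,t),\quad n\ge n_0,$$ with $p(n_0,0)=1$,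 $p(n,0)=0$ for $n>n_0$, and $p(n,t)=0$ for $n<n_0$. Convention: $\lambda_{(n)_i}=0$ for $n<n_0$ (this affects only finitely many terms of the series in the claim). The sets $\Theta_n^k\subset\mathbb{R}^n$ ($n,k\ge1$): let $\bar e_n^{\,j}$ be the $n$-tuple unit row vector with $1$ at the $j$th place and $0$ elsewhere, and for $m>n$ let $Q_{n\times m}=[\,I_{n\times n}\ \ O_{n\times(m-n)}\,]$ (identity block followed by zero block), so that $\bar x\mapsto\bar xQ_{n\times m}$ appends $m-n$ zeros to $\bar x$. For a set $A$ of row vectors, $AQ+v=\{\bar xQ+v:\bar x\in A\}$. Then $\Theta_1^k=\{(1)\}$ for all $k\ge1$, and for $n\ge2$ $$\Theta_n^k=\begin{cases}\bigcup_{i=1}^{k}\left\{\Theta_{n-i}^{k}Q_{(n-i)\times n}+i\,\bar e_n^{\,n-i+1}\right\}, & 1\le k\le n-1,\\[1ex]\bigcup_{i=1}^{n-1}\left\{\Theta_{n-i}^{n}Q_{(n-i)\times n}+i\,\bar e_n^{\,n-i+1}\right\}\cup\{n\,\bar e_n^{\,1}\}, & k\ge n.\end{cases}$$ For $(x_1,\dots,x_n)\in\Theta_n^k$, $\Lambda_n=\{0,1,\dots,n\}\setminus\{1\le j\le n-1:\ x_{j+1}=0\}$, $n^*=|\Lambda_n|$, and $(j)_1<(j)_2<\dots<(j)_{n^*}$ are the elements of $\Lambda_n$ in increasing order, i.e. $(j)_1=0$, $(j)_l=\inf\{(j)_{l-1}<j\le n-1:\ x_{j+1}\ne0\}$ for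 $1<l<n^*$, and $(j)_{n^*}=n$. All of these depend on the tuple. $f_{T_{2\alpha}}(x,t)$ is the folded solution (i.e. $2u(x,t)$ for $x>0$ and $0$ for $x<0$) of $$\frac{\mathrm{d}^{2\alpha}}{\mathrm{d}t^{2\alpha}}u(x,t)=\frac{\partial^2}{\partial x^2}u(x,t),\quad x\in\mathbb{R},\ t>0,$$ with $u(x,0)=\delta(x)$ for $0<\alpha\le1$ and $\frac{\partial}{\partial t}u(x,0)=0$ for $1/2<\alpha\le1$. It is known that $\int_0^{\infty}e^{-st}f_{T_{2\alpha}}(x,t)\,\mathrm{d}t=s^{\alpha-1}e^{-xs^{\alpha}}$ for $x>0$ (for $\alpha=1$ the density is understood in the generalized sense). *)

(* Defs.v *)
From HB Require Import structures.
From mathcomp Require Import all_boot all_order all_algebra.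
From mathcomp Require Import all_classical all_reals all_analysis.

Set Implicit Arguments.
Unset Strict Implicit.
Unset Printing Implicit Defensive.

Import Order.TTheory GRing.Theory Num.Theory.
Import numFieldNormedType.Exports.

Local Open Scope ring_scope.
Local Open Scope classical_set_scope.

Definition Gamma (R : realType) (z : R) : R :=
  \int[@lebesgue_measure R]_(x in `]0, +oo[) (x `^ (z - 1) * expR (- x)).

Definition caputo_order (R : realType) (b : R) : nat := `|Num.ceil b|%N.

Definition caputo_integrand (R : realType) (b : R) (f : R -> R) (t s : R) : R :=
  (t - s) `^ ((caputo_order b)%:R - b - 1) * derive1n (caputo_order b) f s.

(* Order b > 0; for b in ]0, 2] the integer caputo_order b is 1 or 2. *)
Definition caputo (R : realType) (b : R) (f : R -> R) (t : R) : R :=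
  if b == (caputo_order b)%:R then derive1n (caputo_order b) f t
  else (Gamma ((caputo_order b)%:R - b))^-1 *
       \int[@lebesgue_measure R]_(s in `[0, t]) caputo_integrand b f t s.

(* derive1 f is a total function, but this condition forces it to be the
   derivative of f almost everywhere on the half-line. *)
Definition locally_abs_cont (R : realType) (f0 : R) (f : R -> R) : Prop :=
  forall t : R, 0 < t ->
    (@lebesgue_measure R).-integrable `[0, t] (EFin \o derive1 f) /\
    f t = f0 + \int[@lebesgue_measure R]_(s in `[0, t]) derive1 f s.

(* f solves the initial value problem D^b f = F on ]0, +oo[ with
   f^(j)(0+) = c j for j < caputo_order b.  The regularity required is the one
   under which the Caputo derivative is usually defined: the derivatives of f of
   order less than caputo_order b are locally absolutely continuous on [0, +oo[,
   and the integral defining D^b f (t) converges for every t > 0. *)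
Definition caputo_ivp (R : realType) (b : R) (c : nat -> R) (f F : R -> R)
    : Prop :=
  [/\ forall j : nat, (j < caputo_order b)%N ->
        locally_abs_cont (c j) (derive1n j f),
      b != (caputo_order b)%:R -> forall t : R, 0 < t ->
        (@lebesgue_measure R).-integrable `[0, t]
          (EFin \o caputo_integrand b f t)
    & forall t : R, 0 < t -> caputo b f t = F t].

(* The state None is where an exploding process is sent, so that the
   probabilities of the finite states may sum to less than 1. *)
Definition state_prob (R : realType) (d : measure_display)
    (T : measurableType d) (P : probability T R) (X : R -> T -> option nat)
    (n : nat) (t : R) : R :=
  fine (P (X t @^-1` [set Some n])).

Definition birth_rhs (R : realType) (k : nat) (lam : int -> nat -> R)
    (p : nat -> R -> R) (n : nat) (t : R) : R :=
  - (\sum_(1 <= i < k.+1) lam n i * p n t)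
  + \sum_(1 <= i < (minn n k).+1) lam (n - i)%N i * p (n - i)%N t.

(* Times are the nonnegative reals; X is unconstrained at negative times. *)
Record is_gfbp (R : realType) (alpha : R) (k n0 : nat) (lam : int -> nat -> R)
    (d : measure_display) (T : measurableType d) (P : probability T R)
    (X : R -> T -> option nat) : Prop := {
  gfbp_measurable : forall (n : nat) (t : R), 0 <= t ->
    measurable (X t @^-1` [set Some n]);
  gfbp_init : state_prob P X n0 0 = 1;
  gfbp_init_gt : forall n : nat, (n0 < n)%N -> state_prob P X n 0 = 0;
  gfbp_lt : forall (n : nat) (t : R), (n < n0)%N -> 0 <= t ->
    state_prob P X n t = 0;
  gfbp_equation : forall n : nat, (n0 <= n)%N ->
    caputo_ivp alpha (fun=> state_prob P X n 0) (state_prob P X n)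
      (birth_rhs k lam (state_prob P X) n) }.

Definition is_gbp (R : realType) (k n0 : nat) (lam : int -> nat -> R)
    (d : measure_display) (T : measurableType d) (P : probability T R)
    (X : R -> T -> option nat) : Prop :=
  is_gfbp 1 k n0 lam P X.

(* The j-th unit row vector, 1 <= j <= n. *)
Definition unit_row (R : realType) (n j : nat) : 'rV[R]_n :=
  \row_(l < n) (l.+1 == j)%:R.

Definition Qmx (R : realType) (n m : nat) : 'M[R]_(n, m) := pid_mx n.

Inductive Theta (R : realType) : nat -> forall n : nat, 'rV[R]_n -> Prop :=
| Theta_one (k : nat) : (1 <= k)%N -> Theta k (const_mx 1 : 'rV[R]_1)
| Theta_small (k n i : nat) (x : 'rV[R]_(n - i)) :
    (2 <= n)%N -> (1 <= k <= n - 1)%N -> (1 <= i <= k)%N -> Theta k x ->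
    Theta k (x *m Qmx R (n - i) n + i%:R *: unit_row R n (n - i + 1))
| Theta_large (k n i : nat) (x : 'rV[R]_(n - i)) :
    (2 <= n)%N -> (n <= k)%N -> (1 <= i <= n - 1)%N -> Theta n x ->
    Theta k (x *m Qmx R (n - i) n + i%:R *: unit_row R n (n - i + 1))
| Theta_top (k n : nat) :
    (2 <= n)%N -> (n <= k)%N -> Theta k (n%:R *: unit_row R n 1).

(* The elements of the index set in increasing order.  The (j+1)-th coordinate
   of x is x 0 i with val i = j. *)
Definition Lambda (R : realType) (n : nat) (x : 'rV[R]_n) : seq nat :=
  [seq j <- iota 0 n.+1 |
    ~~ ((1 <= j <= n - 1)%N
        && [exists i : 'I_n, (val i == j) && (x 0 i == 0)])].

(* (j)_l and mu_l, for 1 <= l <= size (Lambda x). *)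
Definition Lambda_nth (R : realType) (n : nat) (x : 'rV[R]_n) (l : nat) : nat :=
  nth 0%N (Lambda x) l.-1.

Definition mu_rate (R : realType) (k n0 : nat) (lam : int -> nat -> R)
    (n : nat) (x : 'rV[R]_n) (l : nat) : R :=
  \sum_(1 <= i < k.+1) lam (n0 + Lambda_nth x l)%N i.

Definition test_function (R : realType) (phi : R -> R) : Prop :=
  (forall (j : nat) (x : R), derivable (derive1n j phi) x 1) /\
  (exists M : R, forall x : R, M < `|x| -> phi x = 0).

(* u(dx, t) is a probability measure in x, and the equation
     D_t^(2 alpha) u = u_xx,  u(x, 0) = delta(x),  u_t(x, 0) = 0 if 2 alpha > 1
   is tested against smooth compactly supported functions of x.  A pointwise
   formulation is not available: for alpha = 1 the solution is
   (delta_t + delta_(-t)) / 2, and for alpha < 1, alpha <> 1/2, its density has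
   a kink at x = 0 for every t > 0. *)
Definition fundamental_solution (R : realType) (alpha : R)
    (u : R -> probability (measurableTypeR R) R) : Prop :=
  (forall A : set (measurableTypeR R), measurable A -> u 0 A = \d_(0 : R) A) /\
  (forall phi : R -> R, test_function phi ->
     caputo_ivp (2 * alpha) (fun j => if j is 0%N then phi 0 else 0)
       (fun t => \int[u t]_x phi x)
       (fun t => \int[u t]_x derive1n 2 phi x)).

Definition has_density (R : realType)
    (nu : probability (measurableTypeR R) R) (f : R -> R) : Prop :=
  measurable_fun setT f /\
  forall A : set R, measurable A ->
    nu A = (\int[@lebesgue_measure R]_(x in A) (f x)%:E)%E.

(* Folding (2 u on x > 0, 0 on x < 0), for measures and for densities. *)
Definition folded_measure (R : realType)
    (nu : probability (measurableTypeR R) R) :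
    {measure set (measurableTypeR R) -> \bar R} :=
  mscale 2%:nng (mrestr nu (measurable_itv `]0, +oo[%R)).

Definition folded (R : realType) (f : R -> R) (x : R) : R :=
  if 0 < x then 2 * f x else 0.

(* Main.v *)
From HB Require Import structures.
Require Import Defs.
From mathcomp Require Import all_boot all_order all_algebra.
From mathcomp Require Import all_classical all_reals all_analysis.
From mathcomp Require Import measurable_realfun ring lra.

Set Implicit Arguments.
Unset Strict Implicit.
Unset Printing Implicit Defensive.

Import Order.TTheory GRing.Theory Num.Theory.
Import numFieldNormedType.Exports.

Local Open Scope ring_scope.
Local Open Scope classical_set_scope.

(* With L the Laplace transform, the equation of a process of order a becomes
   (s^a + M_n) L p_n = s^(a-1) p_n(0) + sum_i lambda_(n-i)_i L p_(n-i), so by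
   induction on n the transform of p^alpha_n at s is s^(alpha-1) times that of p_n
   at s^alpha.  The distribution u_t of the fundamental solution satisfies
   L (t |-> int g du_t) (s) = s^(alpha-1)/2 (L g)(s^alpha) for every bounded
   continuous g on the half-line, extended by 0: this is shown for smooth g by
   testing the equation with a solution of s^(2 alpha) phi - phi'' = g, then by
   bounded limits.  Uniqueness of the transform on bounded continuous functions gives
   the integral representation; the self-similarity u_t = u_1 o t^-alpha supplies the
   continuity in t.

   For the total masses, the mass of X on n < N decreases in time, and its loss up
   to time t is the integral of the flux of probability across level N.  If the
   limiting mass at x were l < 1, the fractional mass at t would be at most
   1 - 2 (1 - l) u_t(]x, +oo[).  If mass 1 - l escapes by time t, every flux
   integral is at least 1 - l, which bounds the sum of the inverse rate norms. *)

(** * Convolutions and Laplace transforms *)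

(** The equation for [u] is known only weakly, through measures tested on smooth compactly supported
    functions, and no formula for a density is used; for alpha = 1 there is none. This creates three
    obstacles. With a = s^alpha, the solution phi of s^(2 alpha) phi - phi'' = psi is the
    convolution of psi with the Green function e^(-a|x|) / (2 a): smooth, but not of compact
    support, so it has to be truncated. The initial condition picks out phi(0) = L psi (a) / (2 a),
    which is the source of the factor 1/2 that the folding undoes; no symmetry of [u t] is invoked.
    Next, p(n, .) extended by 0 is not a test function and even jumps at 0 for n = n0, so the
    identity has to be extended by approximation from inside ]0, +oo[. Finally, uniqueness of the
    transform is proved for continuous functions of t, whereas the weak equation yields continuity
    in t for test functions only; moving time into the integrand repairs this. *)

Section affine.
Context {R : realType}.
Local Notation mu := (@lebesgue_measure R).
Implicit Types (c b : R) (D : set R).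

Lemma measurable_affine c b : measurable_fun [set: R] (fun x : R => c * x + b).
Proof. by apply: measurable_funD => //; apply: measurable_funM. Qed.

(** Uniqueness of the measure that gives every interval ]x, y] its length. For [c < 0] the preimage
    of ]x, y] is half-open on the other side, which leaves its length unchanged. *)
Lemma lebesgue_measure_affine c b (A : set R) : c != 0 -> measurable A ->
  (`|c|%:E * mu ((fun x : R => c * x + b)%R @^-1` A) = mu A)%E.
Proof.
move=> c0 mA.
have mphi : @measurable_fun _ _ (measurableTypeR R) (measurableTypeR R) setT
  (fun x : R => c * x + b) by exact: measurable_affine.
pose phi : {mfun (measurableTypeR R) >-> (measurableTypeR R)} :=
  HB.pack (fun x : R => c * x + b) (isMeasurableFun.Build _ _ _ _ _ mphi).
have c0' : 0 < `|c| by rewrite normr_gt0.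
pose k : {nonneg R} := NngNum (ltW c0').
apply/esym; rewrite (@lebesgue_measure_unique R (mscale k (pushforward mu phi))) //.
move=> _ [[x y]] _ <- /=; rewrite /mscale /= /pushforward.
have /orP[cp|cn] : (0 < c) || (c < 0) by lra.
  rewrite (_ : _ @^-1` _ = `](x - b) / c, (y - b) / c]%classic); last first.
    apply/seteqP; split=> z /=; rewrite !in_itv /= ltr_pdivrMr// ler_pdivlMr//; lra.
  rewrite !lebesgue_measure_itv/= !lte_fin ltr_pM2r ?invr_gt0// ltrD2r gtr0_norm//.
  case: ifP => _; last by rewrite mule0.
  by rewrite -!EFinB -EFinM; congr (_%:E); field; lra.
rewrite (_ : _ @^-1` _ = `[(y - b) / c, (x - b) / c[%classic); last first.
  apply/seteqP; split=> z /=; rewrite !in_itv /= ltr_ndivlMr// ler_ndivrMr//; lra.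
rewrite !lebesgue_measure_itv/= !lte_fin ltr_nM2r ?invr_lt0// ltrD2r ltr0_norm//.
case: ifP => _; last by rewrite mule0.
by rewrite -!EFinB -EFinM; congr (_%:E); field; lra.
Qed.

Lemma ge0_integral_affine c b D (f : R -> \bar R) : c != 0 -> measurable D ->
  measurable_fun D f -> (forall x, D x -> 0 <= f x)%E ->
  (\int[mu]_(x in D) f x =
   `|c|%:E * \int[mu]_(x in (fun x : R => c * x + b)%R @^-1` D) f (c * x + b)%R)%E.
Proof.
move=> c0 mD mf f0.
have mphi : @measurable_fun _ _ (measurableTypeR R) (measurableTypeR R) setT
  (fun x : R => c * x + b) by exact: measurable_affine.
pose phi : {mfun (measurableTypeR R) >-> (measurableTypeR R)} :=
  HB.pack (fun x : R => c * x + b) (isMeasurableFun.Build _ _ _ _ _ mphi).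
have c0' : 0 < `|c| by rewrite normr_gt0.
pose k : {nonneg R} := NngNum (ltW c0').
rewrite -(ge0_integral_pushforward mphi mu mD mf); last first.
  by move=> x /[!inE]; exact: f0.
rewrite (_ : `|c| = k%:num)// -ge0_integral_mscale//.
apply: eq_measure_integral => A mA _.
exact/esym/(lebesgue_measure_affine b c0 mA).
Qed.

Lemma measurable_preimage_affine c b D : measurable D ->
  measurable ((fun x : R => c * x + b) @^-1` D).
Proof. by move=> mD; rewrite -[X in measurable X]setTI; exact: measurable_affine. Qed.

Lemma measurable_fun_affine c b D d (T : measurableType d) (f : R -> T) :
  measurable D -> measurable_fun D f ->
  measurable_fun ((fun x : R => c * x + b) @^-1` D) (fun x => f (c * x + b)).
Proof.
move=> mD mf; apply: (@measurable_comp _ _ _ _ _ _ D) => //.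
- by move=> _ [x Dx <-].
- by apply: measurable_funTS; exact: measurable_affine.
Qed.

Lemma integrable_affine c b D (f : R -> R) : c != 0 -> measurable D ->
  mu.-integrable D (EFin \o f) ->
  mu.-integrable ((fun x : R => c * x + b) @^-1` D) (EFin \o (fun x => f (c * x + b))).
Proof.
move=> c0 mD /integrableP[mf foo]; apply/integrableP; split.
  exact: (@measurable_fun_affine c b D _ _ (EFin \o f) mD mf).
move: foo; rewrite (ge0_integral_affine b c0)//; last first.
  exact: measurableT_comp.
rewrite /=.
have : (0 <= \int[mu]_(x in (fun x => (c * x + b)%R) @^-1` D) `|(f (c * x + b))%:E|)%E.
  by apply: integral_ge0.
case: (integral _ _ _) => //=.
  by move=> r _ _; rewrite ltry.
by move=> _; rewrite gt0_muley// lte_fin normr_gt0.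
Qed.

Lemma Rintegral_affine c b D (f : R -> R) : c != 0 -> measurable D ->
  mu.-integrable D (EFin \o f) ->
  \int[mu]_(x in D) f x =
  `|c| * \int[mu]_(x in (fun x => c * x + b) @^-1` D) f (c * x + b).
Proof.
move=> c0 mD fi.
have fi' := integrable_affine b c0 mD fi.
have mf := measurable_int _ fi.
rewrite /Rintegral.
have -> : `|c| = fine (`|c|%:E) by [].
rewrite -fineM//; last first.
  by apply: integrable_fin_num fi' => //; exact: measurable_preimage_affine.
congr fine.
have Ep := ge0_integral_affine b c0 mD (measurable_funepos mf) (fun x _ => funepos_ge0 _ x).
have En := ge0_integral_affine b c0 mD (measurable_funeneg mf) (fun x _ => funeneg_ge0 _ x).
rewrite [LHS](integralE mu D (EFin \o f)) Ep En.
rewrite [in RHS](integralE mu _ (EFin \o (fun x => f (c * x + b)))) [RHS]muleBr//; last first.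
rewrite fin_num_adde_defl// fin_numN.
  apply: integrable_neg_fin_num => //.
  exact: measurable_preimage_affine.
by congr (_ * _ - _ * _)%E; apply: eq_integral => x _; rewrite ?funeposE ?funenegE.
Qed.
End affine.

Section convolution.
Context {R : realType}.
Local Notation mu := (@lebesgue_measure R).
Implicit Types (A K h B : R -> R).

Definition convolution (K h : R -> R) (t : R) : R := \int[mu]_s (K (t - s) * h s).

(** A single interchange of integrals that serves both the transform of a convolution ([A] an
    exponential) and the commutation of a kernel with integration ([A] a reflected kernel).
    Integrability is demanded at every [t] with [A t != 0]: Fubini gives it only almost everywhere,
    while [convolution] is a total function. *)
Lemma fubini_conv A K h B :
  measurable_fun setT A -> measurable_fun setT K -> measurable_fun setT h ->
  (forall t, 0 <= A t) -> (forall t, 0 <= K t) ->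
  (forall s, \int[mu]_t (A t * K (t - s))%:E = (B s)%:E)%E ->
  mu.-integrable setT (EFin \o (fun s => h s * B s)) ->
  (forall t, A t != 0 ->
     mu.-integrable setT (EFin \o (fun s => K (t - s) * h s))) ->
  mu.-integrable setT (EFin \o (fun t => A t * convolution K h t)) /\
  \int[mu]_t (A t * convolution K h t) = \int[mu]_s (h s * B s).
Proof.
move=> mA mK mh A0 K0 AKB hB Kh.
pose Phi (z : measurableTypeR R * measurableTypeR R) : \bar R :=
  (A z.1 * K (z.1 - z.2) * h z.2)%:E.
have mPhi : measurable_fun setT Phi.
  apply/measurable_EFinP; apply: measurable_funM; last first.
    exact: measurableT_comp.
  apply: measurable_funM; first exact: measurableT_comp.
  apply: measurableT_comp => //.
  exact: measurable_funB.
have B0 s : 0 <= B s.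
  rewrite -lee_fin -AKB; apply: integral_ge0 => t _.
  by rewrite lee_fin mulr_ge0.
have mAK s : measurable_fun setT (fun t => A t * K (t - s)).
  apply: measurable_funM => //; apply: measurableT_comp => //.
  exact: measurable_funB.
have iPhi : (mu \x mu)%E.-integrable setT Phi.
  apply/integrable21ltyP => //.
  move/integrableP : hB => [_].
  congr (_ < _)%E; apply: eq_integral => s _ /=.
  rewrite normrM (ger0_norm (B0 s)) EFinM -AKB -ge0_integralZl//=; last first.
  - by move=> t _; rewrite lee_fin mulr_ge0.
  - by apply/measurable_EFinP; exact: mAK.
  apply: eq_integral => t _ /=; rewrite -EFinM !normrM.
  by rewrite (ger0_norm (A0 t)) (ger0_norm (K0 _)) mulrC.
have E1 t : (\int[mu]_s Phi (t, s) = (A t * convolution K h t)%:E)%E.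
  have [A00|An0] := eqVneq (A t) 0.
    rewrite A00 mul0r; apply: integral0_eq => s _.
    by rewrite /Phi /= A00 !mul0r.
  have ik := Kh t An0.
  rewrite EFinM /convolution /Rintegral fineK; last exact: integrable_fin_num.
  rewrite -integralZl//; apply: eq_integral => s _.
  by rewrite /Phi/= -EFinM mulrA.
have E2 s : (\int[mu]_t Phi (t, s) = (h s * B s)%:E)%E.
  rewrite EFinM -AKB -integralZl//; last first.
    apply/integrableP; split; first by apply/measurable_EFinP; exact: mAK.
    rewrite (_ : (\int[mu]_x _ = (B s)%:E)%E) ?ltry// -AKB.
    by apply: eq_integral => t _ /=; rewrite ger0_norm// mulr_ge0.
  by apply: eq_integral => t _; rewrite /Phi/= -EFinM mulrC.
have FF := Fubini iPhi.
have iF := integrable_fubini_F iPhi.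
split.
  by apply: eq_integrable iF => // t _ /=; rewrite -E1.
rewrite /Rintegral; congr fine.
under eq_integral do rewrite -E1.
by rewrite FF; apply: eq_integral => s _; rewrite E2.
Qed.

End convolution.

Section halfline.
Context {R : realType}.
Local Notation mu := (@lebesgue_measure R).
Local Notation pos := (`]0, +oo[%classic : set R).
Implicit Types (K h f g : R -> R).

Lemma measurable_itvR (i : interval R) : @measurable _ (measurableTypeR R) [set` i].
Proof. exact: measurable_itv. Qed.

Lemma patch_posE f x : (f \_ pos) x = if 0 < x then f x else 0.
Proof.
rewrite patchE; case: ifPn => [|]; first by rewrite inE /= in_itv /= andbT => ->.
by rewrite notin_setE /= in_itv /= andbT => /negP/negbTE ->.
Qed.

Lemma patch_itvooE f (a b x : R) :
  (f \_ `]a, b[) x = if a < x < b then f x else 0.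
Proof.
rewrite patchE; case: ifPn => [|]; first by rewrite inE /= in_itv /= => ->.
by rewrite notin_setE /= in_itv /= => /negP/negbTE ->.
Qed.

Lemma measurable_patch_pos f : measurable_fun pos f -> measurable_fun setT (f \_ pos).
Proof. by move=> mf; apply/(measurable_restrictT f (measurable_itv _)). Qed.

Definition hconv K h (t : R) : R := \int[mu]_(s in `]0, t[) (K (t - s) * h s).

Lemma conv_patchE K h t s :
  (K \_ pos) (t - s) * (h \_ pos) s = ((fun s => K (t - s) * h s) \_ `]0, t[) s.
Proof.
rewrite !patch_posE patch_itvooE subr_gt0.
by case: ltP => /= _; case: ltP => /= _; rewrite ?mulr0 ?mul0r.
Qed.

Lemma hconvE K h t : convolution (K \_ pos) (h \_ pos) t = hconv K h t.
Proof.
rewrite /convolution /hconv [RHS]Rintegral_mkcond; apply: eq_Rintegral => s _.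
by rewrite conv_patchE.
Qed.

Lemma integrable_conv_patch K h t :
  mu.-integrable `]0, t[ (EFin \o (fun s => K (t - s) * h s)) ->
  mu.-integrable setT (EFin \o (fun s => (K \_ pos) (t - s) * (h \_ pos) s)).
Proof.
move=> ik; have := (integrable_mkcond _ (measurable_itvR _)).1 ik.
apply: eq_integrable => // s _.
by rewrite /= conv_patchE restrict_EFin.
Qed.

Definition laplace f (s : R) : R := \int[mu]_(t in pos) (expR (- (s * t)) * f t).

Definition laplace_integrable f (s : R) : Prop :=
  mu.-integrable pos (EFin \o (fun t => expR (- (s * t)) * f t)).

Lemma measurable_expNM (s : R) D : measurable_fun D (fun t : R => expR (- (s * t))).
Proof.
apply: measurable_funTS; apply: measurableT_comp => //.
by apply: measurableT_comp => //; apply: measurable_funM.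
Qed.

Lemma laplace_patch f s :
  laplace f s = \int[mu]_t (expR (- (s * t)) * (f \_ pos) t).
Proof.
rewrite /laplace Rintegral_mkcond; apply: eq_Rintegral => t _.
by rewrite !patch_posE; case: ifP => _; rewrite ?mulr0.
Qed.

Lemma laplace_integrable_patch f s : laplace_integrable f s <->
  mu.-integrable setT (EFin \o (fun t => expR (- (s * t)) * (f \_ pos) t)).
Proof.
have E : (EFin \o (fun t => expR (- (s * t)) * f t)) \_ pos =
  EFin \o (fun t => expR (- (s * t)) * (f \_ pos) t).
  rewrite restrict_EFin; apply/funext => t /=; rewrite !patch_posE.
  by case: ifP => _; rewrite ?mulr0.
rewrite -E; exact: (integrable_mkcond _ (measurable_itvR _)).
Qed.

Lemma eq_laplace f g s : (forall t, 0 < t -> f t = g t) -> laplace f s = laplace g s.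
Proof.
by move=> fg; apply: eq_Rintegral => t; rewrite inE /= in_itv /= andbT => /fg ->.
Qed.

Lemma eq_laplace_integrable f g s : (forall t, 0 < t -> f t = g t) ->
  laplace_integrable f s -> laplace_integrable g s.
Proof.
move=> fg; apply: eq_integrable => // t; rewrite inE /= in_itv /= andbT => /fg.
by move=> ->.
Qed.

Lemma laplaceD f g s : laplace_integrable f s -> laplace_integrable g s ->
  laplace_integrable (f \+ g) s /\ laplace (f \+ g) s = laplace f s + laplace g s.
Proof.
move=> lf lg; split.
  have := integrableD (measurable_itvR _) lf lg.
  by apply: eq_integrable => // t _ /=; rewrite mulrDr.
rewrite /laplace -RintegralD//; apply: eq_Rintegral => t _ /=.
by rewrite mulrDr.
Qed.

Lemma laplaceZ c f s : laplace_integrable f s ->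
  laplace_integrable (fun t => c * f t) s /\
  laplace (fun t => c * f t) s = c * laplace f s.
Proof.
move=> lf; split.
  have := integrableZl (measurable_itvR _) c lf.
  by apply: eq_integrable => // t _ /=; rewrite mulrCA.
rewrite /laplace -RintegralZl//; apply: eq_Rintegral => t _ /=.
by rewrite mulrCA.
Qed.

Lemma laplace_sum (I : Type) (r : seq I) (f : I -> R -> R) s :
  (forall i, laplace_integrable (f i) s) ->
  laplace_integrable (fun t => \sum_(i <- r) f i t) s /\
  laplace (fun t => \sum_(i <- r) f i t) s = \sum_(i <- r) laplace (f i) s.
Proof.
move=> lf; elim: r => [|i r [IH1 IH2]].
  rewrite big_nil (_ : (fun t => _) = cst 0); last first.
    by apply/funext => t; rewrite big_nil.
  split.
    rewrite /laplace_integrable (_ : EFin \o _ = cst 0%E); first exact: integrable0.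
    by apply/funext => t /=; rewrite mulr0.
  rewrite /laplace; under eq_Rintegral do rewrite mulr0.
  by rewrite Rintegral_cst// mul0r.
have -> : (fun t => \sum_(j <- (i :: r)) f j t) = f i \+ (fun t => \sum_(j <- r) f j t).
  by apply/funext => t; rewrite big_cons.
have [? ->] := laplaceD (lf i) IH1.
by rewrite big_cons IH2.
Qed.

(** Comes from the total mass 1 of the exponential density of rate [s]. *)
Lemma laplace1 s : 0 < s -> laplace_integrable (cst 1) s /\ laplace (cst 1) s = s^-1.
Proof.
move=> s0.
have E : (\int[mu]_(t in pos) (expR (- (s * t)) * 1)%:E = s^-1%:E)%E.
  have := integral_exponential_pdf s0.
  have -> : (\int[mu]_x (exponential_pdf s x)%:E =
    \int[mu]_(x in pos) (s * (expR (- (s * x)) * 1))%:E)%E.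
    rewrite integral_itv_obnd_cbnd; last first.
      apply/measurable_EFinP; apply: measurable_funM => //.
      by apply: measurable_funM => //; exact: measurable_expNM.
    rewrite [in RHS]integral_mkcond; apply: eq_integral => x _.
    rewrite /exponential_pdf restrict_EFin; congr EFin.
    by rewrite !patchE mulr1 mulNr.
  under eq_integral do rewrite EFinM.
  rewrite ge0_integralZl//; last 2 first.
  - apply/measurable_EFinP.
    by apply: measurable_funM => //; exact: measurable_expNM.
  - by rewrite lee_fin ltW.
  have : (0 <= \int[mu]_(x in pos) (expR (- (s * x)) * 1)%:E)%E.
    by apply: integral_ge0 => t _; rewrite lee_fin mulr1 expR_ge0.
  case: (integral _ _ _) => //= [r r0|_].
    by move=> [] sr; congr EFin; rewrite -[LHS](mulKf (lt0r_neq0 s0)) sr mulr1.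
  by rewrite gt0_muley ?lte_fin.
split; last by rewrite /laplace /Rintegral E.
apply/integrableP; split.
  apply/measurable_EFinP; apply: measurable_funM => //; exact: measurable_expNM.
under eq_integral do rewrite /= mulr1 ger0_norm ?expR_ge0//.
rewrite (_ : (\int[mu]_(x in pos) _ = (s^-1)%:E)%E) ?ltry// -E.
by apply: eq_integral => t _; rewrite mulr1.
Qed.

Definition bounded_on_pos f (M : R) := forall t, 0 < t -> `|f t| <= M.

Lemma laplace_integrable_bounded f M s : 0 < s -> measurable_fun pos f ->
  bounded_on_pos f M -> laplace_integrable f s.
Proof.
move=> s0 mf fM.
have [h _] := laplaceZ M (laplace1 s0).1.
apply: le_integrable h => //.
  apply/measurable_EFinP; apply: measurable_funM => //; exact: measurable_expNM.
move=> t; rewrite /= in_itv /= andbT => t0; rewrite lee_fin mulr1 !normrM.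
by rewrite ler_wpM2l// (le_trans (fM _ t0))// ler_norm.
Qed.

(* Translation invariance gives the factor e^(-s r) L K (s) for the integral in t. *)
Lemma laplace_hconv K h s : measurable_fun pos K -> measurable_fun pos h ->
  (forall t, 0 < t -> 0 <= K t) ->
  laplace_integrable K s -> laplace_integrable h s ->
  (forall t, 0 < t -> mu.-integrable `]0, t[ (EFin \o (fun r => K (t - r) * h r))) ->
  laplace_integrable (hconv K h) s /\
  laplace (hconv K h) s = laplace K s * laplace h s.
Proof.
move=> mK mh K0 lK lh Kh.
have Kp0 t : 0 <= (K \_ pos) t by rewrite patch_posE; case: ifPn => // /K0.
have mKp := measurable_patch_pos mK.
have c0 t : ~~ (0 < t) -> hconv K h t = 0.
  move=> t0; rewrite /hconv set_itv_ge ?Rintegral_set0//.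
have [|||i e] := @fubini_conv R (fun t => expR (- (s * t))) (K \_ pos) (h \_ pos)
   (fun r => laplace K s * expR (- (s * r))) (@measurable_expNM s setT) mKp
  (measurable_patch_pos mh) (fun t => expR_ge0 _) Kp0.
- move=> r; rewrite EFinM.
  have /laplace_integrable_patch lK' := lK.
  rewrite laplace_patch /Rintegral fineK; last exact: integrable_fin_num.
  rewrite [X in _ = (X * _)%E](@ge0_integral_affine R 1 (- r))//; last 2 first.
  + by apply/measurable_EFinP; apply: measurable_funM => //; exact: measurable_expNM.
  + by move=> x _; rewrite lee_fin mulr_ge0 ?expR_ge0.
  rewrite normr1 mul1e preimage_setT muleC -ge0_integralZl//; last 2 first.
  + apply/measurable_EFinP; apply: (@measurableT_comp _ _ _ _ _ _
      (fun x => expR (- (s * x)) * (K \_ pos) x) _ (fun x : R => 1 * x + - r)).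
      by apply: measurable_funM => //; exact: measurable_expNM.
    exact: measurable_affine.
  + by move=> x _; rewrite lee_fin mulr_ge0 ?expR_ge0.
  apply: eq_integral => t _; rewrite -EFinM mul1r mulrA -expRD.
  by congr (_ * _)%:E; congr expR; ring.
- have /laplace_integrable_patch := lh.
  move=> /(integrableZl measurableT (laplace K s)).
  by apply: eq_integrable => // r _ /=; congr EFin; ring.
- move=> t _; apply: integrable_conv_patch.
  have [t0|t0] := ltP 0 t; first exact: Kh.
  rewrite set_itv_ge; first exact: integrable_set0.
  by rewrite bnd_simp -leNgt.
have E t : convolution (K \_ pos) (h \_ pos) t = (hconv K h \_ pos) t.
  by rewrite hconvE patch_posE; case: ifPn => // /c0.
split.
  apply/laplace_integrable_patch; apply: eq_integrable i => // t _ /=.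
  by rewrite E.
rewrite laplace_patch; under eq_Rintegral do rewrite -E.
rewrite e (laplace_patch h) -RintegralZl//; last exact/laplace_integrable_patch.
by apply: eq_Rintegral => r _; ring.
Qed.
End halfline.

(** * The Laplace transform of a Caputo derivative *)

Section fractional_kernel.
Context {R : realType}.
Local Notation mu := (@lebesgue_measure R).
Local Notation pos := (`]0, +oo[%classic : set R).
Implicit Types (K h f g : R -> R).

Lemma preimage_affine_pos (c : R) : 0 < c -> (fun x : R => c * x + 0) @^-1` pos = pos.
Proof.
by move=> c0; apply/seteqP; split => x /=; rewrite !in_itv /= !andbT addr0 pmulr_rgt0.
Qed.

Lemma integral_patch_mul g y : mu.-integrable `]0, y[ (EFin \o g) ->
  (\int[mu]_x ((g \_ pos) x * ((cst 1 : R -> R) \_ pos) (y - x))%:E =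
   (\int[mu]_(x in `]0, y[) g x)%:E)%E.
Proof.
move=> ig; rewrite /Rintegral fineK; last exact: integrable_fin_num.
rewrite [RHS]integral_mkcond; apply: eq_integral => x _.
rewrite restrict_EFin; congr EFin.
have := @conv_patchE R (cst 1) g y x; rewrite mulrC => ->.
by congr (_ \_ _); apply/funext => z; rewrite /= mul1r.
Qed.

Lemma le_Rintegral_itv0 g y z : (forall t, 0 < t -> 0 <= g t) -> y <= z ->
  mu.-integrable `]0, z[ (EFin \o g) ->
  \int[mu]_(x in `]0, y[) g x <= \int[mu]_(x in `]0, z[) g x.
Proof.
move=> g0 yz ig.
have yzS : `]0, y[%classic `<=` (`]0, z[%classic : set R).
  by move=> x /=; rewrite !in_itv /= => /andP[-> /lt_le_trans]; exact.
have ig' : mu.-integrable `]0, y[ (EFin \o g).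
  exact: (@integrableS _ _ _ mu `]0, z[ _ _ (measurable_itvR _) (measurable_itvR _)).
apply: fine_le.
- exact: integrable_fin_num.
- exact: integrable_fin_num.
apply: ge0_subset_integral => //.
- exact: measurable_int ig.
- by move=> x /=; rewrite in_itv /= => /andP[/g0 ? _]; rewrite lee_fin.
Qed.

(** Both sides equal the integral of [h s * G (T - s)], where [G] is the primitive of [g]. This is
    what allows a Caputo equation to be integrated under its kernel; [h] may change sign. *)
Lemma hconv_one_comm g h T : 0 < T -> measurable_fun pos g -> measurable_fun pos h ->
  (forall t, 0 < t -> 0 <= g t) ->
  (forall t, 0 < t -> mu.-integrable `]0, t[ (EFin \o g)) ->
  (forall t, 0 < t -> mu.-integrable `]0, t[ (EFin \o h)) ->
  (forall t, 0 < t -> mu.-integrable `]0, t[ (EFin \o (fun s => g (t - s) * h s))) ->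
  hconv g (hconv (cst 1) h) T = hconv (cst 1) (hconv g h) T.
Proof.
move=> T0 mg mh g0 ig ih igh.
pose G x := \int[mu]_(t in `]0, x[) g t.
have ig' y : mu.-integrable `]0, y[ (EFin \o g).
  have [/ig //|y0] := ltP 0 y.
  by rewrite set_itv_ge ?bnd_simp -?leNgt//; exact: integrable_set0.
have ih' y : mu.-integrable `]0, y[ (EFin \o h).
  have [/ih //|y0] := ltP 0 y.
  by rewrite set_itv_ge ?bnd_simp -?leNgt//; exact: integrable_set0.
have igh' y : mu.-integrable `]0, y[ (EFin \o (fun s => g (y - s) * h s)).
  have [/igh //|y0] := ltP 0 y.
  by rewrite set_itv_ge ?bnd_simp -?leNgt//; exact: integrable_set0.
have G_nd x y : x <= y -> G x <= G y by move=> xy; exact: le_Rintegral_itv0.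
have G0 x : x <= 0 -> G x = 0.
  by move=> x0; rewrite /G set_itv_ge ?Rintegral_set0// bnd_simp -leNgt.
have G_ge0 x : 0 <= G x.
  by apply: Rintegral_ge0 => t /=; rewrite in_itv /= => /andP[/g0].
pose one : R -> R := cst 1.
have mone : measurable_fun setT (one \_ pos).
  by apply: measurable_patch_pos; exact: measurable_cst.
have mgp := measurable_patch_pos mg.
have mhp := measurable_patch_pos mh.
have one0 t : 0 <= (one \_ pos) t by rewrite patch_posE; case: ifP.
have gp0 t : 0 <= (g \_ pos) t by rewrite patch_posE; case: ifPn => // /g0.
have mflip K : measurable_fun setT K -> measurable_fun setT (fun t : R => K (T - t)).
  by move=> mK; apply: measurableT_comp => //; exact: measurable_funB.
have iB : mu.-integrable setT (EFin \o (fun s => (h \_ pos) s * G (T - s))).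
  have ib : mu.-integrable setT (EFin \o (fun s => G T * (h \_ `]0, T[) s)).
    have := (integrable_mkcond _ (measurable_itvR _)).1 (ih' T).
    move=> /(integrableZl measurableT (G T)); apply: eq_integrable => // s _ /=.
    by rewrite restrict_EFin /= EFinM.
  apply: le_integrable ib => //.
    apply/measurable_EFinP; apply: measurable_funM => //; apply: mflip.
    exact: nondecreasing_measurable.
  move=> s _ /=; rewrite lee_fin patch_posE patch_itvooE !normrM mulrC.
  rewrite (ger0_norm (G_ge0 _)) (ger0_norm (G_ge0 _)).
  have [s0|s0] /= := ltP 0 s; last by rewrite normr0 !mulr0.
  have [sT|sT] := ltP s T; last by rewrite G0 ?subr_le0// normr0 mulr0 mul0r.
  by rewrite ler_wpM2r// G_nd// lerBlDr lerDl ltW.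
have k1 t : mu.-integrable setT (EFin \o (fun s => (one \_ pos) (t - s) * (h \_ pos) s)).
  apply: integrable_conv_patch.
  by apply: eq_integrable (ih' t) => // s _ /=; rewrite mul1r.
have k2 t := integrable_conv_patch (igh' t).
have F1 s : (\int[mu]_t ((g \_ pos) (T - t) * (one \_ pos) (t - s))%:E = (G (T - s))%:E)%E.
  rewrite -(integral_patch_mul (ig' (T - s))) [RHS](@ge0_integral_affine R (-1) T)//.
  - rewrite normrN1 mul1e preimage_setT; apply: eq_integral => t _.
    by congr (_ * _)%:E; [congr (_ \_ _)|congr ((_ \_ _) _)]; ring.
  - apply/measurable_EFinP; apply: measurable_funM => //.
    by apply: (measurableT_comp mone); exact: measurable_funB.
  - by move=> x _; rewrite lee_fin mulr_ge0.
have F2 s : (\int[mu]_t ((one \_ pos) (T - t) * (g \_ pos) (t - s))%:E = (G (T - s))%:E)%E.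
  rewrite -(integral_patch_mul (ig' (T - s))) [RHS](@ge0_integral_affine R 1 (- s))//.
  - rewrite normr1 mul1e preimage_setT; apply: eq_integral => t _.
    rewrite mulrC; congr (_ * _)%:E; [congr (_ \_ _)|congr ((_ \_ _) _)]; ring.
  - apply/measurable_EFinP; apply: measurable_funM => //.
    by apply: (measurableT_comp mone); exact: measurable_funB.
  - by move=> x _; rewrite lee_fin mulr_ge0.
have [_ e1] := fubini_conv (mflip _ mgp) mone mhp (fun t => gp0 _) one0 F1 iB (fun t _ => k1 t).
have [_ e2] := fubini_conv (mflip _ mone) mgp mhp (fun t => one0 _) gp0 F2 iB (fun t _ => k2 t).
transitivity (\int[mu]_t ((g \_ pos) (T - t) * convolution (one \_ pos) (h \_ pos) t)).
  rewrite -hconvE; apply: eq_Rintegral => t _; congr (_ * _).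
  rewrite hconvE patch_posE; case: ifPn => //; rewrite -leNgt => t0.
  by rewrite /hconv set_itv_ge ?Rintegral_set0// bnd_simp -leNgt.
rewrite e1 -e2 -hconvE; apply: eq_Rintegral => t _; congr (_ * _).
rewrite hconvE patch_posE; case: ifPn => //; rewrite -leNgt => t0.
by rewrite /hconv set_itv_ge ?Rintegral_set0// bnd_simp -leNgt.
Qed.

Lemma ftc2 (F f : R -> R) (a b : R) : a < b ->
  (forall x, a <= x <= b -> is_derive x 1 F (f x)) ->
  (forall x, a <= x <= b -> {for x, continuous f}) ->
  (\int[mu]_(x in `[a, b]) (f x)%:E = (F b - F a)%:E)%E.
Proof.
move=> ab dF cf.
have cF x : a <= x <= b -> {for x, continuous F}.
  move=> /dF xab; apply: differentiable_continuous.
  by apply/derivable1_diffP; exact: ex_derive.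
rewrite EFinB; apply: continuous_FTC2 => //.
- apply: continuous_in_subspaceT => x; rewrite inE /= in_itv /=; exact: cf.
- split.
  + move=> x; rewrite in_itv /= => /andP[/ltW ax /ltW xb].
    by apply: ex_derive; apply: dF; rewrite ax xb.
  + by apply/cvg_at_right_filter; apply: cF; rewrite lexx ltW.
  + by apply/cvg_at_left_filter; apply: cF; rewrite lexx ltW.
- move=> x; rewrite in_itv /= => /andP[/ltW ax /ltW xb].
  have xab : a <= x <= b by rewrite ax xb.
  by rewrite derive1E; have /@derive_val := dF x xab.
Qed.

Lemma continuous_powR (c x : R) : 0 < x -> {for x, continuous (fun y : R => y `^ c)}.
Proof.
move=> x0; apply: differentiable_continuous; apply/derivable1_diffP.
by apply: ex_derive; exact: is_derive1_powR.
Qed.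

Lemma integrable_powR (c t : R) : -1 < c -> 0 < t ->
  mu.-integrable `]0, t[ (EFin \o (fun x : R => x `^ c)).
Proof.
move=> c1 t0; have a0 : 0 < c + 1 by lra.
have mp D : measurable_fun D (EFin \o (fun x : R => x `^ c)).
  by apply/measurable_EFinP; apply: measurable_funTS; exact: measurable_powR.
suff le : (\int[mu]_(x in (`]0%R, t] : set R)) (x `^ c)%:E <= (t `^ (c + 1) / (c + 1))%:E)%E.
  apply: (@integrableS _ _ _ mu `]0, t] _ _ (measurable_itvR _) (measurable_itvR _)).
    by move=> x /=; rewrite !in_itv /= => /andP[-> /ltW].
  apply/integrableP; split; first exact: mp.
  apply: le_lt_trans (ltry (t `^ (c + 1) / (c + 1))); apply: le_trans le.
  by under eq_integral do rewrite /= ger0_norm ?powR_ge0//.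
pose F (n : nat) : set R := `[t / n.+1%:R, t]%classic.
have UF : \bigcup_n F n = `]0, t]%classic.
  apply/seteqP; split => x /=.
    move=> [n _]; rewrite /F /= !in_itv /= => /andP[tx ->]; rewrite andbT.
    by apply: lt_le_trans tx; rewrite divr_gt0.
  rewrite in_itv /= => /andP[x0 xt].
  exists (Num.truncn (t / x)) => //; rewrite /F /= in_itv /= xt andbT.
  rewrite ler_pdivrMr// mulrC -ler_pdivrMr//.
  by rewrite ltW// truncnS_gt.
have ndF : nondecreasing_seq F.
  apply/nondecreasing_seqP => n; rewrite subsetEset => x; rewrite /F /= !in_itv /=.
  move=> /andP[tx ->]; rewrite andbT; apply: le_trans tx.
  by rewrite ler_pM2l// lef_pV2 ?posrE// ler_nat.
have cvgF := @ge0_nondecreasing_set_cvg_integral _ (measurableTypeR R) R F (fun x => (x `^ c)%:E) mu ndF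
  (fun n => measurable_itvR _) (fun n => mp _) (fun n x _ => powR_ge0 _ _).
rewrite UF in cvgF.
apply: (cvge_le _ cvgF); apply: nearW => n.
(* For n = 0 the interval is the single point t, to which [ftc2] does not apply. *)
case: n => [|n].
  rewrite /F divr1 set_itv1 integral_set1 lee_fin divr_ge0 ?powR_ge0// ltW//.
have tn0 : 0 < t / n.+2%:R by rewrite divr_gt0.
pose G (x : R) := (c + 1)^-1 * x `^ (c + 1).
have E : (\int[mu]_(x in F n.+1) (x `^ c)%:E = (G t - G (t / n.+2%:R)%R)%:E)%E.
  apply: ftc2.
  - by rewrite ltr_pdivrMr// ltr_pMr// ltr1n.
  - move=> x /andP[tx _]; have x0 : 0 < x := lt_le_trans tn0 tx.
    have H := @is_deriveZ _ R^o R^o (fun x => x `^ (c + 1)) (c + 1)^-1 x 1 _ (is_derive1_powR (c + 1) x0).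
    apply: is_derive_eq H _.
    by rewrite /GRing.scale /= mulrA mulVf ?mul1r ?addrK// gt_eqF.
  - by move=> x /andP[tx _]; apply: continuous_powR; exact: lt_le_trans tx.
rewrite E lee_fin /G mulrC lerBlDr lerDl mulr_ge0 ?powR_ge0// invr_ge0 ltW//.
Qed.

(** Since [c <= 0], the integrand is at most x^c below 1 and at most e^(-s x) above 1. *)
Lemma laplace_integrable_powR (c s : R) : -1 < c <= 0 -> 0 < s ->
  laplace_integrable (fun x => x `^ c) s.
Proof.
move=> /andP[c1 c0] s0.
have i1 : mu.-integrable pos (EFin \o ((fun x : R => x `^ c) \_ `]0, 1[)).
  have := (integrable_mkcond _ (measurable_itvR _)).1 (integrable_powR c1 ltr01).
  rewrite restrict_EFin.
  exact: (@integrableS _ _ _ mu setT _ _ measurableT (measurable_itvR _)).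
have i2 := (laplace1 s0).1.
apply: le_integrable (integrableD (measurable_itvR _) i1 i2) => //.
  apply/measurable_EFinP; apply: measurable_funM; first exact: measurable_expNM.
  by apply: measurable_funTS; exact: measurable_powR.
move=> x /=; rewrite in_itv /= andbT => x0.
rewrite lee_fin mulr1 patch_itvooE x0 /= !ger0_norm ?addr_ge0 ?mulr_ge0 ?expR_ge0 ?powR_ge0//; last first.
  by case: ifP => // _; exact: powR_ge0.
have [x1|x1] := ltP x 1.
  rewrite ler_wpDr ?expR_ge0// ler_piMl ?powR_ge0// -expR0 ler_expR.
  by rewrite oppr_le0 mulr_ge0// ltW.
by rewrite add0r ler_piMr ?expR_ge0// -[leRHS](powRr0 x) ler_powR.
Qed.

Lemma laplace_powR (a s : R) : 0 < a <= 1 -> 0 < s ->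
  laplace (fun x => x `^ (a - 1)) s = Gamma a * s `^ (- a).
Proof.
move=> /andP[a0 a1] s0.
have c1 : -1 < a - 1 <= 0 by lra.
have i1 := laplace_integrable_powR c1 ltr01.
have i1' : mu.-integrable pos (EFin \o (fun x => x `^ (a - 1) * expR (- x))).
  by apply: eq_integrable i1 => // x _; rewrite /= mul1r mulrC.
rewrite /Gamma (@Rintegral_affine R s 0)//; last by rewrite gt_eqF.
rewrite preimage_affine_pos// gtr0_norm//.
under eq_Rintegral => x.
  rewrite inE /= in_itv /= andbT => x0.
  rewrite addr0 powRM ?ltW// -mulrA [_ * expR _]mulrC; over.
rewrite RintegralZl//; last exact: laplace_integrable_powR.
rewrite -/(laplace _ s) mulrA (mulr_powRB1 (ltW s0) a0) mulrC mulrA -powRD.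
  by rewrite addNr powRr0 mul1r.
by rewrite addNr eqxx gt_eqF.
Qed.

Lemma Gamma_gt0 (a : R) : 0 < a <= 1 -> 0 < Gamma a.
Proof.
move=> /andP[a0 a1].
have c1 : -1 < a - 1 <= 0 by lra.
have i1 := laplace_integrable_powR c1 ltr01.
have i1' : mu.-integrable pos (EFin \o (fun x => x `^ (a - 1) * expR (- x))).
  by apply: eq_integrable i1 => // x _; rewrite /= mul1r mulrC.
(* For a <= 1 the integrand is at least e^(-1) on ]0, 1[, an interval of length 1. *)
apply: (@lt_le_trans _ _ (expR (-1))); first exact: expR_gt0.
have i2 : mu.-integrable pos (EFin \o ((cst (expR (-1)) : R -> R) \_ `]0, 1[)).
  have : mu.-integrable `]0, 1[ (EFin \o (cst (expR (-1)) : R -> R)).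
    apply: measurable_bounded_integrable => //.
    by rewrite /= lebesgue_measure_itv /= lte_fin ltr01 ltry.
    exact: bounded_cst.
  move=> /(integrable_mkcond _ (measurable_itvR _)); rewrite restrict_EFin.
  exact: (@integrableS _ _ _ mu setT _ _ measurableT (measurable_itvR _)).
have -> : expR (-1) = \int[mu]_(x in pos) ((cst (expR (-1)) : R -> R) \_ `]0, 1[) x :> R.
  rewrite -Rintegral_mkcondr.
  rewrite (_ : pos `&` `]0, 1[ = `]0, 1[%classic); last first.
    by apply/seteqP; split => x /=; rewrite !in_itv /= andbT; [case|move=> /andP[-> ->]].
  rewrite Rintegral_cst// /= lebesgue_measure_itv /= lte_fin ltr01 /=.
  by rewrite subr0 mulr1.
apply: le_Rintegral => // x /=; rewrite in_itv /= andbT => x0.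
rewrite patch_itvooE x0 /=; case: ltP => x1; last by rewrite mulr_ge0 ?powR_ge0 ?expR_ge0.
rewrite -[leLHS]mul1r ler_pM ?expR_ge0//; last by rewrite ler_expR lerN2 ltW.
by rewrite -[leLHS](powRr0 x) ger_powR ?subr_le0// x0 ltW.
Qed.
End fractional_kernel.

Section caputo_laplace.
Context {R : realType}.
Local Notation mu := (@lebesgue_measure R).
Local Notation pos := (`]0, +oo[%classic : set R).
Implicit Types (f F g h v : R -> R) (t s B M : R).

Lemma caputo_order1 (b : R) : 0 < b <= 1 -> caputo_order b = 1%N.
Proof.
move=> /andP[b0 b1]; rewrite /caputo_order (@ceil_def _ b 1)//.
by rewrite subrr b0 b1.
Qed.

Lemma caputo_order2 (b : R) : 1 < b <= 2 -> caputo_order b = 2%N.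
Proof.
move=> /andP[b0 b1]; rewrite /caputo_order (@ceil_def _ b 2)//.
by rewrite b0.
Qed.

Lemma measurable_pos_itv f : (forall t, 0 < t -> measurable_fun `]0, t[ f) ->
  measurable_fun pos f.
Proof.
move=> mf; have -> : pos = \bigcup_n `]0, n.+1%:R[.
  apply/seteqP; split => x /=; rewrite in_itv /= andbT.
    move=> x0; exists (Num.truncn x) => //=; rewrite in_itv /= x0 /=.
    exact: truncnS_gt.
  by move=> [n _] /=; rewrite in_itv /= => /andP[].
apply/measurable_fun_bigcup => // n; exact: mf.
Qed.

Lemma continuous_pos_measurable f : (forall t, 0 < t -> {for t, continuous f}) ->
  measurable_fun pos f.
Proof.
move=> cf; apply: open_continuous_measurable_fun; first exact: interval_open.
by move=> t; rewrite inE /= in_itv /= andbT => /cf.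
Qed.

Lemma integrable_itv_bounded v t B : measurable_fun `]0, t[ v ->
  (forall r, 0 < r < t -> `|v r| <= B) -> mu.-integrable `]0, t[ (EFin \o v).
Proof.
move=> mv vB; apply: measurable_bounded_integrable => //.
  by rewrite /= lebesgue_measure_itv /=; case: ifP => // _; rewrite -EFinB ltry.
exists B; split; first exact: num_real.
by move=> y By x /=; rewrite in_itv /= => /vB /le_trans; apply; exact: ltW.
Qed.

Lemma integrable_cc_oo h t : mu.-integrable `[0, t] (EFin \o h) ->
  mu.-integrable `]0, t[ (EFin \o h).
Proof.
apply: (@integrableS _ _ _ mu `[0, t] _ _ (measurable_itvR _) (measurable_itvR _)).
by move=> x /=; rewrite !in_itv /= => /andP[/ltW -> /ltW].
Qed.

Lemma Rintegral_cc_oo h t : mu.-integrable `[0, t] (EFin \o h) ->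
  \int[mu]_(x in `[0, t]) h x = \int[mu]_(x in `]0, t[) h x.
Proof.
move=> ih; rewrite -Rintegral_itv_obnd_cbnd; last first.
  apply: (@integrableS _ _ _ mu `[0, t] _ _ (measurable_itvR _) (measurable_itvR _)) ih.
  by move=> x /=; rewrite !in_itv /= => /andP[/ltW -> ->].
by rewrite -Rintegral_itv_bndo_bndc//; exact: integrable_cc_oo.
Qed.

Lemma eq_hconv g v w t : (forall r, 0 < r < t -> v r = w r) -> hconv g v t = hconv g w t.
Proof.
by move=> vw; apply: eq_Rintegral => r; rewrite inE /= in_itv /= => /vw ->.
Qed.

Local Notation I := (hconv (cst 1)).

Lemma hconv1E h t : I h t = \int[mu]_(x in `]0, t[) h x.
Proof. by apply: eq_Rintegral => r _; rewrite mul1r. Qed.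

Lemma locally_abs_contE c0 f t : locally_abs_cont c0 f -> 0 < t ->
  f t - c0 = I (derive1 f) t.
Proof.
by move=> acf /acf[i ->]; rewrite addrC addKr hconv1E Rintegral_cc_oo.
Qed.

Lemma locally_abs_cont_continuous c0 f t : locally_abs_cont c0 f -> 0 < t ->
  {for t, continuous f}.
Proof.
(* The point [t] has to be interior to the interval of integration, hence the endpoint 2 t. *)
move=> acf t0; have t20 : 0 < t + t by rewrite addr_gt0.
have [i _] := acf (t + t) t20.
have := parameterized_integral_continuous (ltW t20) i.
move=> /continuous_within_itvP => /(_ t20)[+ _ _] => /(_ t).
rewrite in_itv /= t0 ltrDl t0 => /(_ isT) cI.
have E x : 0 < x -> c0 + parameterized_integral mu 0 x (derive1 f) = f x.
  by move=> x0; rewrite /parameterized_integral; have [_ <-] := acf x x0.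
rewrite /prop_for /continuous_at -(E t t0).
apply: cvg_trans (cvgD (cvg_cst c0) cI); apply: near_eq_cvg.
have : \forall x \near t, 0 < x by exact: lt_nbhsr.
by apply: filterS => x x0; rewrite -E.
Qed.

Lemma laplace_I v s : 0 < s -> measurable_fun pos v -> laplace_integrable v s ->
  (forall t, 0 < t -> mu.-integrable `]0, t[ (EFin \o v)) ->
  laplace_integrable (I v) s /\ laplace (I v) s = laplace v s / s.
Proof.
move=> s0 mv lv iv.
have [||l e] := @laplace_hconv R (cst 1) v s (measurable_cst _) mv _ (laplace1 s0).1 lv.
- by [].
- by move=> t t0; apply: eq_integrable (iv t t0) => // r _; rewrite /= mul1r.
by split=> //; rewrite e (laplace1 s0).2 mulrC.
Qed.

Lemma laplace_integrable_measurable v s : laplace_integrable v s -> measurable_fun pos v.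
Proof.
move=> /measurable_int /measurable_EFinP mv.
have : measurable_fun pos (fun t => expR (s * t) * (expR (- (s * t)) * v t)).
  apply: measurable_funM => //; apply: measurable_funTS.
  by apply: measurableT_comp => //; exact: measurable_funM.
congr measurable_fun; apply/funext => t.
by rewrite mulrA -expRD addrN expR0 mul1r.
Qed.

Lemma measurable_pos_oo v t : measurable_fun pos v -> measurable_fun (`]0, t[ : set R) v.
Proof.
by apply: measurable_funS => // x /=; rewrite !in_itv /= => /andP[->].
Qed.

Lemma I_bounded v t B : measurable_fun pos v -> 0 < t ->
  (forall r, 0 < r < t -> `|v r| <= B) -> `|I v t| <= B * t.
Proof.
move=> mv t0 vB; rewrite hconv1E.
have iv := integrable_itv_bounded (@measurable_pos_oo v t mv) vB.
apply: (le_trans (le_normr_Rintegral _ iv)) => //.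
have -> : B * t = \int[mu]_(x in `]0, t[) B.
  by rewrite Rintegral_cst// /= lebesgue_measure_itv /= lte_fin t0 /= subr0.
apply: le_Rintegral => //.
- exact: integrable_norm.
- apply: (@integrable_itv_bounded _ _ `|B|) => //.
Qed.

Lemma integrable_flip_mul g v t B : 0 < t ->
  mu.-integrable `]0, t[ (EFin \o g) -> measurable_fun `]0%R, t[%classic v ->
  (forall r, 0 < r < t -> `|v r| <= B) ->
  mu.-integrable `]0, t[ (EFin \o (fun r => g (t - r) * v r)).
Proof.
move=> t0 ig mv vB.
have ig' : mu.-integrable `]0, t[ (EFin \o (fun r => g (t - r))).
  have N1 : (-1 : R) != 0 by rewrite oppr_eq0 oner_neq0.
  have := @integrable_affine R (-1) t _ _ N1 (measurable_itv _) ig.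
  rewrite (_ : _ @^-1` _ = `]0, t[%classic); last first.
    by apply/seteqP; split => x /=; rewrite !in_itv /= => /andP[? ?]; apply/andP; split; lra.
  by apply: eq_integrable => // r _ /=; congr (g _)%:E; ring.
have := integrableZl (measurable_itvR _) B ig'.
apply: le_integrable => //.
  apply/measurable_EFinP; apply: measurable_funM => //.
  by have /measurable_int /measurable_EFinP := ig'.
move=> r /=; rewrite in_itv /= => /vB vrB; rewrite lee_fin !normrM mulrC.
by rewrite ler_wpM2r// (le_trans vrB)// ler_norm.
Qed.

Lemma kernel_exponent (a : R) : 0 < a <= 1 -> -1 < a - 1 <= 0.
Proof. lra. Qed.

(** The derivative [h] of order m is only locally integrable and may have no transform, so the
    equation is first integrated m times. This replaces [h] by [v = f - c 0], which is bounded and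
    equals the m-fold integral of [h], because [c 1] vanishes when m = 2. If b = m, the m-fold
    integral of [F] is [v] itself; otherwise it is the convolution of [v] with a power kernel. *)
Lemma caputo_laplace (b : R) (c : nat -> R) f F s M M' : 0 < b <= 2 -> 0 < s ->
  caputo_ivp b c f F -> ((1 < caputo_order b)%N -> c 1%N = 0) ->
  bounded_on_pos f M -> measurable_fun pos F -> bounded_on_pos F M' ->
  s `^ b * (laplace f s - c 0%N / s) = laplace F s.
Proof.
move=> /andP[b0 b2] s0 [ac ci cF] c1 fM mF FM.
pose m := caputo_order b.
have m12 : m = 1%N \/ m = 2%N.
  have [b1|b1] := leP b 1; [left; apply: caputo_order1; lra|right; apply: caputo_order2; lra].
have m0 : (0 < m)%N by case: m12 => ->.
have acf : locally_abs_cont (c 0%N) f by exact: (ac 0%N).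
pose h := derive1n m f.
have ih0 t : 0 < t -> mu.-integrable `[0, t] (EFin \o h).
  move=> t0; case: m12 => mE; rewrite /h mE.
    by have [] := acf t t0.
  have [] := ac 1%N _ t t0; by rewrite -/m ?mE.
have ih t : 0 < t -> mu.-integrable `]0, t[ (EFin \o h).
  by move=> t0; apply: integrable_cc_oo; exact: ih0.
have mh : measurable_fun pos h.
  by apply: measurable_pos_itv => t /ih /measurable_int /measurable_EFinP.
have mf : measurable_fun pos f.
  by apply: continuous_pos_measurable => t; exact: locally_abs_cont_continuous acf.
pose v t := f t - c 0%N.
have mv : measurable_fun pos v by exact: measurable_funB.
have vM t : 0 < t -> `|v t| <= M + `|c 0%N|.
  by move=> t0; rewrite (le_trans (ler_normB _ _))// lerD2r fM.
have lf := laplace_integrable_bounded s0 mf fM.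
have lv := laplace_integrable_bounded s0 mv vM.
have lvE : laplace v s = laplace f s - c 0%N / s.
  have [l1 e1] := laplaceZ (- c 0%N) (laplace1 s0).1.
  have [_] := laplaceD lf l1; rewrite e1 (laplace1 s0).2 mulNr => <-.
  by apply: eq_laplace => t _ /=; rewrite mulr1.
rewrite -lvE.
have iF t : 0 < t -> mu.-integrable `]0, t[ (EFin \o F).
  move=> t0; apply: (@integrable_itv_bounded _ _ M'); first exact: measurable_pos_oo.
  by move=> r /andP[r0 _]; exact: FM.
have lF := laplace_integrable_bounded s0 mF FM.
have [lIF LIF] := laplace_I s0 mF lF iF.
have mIF : measurable_fun pos (I F) by exact: laplace_integrable_measurable lIF.
have iIF t : 0 < t -> mu.-integrable `]0, t[ (EFin \o I F).
  move=> t0; apply: (@integrable_itv_bounded _ _ (`|M'| * t)); first exact: measurable_pos_oo.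
  move=> r /andP[r0 rt]; apply: (@le_trans _ _ (`|M'| * r)).
    apply: I_bounded => // x /andP[x0 _]; apply: (le_trans (FM _ x0)); exact: ler_norm.
  by rewrite ler_wpM2l// ltW.
have [lIIF LIIF] := laplace_I s0 mIF lIF iIF.
have sn0 : s != 0 by rewrite gt_eqF.
have LIm : laplace (iter m I F) s = laplace F s / s ^+ m.
  case: m12 => ->; rewrite /= ?LIF ?LIIF ?LIF//.
  by rewrite expr2; field.
have ivm : forall t, 0 < t -> v t = iter m I h t.
  move=> t t0; rewrite /v (locally_abs_contE acf t0).
  case: m12 => mE; rewrite /h mE //=.
  apply: eq_hconv => r /andP[r0 _].
  have := locally_abs_contE (ac 1%N _) r0; rewrite c1 -/m ?mE// subr0.
  exact.
have [bm|bm] := eqVneq b m%:R.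
  have Fh t : 0 < t -> F t = h t.
    by move=> t0; rewrite -(cF t t0) /caputo -/m bm eqxx.
  have vI t : 0 < t -> v t = iter m I F t.
    move=> t0; rewrite ivm//; case: m12 => -> /=; apply: eq_hconv => r /andP[r0 _].
      by rewrite Fh.
    by apply: eq_hconv => x /andP[x0 _]; rewrite Fh.
  rewrite (eq_laplace _ vI) LIm {1}bm powR_mulrn ?ltW// mulrC divfK//.
  by rewrite expf_neq0.
pose a := m%:R - b.
have a01 : 0 < a <= 1.
  rewrite /a; case: m12 => mE; rewrite mE.
    have b1 : b <= 1.
      by rewrite leNgt; apply/negP => b1; move: mE; rewrite /m caputo_order2// b1.
    rewrite subr_gt0 lt_neqAle b1; move: bm; rewrite mE => -> /=.
    by rewrite gerBl ltW.
  have b1 : 1 < b.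
    rewrite ltNge; apply/negP => b1; move: mE; rewrite /m caputo_order1// b0//.
  rewrite subr_gt0 lt_neqAle b2; move: bm; rewrite mE => -> /=.
  by rewrite lerBlDr (le_trans _ (lerD (lexx 1) (ltW b1))).
have Ga := Gamma_gt0 a01.
have /andP[a0 a1] := a01.
(* The Riemann-Liouville kernel of order a = m - b, whose transform is s^(-a); [F] is its
   convolution with [h]. *)
pose g (x : R) := (Gamma a)^-1 * x `^ (a - 1).
have a1' : -1 < a - 1 <= 0 := kernel_exponent a01.
have /andP[a1'' _] := a1'.
have g0 t : 0 < t -> 0 <= g t by move=> _; rewrite /g mulr_ge0 ?powR_ge0// invr_ge0 ltW.
have mg : measurable_fun pos g.
  by apply: measurable_funM => //; apply: measurable_funTS; exact: measurable_powR.
have ig t : 0 < t -> mu.-integrable `]0, t[ (EFin \o g).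
  move=> t0; have := integrableZl (measurable_itvR _) (Gamma a)^-1 (integrable_powR a1'' t0).
  by apply: eq_integrable.
have lg : laplace_integrable g s.
  exact: (laplaceZ _ (laplace_integrable_powR a1' s0)).1.
have Lg : laplace g s = s `^ (- a).
  rewrite (laplaceZ _ (laplace_integrable_powR a1' s0)).2.
  by rewrite laplace_powR// mulrA mulVf ?mul1r// gt_eqF.
have igh t : 0 < t -> mu.-integrable `]0, t[ (EFin \o (fun r => g (t - r) * h r)).
  move=> t0; have := ci bm t t0 => /integrable_cc_oo.
  move=> /(integrableZl (measurable_itvR _) (Gamma a)^-1).
  by apply: eq_integrable => // r _ /=; rewrite /caputo_integrand /g -mulrA.
have Fg t : 0 < t -> F t = hconv g h t.
  move=> t0; rewrite -(cF t t0) /caputo -/m (negbTE bm) Rintegral_cc_oo; last exact: ci.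
  rewrite -RintegralZl//; last exact/integrable_cc_oo/ci.
  by apply: eq_Rintegral => r _; rewrite /caputo_integrand /g -mulrA.
have IFE t : 0 < t -> I F t = hconv g (I h) t.
  move=> t0; rewrite hconv_one_comm//.
  by apply: eq_hconv => r /andP[r0 _]; rewrite Fg.
have vI t : 0 < t -> iter m I F t = hconv g v t.
  move=> t0; case: m12 => mE; rewrite mE /=.
    rewrite IFE//; apply: eq_hconv => r /andP[r0 _]; by rewrite ivm// mE.
  have mIh : measurable_fun pos (I h).
    have mf' : measurable_fun pos (derive1n 1 f).
      apply: continuous_pos_measurable => r.
      by apply: locally_abs_cont_continuous; apply: ac; rewrite -/m mE.
    apply: eq_measurable_fun mf' => r; rewrite inE /= in_itv /= andbT => r0.
    have := locally_abs_contE (ac 1%N _) r0; rewrite c1 -/m ?mE// subr0 /h mE.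
    exact.
  (* For m = 2 the commutation is used a second time, on [I h], the first derivative of [f]. Its
     local boundedness makes the product with the singular kernel integrable. *)
  have Ihb y : 0 < y -> exists B, forall r, 0 < r < y -> `|I h r| <= B.
    move=> y0; exists (\int[mu]_(x in `]0, y[) `|h x|) => r /andP[r0 ry].
    rewrite hconv1E; apply: (le_trans (le_normr_Rintegral _ (ih _ r0))) => //.
    apply: le_Rintegral_itv0 => //; first exact: ltW.
    exact/integrable_norm/ih.
  have iIh y : 0 < y -> mu.-integrable `]0, y[ (EFin \o I h).
    move=> y0; have [B IB] := Ihb y y0.
    by apply: integrable_itv_bounded IB; exact: measurable_pos_oo.
  have -> : I (I F) t = I (hconv g (I h)) t.
    by apply: eq_hconv => r /andP[r0 _]; exact: IFE.
  rewrite -hconv_one_comm//; last first.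
    move=> y y0; have [B IB] := Ihb y y0.
    by apply: integrable_flip_mul IB => //; [exact: ig|exact: measurable_pos_oo].
  by apply: eq_hconv => r /andP[r0 _]; rewrite ivm// mE.
have igv t : 0 < t -> mu.-integrable `]0, t[ (EFin \o (fun r => g (t - r) * v r)).
  move=> t0; apply: (@integrable_flip_mul _ _ _ (M + `|c 0%N|)) => //.
  - exact: ig.
  - exact: measurable_pos_oo.
  - by move=> r /andP[r0 _]; exact: vM.
have [_ Lgv] := laplace_hconv mg mv g0 lg lv igv.
have e : laplace F s / s ^+ m = s `^ (- a) * laplace v s.
  by rewrite -LIm -Lg -Lgv; exact: eq_laplace.
have -> : b = m%:R - a by rewrite /a; ring.
rewrite powRD; last by rewrite sn0 implybT.
rewrite powR_mulrn ?ltW// -mulrA -e mulrC divfK//.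
by rewrite expf_neq0.
Qed.
End caputo_laplace.

(** * Uniqueness of the Laplace transform *)

Section laplace_injective.
Context {R : realType}.
Local Notation mu := (@lebesgue_measure R).
Local Notation pos := (`]0, +oo[%classic : set R).
Implicit Types (f g h : R -> R) (t s M : R).

Lemma integrable_patch_itv (A : set (measurableTypeR R)) f (i : interval R) :
  measurable A -> mu.-integrable [set` i] (EFin \o f) ->
  mu.-integrable A (EFin \o (f \_ [set` i])).
Proof.
move=> mA /(integrable_mkcond _ (measurable_itvR _)); rewrite restrict_EFin.
exact: (@integrableS _ _ _ mu setT _ _ measurableT mA).
Qed.

(** In the variable y = e^(-t), the transform at 1 + i is the i-th moment of [h], so vanishing
    transforms at the positive integers already annihilate all polynomials in y. *)
Lemma laplace_poly h (p : {poly R}) M : measurable_fun pos h -> bounded_on_pos h M ->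
  (forall s, 0 < s -> laplace h s = 0) ->
  laplace_integrable (fun t => p.[expR (- t)] * h t) 1 /\
  laplace (fun t => p.[expR (- t)] * h t) 1 = 0.
Proof.
move=> mh hM L0.
have lh (i : nat) : laplace_integrable h (1 + i%:R).
  by apply: laplace_integrable_bounded mh hM; rewrite ltr_pwDl.
have E (i : nat) t : expR (- ((1 + i%:R) * t)) * h t =
    expR (- (1 * t)) * (expR (- t) ^+ i * h t).
  rewrite mulrA -expRM_natl -expRD; congr (expR _ * _); ring.
have le (i : nat) : laplace_integrable (fun t => expR (- t) ^+ i * h t) 1.
  by apply: eq_integrable (lh i) => // t _; rewrite /= E.
have Le (i : nat) : laplace (fun t => expR (- t) ^+ i * h t) 1 = 0.
  rewrite -(L0 (1 + i%:R)) ?ltr_pwDl//; apply: eq_Rintegral => t _.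
  by rewrite E.
have [l e] := @laplace_sum R _ (index_enum 'I_(size p))
  (fun i t => p`_i * (expR (- t) ^+ i * h t)) 1
  (fun i => (laplaceZ _ (le i)).1).
have pE t : \sum_(i <- index_enum 'I_(size p)) p`_i * (expR (- t) ^+ i * h t) =
    p.[expR (- t)] * h t.
  by rewrite horner_coef mulr_suml; apply: eq_bigr => i _; rewrite mulrA.
split.
  by apply: eq_laplace_integrable l => t _; rewrite pE.
have := e; rewrite big1; last by move=> i _; rewrite (laplaceZ _ (le i)).2 Le mulr0.
by move=> <-; apply: eq_laplace => t _; rewrite pE.
Qed.

(* The polynomial [1 - (y - y0)^2] in [y = exp (- t)] peaks exactly at [t0], so
   its powers concentrate the integral near [t0]. *)
Lemma laplace_eq0_le h M : (forall t, 0 < t -> {for t, continuous h}) ->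
  bounded_on_pos h M -> (forall s, 0 < s -> laplace h s = 0) ->
  forall t, 0 < t -> h t <= 0.
Proof.
move=> ch hM L0 t0 t00; rewrite leNgt; apply/negP => ht0.
have mh := continuous_pos_measurable ch.
pose y0 := expR (- t0).
pose eta := h t0 / 2.
have eta0 : 0 < eta by rewrite divr_gt0.
have y00 : 0 < y0 by exact: expR_gt0.
have y01 : y0 < 1 by rewrite /y0 expR_lt1 oppr_lt0.
(* The neighbourhood of [t0] on which [h] exceeds [eta] is measured in y = e^(-t), the variable of
   the polynomial; [dl < 1] keeps [q1] positive. *)
have [dl [dl0 dl1 dlh]] : exists dl, [/\ 0 < dl, dl < 1 &
    forall t, 0 < t -> `|expR (- t) - y0| < dl -> eta < h t].
  have clny : {for y0, continuous (fun y : R => h (- ln y))}.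
    apply: (@continuous_comp _ _ _ (fun y => - ln y) h).
      by apply: continuousN; exact: continuous_ln.
    by rewrite /y0 expRK opprK; exact: ch.
  have : \forall y \near y0, eta < h (- ln y).
    have e0 : h (- ln y0) > eta.
      by rewrite /y0 expRK opprK /eta ltr_pdivrMr// ltr_pMr// ltr1n.
    exact: (cvgr_gt _ clny).
  move=> /nbhs_ballP[e /= e0 He].
  exists (Num.min e (2^-1 : R)); split.
  - by rewrite lt_min e0 invr_gt0 ltr0n.
  - by rewrite gt_min invf_lt1// ltr1n orbT.
  - move=> t tp; rewrite lt_min => /andP[te _].
    have := He (expR (- t)); rewrite /ball /= expRK opprK; apply.
    by rewrite distrC.
have [ep [ep0 epy]] : exists ep, 0 < ep /\
    forall t, t0 <= t <= t0 + ep -> `|expR (- t) - y0| < dl / 2.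
  have : \forall t \near t0, `|expR (- t) - y0| < dl / 2.
    have c : {for t0, continuous (fun t : R => expR (- t))}.
      apply: (@continuous_comp _ _ _ (fun y => - y) expR); last exact: continuous_expR.
      by apply: continuousN; exact: cvg_id.
    have d20 : 0 < dl / 2 by rewrite divr_gt0.
    move/cvgrPdist_lt : c => /(_ _ d20); apply: filterS => t.
    by rewrite distrC.
  move=> /nbhs_ballP[e /= e0 He].
  exists (e / 2); split; first by rewrite divr_gt0.
  move=> t /andP[t0t tt0]; apply: He; rewrite /ball /= ltr_norml.
  apply/andP; split; lra.
(* With w = e^(-t) - y0, the polynomial 1 - w^2 is at most [q1] where |w| >= dl, and at least
   [q2 > q1] where |w| < dl / 2, in particular on [t0, t0 + ep]. *)
pose q1 : R := 1 - dl ^+ 2.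
pose q2 : R := 1 - (dl / 2) ^+ 2.
have q10 : 0 < q1 by rewrite /q1 subr_gt0 expr_lt1// ltW.
have q12 : q1 < q2.
  rewrite /q1 /q2 ltrD2l ltrN2 ltr_pXn2r ?nnegrE// ?ltW// ?divr_gt0//.
  by rewrite ltr_pdivrMr// ltr_pMr// ltr1n.
pose p : {poly R} := 1 - ('X - y0%:P) ^+ 2.
have pE t : p.[expR (- t)] = 1 - (expR (- t) - y0) ^+ 2.
  by rewrite /p !hornerE.
pose c := eta * expR (- (t0 + ep)).
have c0 : 0 < c by rewrite mulr_gt0 ?expR_gt0.
have M0 : 0 <= M by apply: le_trans (hM _ t00).
(* The integral of e^(-t) p^n h is 0. The window [t0, t0 + ep] contributes at least c ep q2^n, the
   remaining part of |w| < dl nothing negative, and the rest at least - M q1^n. Since q1 / q2 < 1,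
   this is impossible for large n. *)
have key n : c * ep * q2 ^+ n <= M * q1 ^+ n.
  have [li L] := laplace_poly (p ^+ n) mh hM L0.
  have i1 : mu.-integrable pos (EFin \o (fun t => c * q2 ^+ n *
      ((cst 1 : R -> R) \_ `[t0, t0 + ep]) t)).
    have : mu.-integrable `[t0, t0 + ep] (EFin \o (cst 1 : R -> R)).
      apply: measurable_bounded_integrable => //; last exact: bounded_cst.
      by rewrite /= lebesgue_measure_itv /=; case: ifP => // _; rewrite -EFinB ltry.
    move=> /(integrable_patch_itv (measurable_itvR (Interval (BRight 0) +oo%O))).
    exact: integrableZl.
  have i2 : mu.-integrable pos (EFin \o (fun t => M * q1 ^+ n * (expR (- (1 * t)) * 1))).
    by have := integrableZl (measurable_itvR _) (M * q1 ^+ n) (laplace1 (@ltr01 R)).1.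
  have I1 : \int[mu]_(t in pos) (c * q2 ^+ n * ((cst 1 : R -> R) \_ `[t0, t0 + ep]) t) =
      c * q2 ^+ n * ep.
    under eq_Rintegral => t _.
      rewrite (_ : c * q2 ^+ n * _ = ((cst (c * q2 ^+ n) : R -> R) \_ `[t0, t0 + ep]) t); last first.
        by rewrite !patchE; case: ifP; rewrite ?mulr1 ?mulr0.
      over.
    rewrite -Rintegral_mkcondr (_ : pos `&` _ = `[t0, t0 + ep]%classic); last first.
      apply/seteqP; split => x /=; rewrite !in_itv /= andbT; first by case.
      by move=> /andP[t0x ->]; rewrite t0x (lt_le_trans t00).
    rewrite Rintegral_cst// /= lebesgue_measure_itv /= lte_fin ltrDl ep0 /=.
    by rewrite addrAC subrr add0r.
  have I2 : \int[mu]_(t in pos) (M * q1 ^+ n * (expR (- (1 * t)) * 1)) = M * q1 ^+ n.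
    rewrite RintegralZl//; last exact: (laplace1 (@ltr01 R)).1.
    by have := (laplace1 (@ltr01 R)).2; rewrite /laplace => ->; rewrite invr1 mulr1.
  rewrite -subr_le0 -mulrA [ep * _]mulrC mulrA -I1 -[X in _ - X]I2 -RintegralB// -[leRHS]L.
  apply: le_Rintegral => //.
    by have := integrableB (measurable_itvR _) i1 i2; apply: eq_integrable.
  move=> t /=; rewrite in_itv /= andbT => tp.
  rewrite horner_exp pE.
  set w := expR (- t) - y0.
  have w1 : `|w| < 1.
    rewrite ltr_norml /w; have e1 := expR_gt0 (- t).
    have e2 : expR (- t) < 1 by rewrite expR_lt1 oppr_lt0.
    by apply/andP; split; lra.
  have w20 : 0 <= 1 - w ^+ 2 by rewrite subr_ge0 -real_normK ?num_real// expr_le1// ltW.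
  have et0 := expR_gt0 (- (1 * t)).
  have [wd|wd] := ltP `|w| dl.
    have ht := dlh t tp wd.
    apply: (@le_trans _ _ (c * q2 ^+ n * ((cst 1 : R -> R) \_ `[t0, t0 + ep]) t)).
      by rewrite gerBl !mulr_ge0// ?exprn_ge0 ?ltW.
    rewrite patchE; case: ifPn => [|_]; last first.
      by rewrite mulr0 !mulr_ge0 ?exprn_ge0// ?ltW//; exact: lt_trans ht.
    rewrite inE /= in_itv /= => ttt; rewrite mulr1.
    have q2w : q2 <= 1 - w ^+ 2.
      rewrite /q2 lerD2l lerN2 -(real_normK (num_real w)) lerXn2r ?nnegrE//.
        by rewrite divr_ge0// ltW.
      by rewrite ltW// epy.
    have q20 : 0 < q2 by exact: lt_trans q12.
    have q2n : q2 ^+ n * eta <= (1 - w ^+ 2) ^+ n * h t.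
      apply: ler_pM; [exact: exprn_ge0 (ltW q20)|exact: ltW| |exact: ltW].
      by rewrite lerXn2r ?nnegrE// ltW.
    have -> : c * q2 ^+ n = expR (- (t0 + ep)) * (q2 ^+ n * eta) by rewrite /c; ring.
    apply: ler_pM => //.
      by rewrite mulr_ge0 ?exprn_ge0 ?ltW.
    by rewrite ler_expR lerN2 mul1r; have /andP[] := ttt.
  rewrite patchE; case: ifPn => [|_].
    rewrite inE /= in_itv /= => /epy; rewrite -/w => w2.
    have dd : dl / 2 <= dl by rewrite ler_pdivrMr// ler_pMr// ler1n.
    by have := lt_le_trans w2 dd; rewrite ltNge wd.
  have Ah : - (M * q1 ^+ n) <= (1 - w ^+ 2) ^+ n * h t.
    rewrite lerNl -mulrN mulrC; apply: (@le_trans _ _ (M * (1 - w ^+ 2) ^+ n)).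
      by rewrite ler_wpM2r ?exprn_ge0// (le_trans _ (hM _ tp))// -normrN ler_norm.
    have wq : 1 - w ^+ 2 <= q1.
      by rewrite lerD2l lerN2 -(real_normK (num_real w)) lerXn2r ?nnegrE// ltW.
    by rewrite ler_wpM2l// lerXn2r ?nnegrE// ltW.
  by rewrite mulr0 sub0r mulr1 -mulNr mulrC ler_wpM2l// ltW.
have q20 : 0 < q2 by exact: lt_trans q12.
have z1 : `|q1 / q2| < 1 by rewrite ger0_norm ?divr_ge0 ?ltW// ltr_pdivrMr// mul1r.
have cz : (fun n => M * (q1 / q2) ^+ n) @ \oo --> M * 0.
  by apply: cvgMr; exact: cvg_expr.
have cep : M * 0 < c * ep by rewrite mulr0 mulr_gt0.
have [N _ HN] := cvgr_lt _ cz _ cep.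
have := HN N (leqnn N); rewrite /= ltNge => /negP; apply.
by rewrite expr_div_n mulrA ler_pdivlMr ?exprn_gt0.
Qed.

Lemma laplace_inj f g M M' : (forall t, 0 < t -> {for t, continuous f}) ->
  (forall t, 0 < t -> {for t, continuous g}) ->
  bounded_on_pos f M -> bounded_on_pos g M' ->
  (forall s, 0 < s -> laplace f s = laplace g s) ->
  forall t, 0 < t -> f t = g t.
Proof.
move=> cf cg fM gM fg.
have H u v N N' : (forall t, 0 < t -> {for t, continuous u}) ->
    (forall t, 0 < t -> {for t, continuous v}) ->
    bounded_on_pos u N -> bounded_on_pos v N' ->
    (forall s, 0 < s -> laplace u s = laplace v s) ->
    forall t, 0 < t -> u t <= v t.
  move=> cu cv uN vN uv t t0; rewrite -subr_le0.
  apply: (@laplace_eq0_le (fun t => u t - v t) (N + N')) t0.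
  - by move=> x x0; apply: continuousB; [exact: cu|exact: cv].
  - move=> x x0; apply: (le_trans (ler_normB _ _)); apply: lerD; [exact: uN|exact: vN].
  - move=> s s0.
    have lu := laplace_integrable_bounded s0 (continuous_pos_measurable cu) uN.
    have lv := laplace_integrable_bounded s0 (continuous_pos_measurable cv) vN.
    have [l1 e1] := laplaceZ (-1) lv.
    have [_] := laplaceD lu l1; rewrite e1 uv// mulN1r addrN => <-.
    by apply: eq_laplace => x _ /=; rewrite mulN1r.
move=> t t0; apply/eqP; rewrite eq_le; apply/andP; split.
  exact: (H f g M M').
by apply: (H g f M' M) => // s s0; rewrite fg.
Qed.
End laplace_injective.

(** * Smooth functions of compact support *)

Section smooth.
Context {R : realType}.
Local Notation mu := (@lebesgue_measure R).
Local Notation pos := (`]0, +oo[%classic : set R).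
Implicit Types (f g : R -> R) (x : R).

Definition deriv_of f f' := forall x : R, is_derive x (1 : R) f (f' x).

Lemma deriv_of_derive1 f f' : deriv_of f f' -> derive1 f = f'.
Proof. by move=> d; apply/funext => x; rewrite derive1E; have /@derive_val := d x. Qed.

Lemma deriv_of_continuous f f' x : deriv_of f f' -> {for x, continuous f}.
Proof.
move=> d; apply: differentiable_continuous; apply/derivable1_diffP.
by have /@ex_derive := d x.
Qed.

Lemma deriv_of_cst (c : R) : deriv_of (cst c) (cst 0).
Proof. by move=> x; exact: is_derive_cst. Qed.

Lemma deriv_ofD f f' g g' : deriv_of f f' -> deriv_of g g' ->
  deriv_of (fun x => f x + g x) (fun x => f' x + g' x).
Proof. by move=> df dg x; exact: (is_deriveD (df x) (dg x)). Qed.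

Lemma deriv_ofB f f' g g' : deriv_of f f' -> deriv_of g g' ->
  deriv_of (fun x => f x - g x) (fun x => f' x - g' x).
Proof. by move=> df dg x; exact: (is_deriveB (df x) (dg x)). Qed.

Lemma deriv_ofM f f' g g' : deriv_of f f' -> deriv_of g g' ->
  deriv_of (fun x => f x * g x) (fun x => f' x * g x + f x * g' x).
Proof.
move=> df dg x; apply: is_derive_eq (is_deriveM (df x) (dg x)) _.
by rewrite /GRing.scale /= addrC mulrC.
Qed.

Lemma deriv_ofZ (c : R) f f' : deriv_of f f' ->
  deriv_of (fun x => c * f x) (fun x => c * f' x).
Proof.
move=> df x; apply: is_derive_eq (deriv_ofM (deriv_of_cst c) df x) _.
by rewrite /= mul0r add0r.
Qed.

Lemma deriv_of_affine (c b : R) : deriv_of (fun x => c * x + b) (cst c).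
Proof.
move=> x; have d1 := deriv_ofZ c (fun x => is_derive_id x (1 : R)).
apply: is_derive_eq (deriv_ofD d1 (deriv_of_cst b) x) _.
by rewrite /= mulr1 addr0.
Qed.

Lemma deriv_of_comp_affine (c b : R) f f' : deriv_of f f' ->
  deriv_of (fun x => f (c * x + b)) (fun x => c * f' (c * x + b)).
Proof.
move=> df x; have := @is_derive1_comp R f (fun x => c * x + b) x _ _ (df (c * x + b)) (deriv_of_affine c b x).
by rewrite mulrC.
Qed.

Lemma deriv_of_expR (c : R) : deriv_of (fun x => expR (c * x)) (fun x => c * expR (c * x)).
Proof.
have -> : (fun x => expR (c * x)) = (fun x => expR (c * x + 0)).
  by apply/funext => x; rewrite addr0.
have -> : (fun x => c * expR (c * x)) = (fun x => c * expR (c * x + 0)).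
  by apply/funext => x; rewrite addr0.
exact: deriv_of_comp_affine (@is_derive_expR R).
Qed.

(** Carrying the derivatives as witnesses turns closure under sums, products and affine
    substitutions into plain inductions. The last derivative need not be continuous; continuity
    comes from the next level. *)
Fixpoint Cn (n : nat) f : Prop :=
  if n is n'.+1 then exists2 f', deriv_of f f' & Cn n' f' else True.

Definition smooth f := forall n, Cn n f.

Lemma CnSW n f : Cn n.+1 f -> Cn n f.
Proof.
elim: n f => [//|n IH] f [f' df cf]; exists f' => //; exact: IH.
Qed.

Lemma smooth_derivable f : smooth f ->
  forall (j : nat) (x : R), derivable (derive1n j f) x (1 : R).
Proof.
move=> sf j x; have := sf j.+1; elim: j f {sf} x => [|j IH] f x.
  by move=> [f' df _]; have /@ex_derive := df x.
move=> [f' df cf]; rewrite derive1Sn (deriv_of_derive1 df); exact: IH.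
Qed.

Lemma Cn_cst n (c : R) : Cn n (cst c).
Proof. by elim: n c => [//|n IH] c; exists (cst 0); [exact: deriv_of_cst|exact: IH]. Qed.

Lemma CnD n f g : Cn n f -> Cn n g -> Cn n (fun x => f x + g x).
Proof.
elim: n f g => [//|n IH] f g [f' df cf] [g' dg cg].
by exists (fun x => f' x + g' x); [exact: deriv_ofD|exact: IH].
Qed.

Lemma CnM n f g : Cn n f -> Cn n g -> Cn n (fun x => f x * g x).
Proof.
elim: n f g => [//|n IH] f g cf cg.
have cf0 := CnSW cf; have cg0 := CnSW cg.
move: cf cg => [f' df cf] [g' dg cg].
exists (fun x => f' x * g x + f x * g' x); first exact: deriv_ofM.
by apply: CnD; exact: IH.
Qed.

Lemma CnZ n (c : R) f : Cn n f -> Cn n (fun x => c * f x).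
Proof. by move=> cf; apply: CnM => //; exact: Cn_cst. Qed.

Lemma CnB n f g : Cn n f -> Cn n g -> Cn n (fun x => f x - g x).
Proof.
move=> cf cg; rewrite (_ : (fun x => _) = (fun x => f x + (-1) * g x)).
  by apply: CnD => //; exact: CnZ.
by apply/funext => x; rewrite mulN1r.
Qed.

Lemma Cn_comp_affine n (c b : R) f : Cn n f -> Cn n (fun x => f (c * x + b)).
Proof.
elim: n f => [//|n IH] f [f' df cf].
exists (fun x => c * f' (c * x + b)); first exact: deriv_of_comp_affine.
by apply: CnZ; exact: IH.
Qed.

Lemma Cn_expR n (c : R) : Cn n (fun x => expR (c * x)).
Proof.
elim: n => [//|n IH]; exists (fun x => c * expR (c * x)); first exact: deriv_of_expR.
exact: CnZ.
Qed.

(* The factor x^-m makes the family closed under differentiation up to linear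
   combinations. *)
Definition flat (m : nat) (x : R) : R :=
  if 0 < x then (x^-1) ^+ m * expR (- x^-1) else 0.

(** With y = 1 / x and k = m + 1, the inequality y / k <= e^(y / k) raised to the power k gives y^k
    e^(-y) <= k^k. This is one power of y more than [flat m] contains, and that power supplies the
    factor x. *)
Lemma flat_bound m x : 0 < x -> flat m x <= m.+1%:R ^+ m.+1 * x.
Proof.
move=> x0; rewrite /flat x0.
set y := x^-1; have y0 : 0 < y by rewrite invr_gt0.
set k := m.+1; have k0 : 0 < k%:R :> R by [].
have H : y ^+ k <= k%:R ^+ k * expR y.
  have -> : expR y = expR (y / k%:R) ^+ k.
    by rewrite -expRM_natl mulrC divfK// gt_eqF.
  have yk : y <= k%:R * expR (y / k%:R).
    by rewrite mulrC -ler_pdivrMr// (le_trans _ (expR_ge1Dx _))// lerDr.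
  by rewrite -exprMn lerXn2r ?nnegrE ?mulr_ge0 ?expR_ge0// ltW.
rewrite -(ler_pM2r (expR_gt0 y)) -mulrA -expRD addNr expR0 mulr1.
rewrite -(ler_pM2r y0) -exprSr mulrAC -/k (le_trans H)//.
have xy : x * y = 1 by rewrite mulfV ?gt_eqF.
by rewrite -[_ * x * y]mulrA xy mulr1.
Qed.

Lemma flat_ge0 m x : 0 <= flat m x.
Proof.
rewrite /flat; case: ifP => // x0; rewrite mulr_ge0 ?expR_ge0// exprn_ge0//.
by rewrite invr_ge0 ltW.
Qed.

Lemma deriv_of_flat m :
  deriv_of (flat m) (fun x => flat m.+2 x - m%:R * flat m.+1 x).
Proof.
move=> x; have [x0|x0|->] := ltgtP x 0.
- rewrite /flat ltNge (ltW x0) /= mulr0 subr0.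
  have d : is_derive x (1 : R) (cst 0 : R -> R) 0 by exact: is_derive_cst.
  apply: near_eq_is_derive d.
  have : \forall z \near x, z < 0 by exact: lt_nbhsl.
  by apply: filterS => z z0; rewrite ltNge (ltW z0).
- have xn0 : x != 0 by rewrite gt_eqF.
  have d1 : is_derive x (1 : R) (fun y : R => y^-1) (- x ^- 2).
    have := @is_deriveV R id x 1 1 xn0 (is_derive_id _ _).
    by rewrite /GRing.scale /= mulr1.
  have d2 := @is_deriveX _ R^o _ m _ _ _ d1.
  pose nf (y : R) : R := - y^-1.
  have dn : is_derive x (1 : R) nf (x ^- 2).
    by apply: is_derive_eq (is_deriveN d1) _; rewrite opprK.
  have d3 := @is_derive1_comp R expR nf x _ _ (is_derive_expR (nf x)) dn.
  have d4 := is_deriveM d2 d3.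
  apply: (@near_eq_is_derive _ _ _ ((fun y : R => y^-1) ^+ m * (expR \o nf))).
    have : \forall z \near x, 0 < z by exact: lt_nbhsr.
    apply: filterS => z z0; rewrite /flat z0; congr (_ * _).
    by elim: (m) => // k IH; rewrite !exprS -IH.
  apply: is_derive_eq d4 _; rewrite /flat x0.
  have -> : ((fun y : R => y^-1) ^+ m) x = x^-1 ^+ m.
    by elim: (m) => // k IH; rewrite !exprS -IH.
  rewrite /GRing.scale /= /nf.
  case: (m) => [|k] /=.
    by rewrite -exprVn; ring.
  by rewrite -exprVn !exprS; ring.
- have z0 k : flat k 0 = 0 by rewrite /flat ltxx.
  rewrite !z0 mulr0 subr0.
  (* At 0 the difference quotient is 0 on the left and [flat m.+1 h] on the right, and [flat_bound]
     makes the latter at most C h. *)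
  have H : h^-1 *: ((flat m \o shift 0) (h *: (1 : R)) - flat m 0) @[h --> 0^'] --> (0 : R).
    rewrite z0; apply/cvgrPdist_le => e e0.
    pose C : R := m.+2%:R ^+ m.+2.
    have C0 : 0 < C by rewrite exprn_gt0.
    rewrite near_withinE; apply/nbhs_ballP; exists (e / C) => /=.
      by rewrite divr_gt0.
    move=> h; rewrite /ball /= sub0r normrN => hC hn0.
    rewrite subr0 sub0r normrN /GRing.scale /= mulr1 addr0.
    have [h0|h0|hE] := ltgtP h 0; last by rewrite hE eqxx in hn0.
      by rewrite /flat ltNge (ltW h0) /= mulr0 normr0 ltW.
    have -> : h^-1 * flat m h = flat m.+1 h by rewrite /flat h0 exprS mulrA.
    rewrite ger0_norm ?flat_ge0//; apply: (le_trans (flat_bound _ h0)).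
    rewrite -/C mulrC -ler_pdivlMr//.
    by move: hC; rewrite gtr0_norm// => /ltW.
  by apply: DeriveDef; [apply: cvgP H|apply: cvg_lim H].
Qed.

Lemma Cn_flat n m : Cn n (flat m).
Proof.
elim: n m => [//|n IH] m; exists (fun x => flat m.+2 x - m%:R * flat m.+1 x).
  exact: deriv_of_flat.
by apply: CnB => //; exact: CnZ.
Qed.

End smooth.

(** * Smooth steps, cutoffs and the resolvent of the second derivative *)

Section step_functions.
Context {R : realType}.
Local Notation mu := (@lebesgue_measure R).
Local Notation pos := (`]0, +oo[%classic : set R).
Implicit Types (f g w : R -> R) (x y z a : R).

(** Integration from -oo lets the fundamental theorem apply at every real point, negative ones
    included. *)
Definition prim (w : R -> R) (x : R) : R := \int[mu]_(t in `]-oo, x]) w t.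

Definition supp0 (Z : R) w := forall x, x <= 0 \/ Z <= x -> w x = 0.

Lemma integrable_supp0 (Z : R) w (D : set (measurableTypeR R)) : measurable D ->
  (forall x, {for x, continuous w}) -> supp0 Z w -> mu.-integrable D (EFin \o w).
Proof.
move=> mD cw w0.
have i1 : mu.-integrable `[0, Z] (EFin \o w).
  apply: continuous_compact_integrable; first exact: segment_compact.
  by apply: continuous_subspaceT => x; exact: cw.
have := integrable_patch_itv mD i1; apply: eq_integrable => // x _ /=.
congr EFin; rewrite patchE; case: ifPn => //; rewrite notin_setE /= in_itv /= => /negP.
by rewrite negb_and -!ltNge => /orP[/ltW x0|/ltW x0]; rewrite w0//; [left|right].
Qed.

Lemma deriv_of_prim (Z : R) w : (forall x, {for x, continuous w}) -> supp0 Z w ->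
  deriv_of (prim w) w.
Proof.
move=> cw w0 x.
have iw : mu.-integrable `]-oo, x + 1] (EFin \o w).
  exact: (integrable_supp0 (measurable_itvR _) cw w0).
have x1 : x < x + 1 by rewrite ltrDl.
have H := @continuous_FTC1 R w -oo%O x (x + 1) x1 iw.
have [|d e] := H _ (cw x); first by rewrite ltNyr.
by apply: DeriveDef; [exact: d|rewrite -derive1E].
Qed.

Lemma prim_le0 (Z : R) w x : supp0 Z w -> x <= 0 -> prim w x = 0.
Proof.
move=> w0 x0; rewrite /prim.
have -> : \int[mu]_(t in `]-oo, x]) w t = \int[mu]_(t in `]-oo, x]) cst 0 t.
  apply: eq_Rintegral => t; rewrite inE /= in_itv /= => tx.
  by rewrite w0//; left; exact: le_trans x0.
by rewrite Rintegral_cst// mul0r.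
Qed.

Lemma prim_nd (Z : R) w x y : (forall x, {for x, continuous w}) -> supp0 Z w ->
  (forall x, 0 <= w x) -> x <= y -> prim w x <= prim w y.
Proof.
move=> cw w0 wp xy; apply: fine_le.
- exact: integrable_fin_num (integrable_supp0 (measurable_itvR _) cw w0).
- exact: integrable_fin_num (integrable_supp0 (measurable_itvR _) cw w0).
apply: ge0_subset_integral => //.
- by have /measurable_int := integrable_supp0 (measurable_itvR (Interval -oo%O (BRight y))) cw w0.
- by move=> t _; rewrite lee_fin.
- by move=> t /=; rewrite !in_itv /= => /le_trans; exact.
Qed.

Lemma prim_ge (Z : R) w x : (forall x, {for x, continuous w}) -> supp0 Z w ->
  Z <= x -> prim w x = prim w Z.
Proof.
move=> cw w0 Zx; rewrite /prim [LHS]Rintegral_mkcond [RHS]Rintegral_mkcond.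
apply: eq_Rintegral => t _; rewrite !patchE.
have E (b : R) : (t \in (`]-oo, b]%classic : set R)) = (t <= b).
  by apply/idP/idP; rewrite inE /= in_itv.
rewrite !E; case: (leP t Z) => [tZ|tZ]; first by rewrite (le_trans tZ).
by case: ifP => // _; rewrite w0//; right; exact: ltW.
Qed.

Definition bump (x : R) : R := flat 0 x * flat 0 (1 - x).

Lemma Cn_bump n : Cn n bump.
Proof.
have -> : bump = (fun x => flat 0 x * flat 0 (- 1 * x + 1)).
  by apply/funext => x; rewrite /bump mulN1r addrC.
by apply: CnM; [|apply: (@Cn_comp_affine _ n (-1) 1)]; exact: Cn_flat.
Qed.

Lemma Cn1_continuous f x : Cn 1 f -> {for x, continuous f}.
Proof. by move=> [f' df _]; exact: deriv_of_continuous df. Qed.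

Lemma bump_supp : supp0 1 bump.
Proof.
move=> x; rewrite /bump /flat => -[x0|x1].
  by rewrite ltNge x0 /= mul0r.
by rewrite subr_gt0 [x < 1]ltNge x1 /= mulr0.
Qed.

Lemma bump_ge0 x : 0 <= bump x.
Proof. by rewrite mulr_ge0 ?flat_ge0. Qed.

Definition step (x : R) : R := (prim bump 1)^-1 * prim bump x.

(** By the mean value theorem this is a value of [bump] inside ]0, 1[. *)
Lemma prim_bump_gt0 : 0 < prim bump 1.
Proof.
have cb x : {for x, continuous bump} by exact: Cn1_continuous (Cn_bump 1).
have db := deriv_of_prim cb bump_supp.
have cp : {within `[0 : R, 1], continuous (prim bump)}.
  by apply: continuous_subspaceT => x; exact: (deriv_of_continuous (x := x) db).
have [c] := MVT (@ltr01 R) (fun x _ => db x) cp.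
rewrite in_itv /= => /andP[c0 c1].
rewrite (prim_le0 bump_supp (lexx 0)) !subr0 mulr1 => ->.
by rewrite /bump /flat c0 subr_gt0 c1 !expr0 !mul1r mulr_gt0 ?expR_gt0.
Qed.

Lemma Cn_step n : Cn n step.
Proof.
apply: CnZ; apply: CnSW; exists bump; last exact: Cn_bump.
by apply: deriv_of_prim bump_supp => x; exact: Cn1_continuous (Cn_bump 1).
Qed.

Lemma step_le0 x : x <= 0 -> step x = 0.
Proof. by move=> x0; rewrite /step (prim_le0 bump_supp x0) mulr0. Qed.

Lemma step_ge1 x : 1 <= x -> step x = 1.
Proof.
move=> x1; rewrite /step (prim_ge _ bump_supp x1) ?mulVf ?gt_eqF ?prim_bump_gt0//.
by move=> z; exact: Cn1_continuous (Cn_bump 1).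
Qed.

Lemma step_nd x y : x <= y -> step x <= step y.
Proof.
move=> xy; rewrite ler_pM2l ?invr_gt0 ?prim_bump_gt0//.
apply: prim_nd bump_supp bump_ge0 xy => z; exact: Cn1_continuous (Cn_bump 1).
Qed.

Lemma step_ge0 x : 0 <= step x.
Proof.
by case: (leP x 0) => [/step_le0->//|/ltW x0]; rewrite -(step_le0 (lexx 0)) step_nd.
Qed.

Lemma step_le1 x : step x <= 1.
Proof.
by case: (leP 1 x) => [/step_ge1->//|/ltW x0]; rewrite -(step_ge1 (lexx 1)) step_nd.
Qed.

(* Tends to the indicator function of ]y, z] as r grows. *)
Definition plateau (r y z x : R) : R := step (r * (x - y)) - step (r * (x - z)).

Lemma smooth_plateau r y z : smooth (plateau r y z).
Proof.
move=> n; have E (w : R) : (fun x => step (r * (x - w))) = (fun x => step (r * x + - (r * w))).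
  by apply/funext => x; rewrite mulrBr.
by apply: CnB; rewrite E; apply: Cn_comp_affine; exact: Cn_step.
Qed.

Lemma plateau_ge0 r y z x : 0 <= r -> y <= z -> 0 <= plateau r y z x.
Proof. by move=> r0 yz; rewrite subr_ge0 step_nd// ler_wpM2l// lerD2l lerN2. Qed.

Lemma plateau_le1 r y z x : plateau r y z x <= 1.
Proof. by rewrite /plateau lerBlDr (le_trans (step_le1 _))// lerDl step_ge0. Qed.

Lemma plateau_lt r y z x : 0 <= r -> y <= z -> x <= y -> plateau r y z x = 0.
Proof.
move=> r0 yz xy; rewrite /plateau !step_le0 ?subrr//.
  by rewrite mulr_ge0_le0// subr_le0 (le_trans xy).
by rewrite mulr_ge0_le0// subr_le0.
Qed.

Lemma plateau_gt r y z x : 0 < r -> y <= z -> z + r^-1 <= x -> plateau r y z x = 0.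
Proof.
move=> r0 yz zx; have zx' : 1 <= r * (x - z).
  by rewrite -ler_pdivrMl// mulr1 lerBrDl.
rewrite /plateau !step_ge1 ?subrr//.
by rewrite (le_trans zx')// ler_pM2l// lerD2l lerN2.
Qed.

Lemma plateau_in r y z x : 0 < r -> y + r^-1 <= x <= z -> plateau r y z x = 1.
Proof.
move=> r0 /andP[yx xz]; rewrite /plateau step_ge1 ?step_le0 ?subr0//.
  by rewrite mulr_ge0_le0 ?subr_le0// ltW.
by rewrite -ler_pdivrMl// mulr1 lerBrDl.
Qed.

Lemma smooth_test f (M : R) : smooth f -> (forall x, M < `|x| -> f x = 0) ->
  test_function f.
Proof. by move=> sf fM; split; [exact: smooth_derivable|exists M]. Qed.

Lemma supp0_plateau r y z : 0 < r -> 0 <= y <= z -> supp0 (z + r^-1) (plateau r y z).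
Proof.
move=> r0 /andP[y0 yz] x [x0|xz]; last exact: plateau_gt.
by rewrite plateau_lt// ?(le_trans x0)// ltW.
Qed.

Lemma supp0_test (Z : R) f : smooth f -> supp0 Z f -> test_function f.
Proof.
move=> sf f0; apply: (@smooth_test _ `|Z|) => // x Zx; apply: f0.
case: (leP x 0) => x0; [by left|right].
by rewrite ltW// (le_lt_trans (ler_norm Z))// -(gtr0_norm x0).
Qed.

Lemma smooth_continuous f x : smooth f -> {for x, continuous f}.
Proof. by move=> sf; exact: Cn1_continuous (sf 1%N). Qed.

Lemma resolvent_algebra (a e e' c p s : R) : e * e' = 1 ->
  a * e * (c - p) + e * (0 - e' * s) = a * (e * (c - p)) - s.
Proof. by move=> ee; rewrite sub0r mulrN [e * (_ * _)]mulrA ee; ring. Qed.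

Lemma resolvent_bound (a u v Bu Bv : R) : 0 < a -> 0 <= u <= Bu -> 0 <= v <= Bv ->
  `|(2 * a)^-1 * (u + v)| <= ((2 * a)^-1 + 2^-1) * (Bu + Bv) /\
  `|2^-1 * (u - v)| <= ((2 * a)^-1 + 2^-1) * (Bu + Bv).
Proof.
move=> a0 /andP[u0 u1] /andP[v0 v1].
have a20 : 0 <= (2 * a)^-1 by rewrite invr_ge0 mulr_ge0// ltW.
have B0 : 0 <= Bu + Bv by rewrite addr_ge0// (le_trans _ u1, le_trans _ v1).
have B1 : `|u + v| <= Bu + Bv by rewrite ger0_norm ?addr_ge0// lerD.
have B2 : `|u - v| <= Bu + Bv.
  by rewrite (le_trans (ler_normB _ _))// !ger0_norm// lerD.
split.
  by rewrite normrM [leRHS]mulrDl (ger0_norm a20) ler_wpDr ?ler_wpM2l ?mulr_ge0.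
by rewrite normrM [leRHS]mulrDl [`|2^-1|]ger0_norm ?ler_wpDl ?ler_wpM2l ?mulr_ge0.
Qed.

(** [phi] is the convolution of [psi] with the Green function e^(-a|x|) / (2 a), and [eta] is its
    derivative. As [psi] lives on the positive half-line, the value at 0 is a Laplace transform.
    Both bounds are needed because truncating [phi] brings in its derivative. *)
Lemma resolvent (Z a : R) psi : 0 < Z -> 0 < a -> smooth psi -> supp0 Z psi ->
  (forall x, 0 <= psi x) ->
  exists phi eta B, [/\ deriv_of phi eta,
    deriv_of eta (fun x => a ^+ 2 * phi x - psi x),
    smooth phi, (forall x, `|phi x| <= B /\ `|eta x| <= B) &
    phi 0 = laplace psi a / (2 * a)].
Proof.
move=> Z0 a0 sp p0 pp.
have cp x := smooth_continuous (x := x) sp.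
pose w (c x : R) := expR (c * x) * psi x.
have cw c x : {for x, continuous (w c)}.
  apply: Cn1_continuous; apply: CnM; [exact: Cn_expR|exact: sp].
have w0 c : supp0 Z (w c) by move=> x xZ; rewrite /w p0// mulr0.
have wp c x : 0 <= w c x by rewrite mulr_ge0 ?expR_ge0.
have dE c := deriv_of_prim (cw c) (w0 c).
pose A := prim (w (- a)) Z.
have E0 c x : 0 <= prim (w c) x.
  case: (leP x 0) => x0; first by rewrite (prim_le0 (w0 c)).
  by rewrite -(prim_le0 (w0 c) (lexx 0)) (prim_nd (cw c) (w0 c))// ltW.
have EZ c x : prim (w c) x <= prim (w c) Z.
  case: (leP x Z) => xZ; first exact: (prim_nd (cw c) (w0 c)).
  by rewrite (prim_ge (cw c) (w0 c))// ltW.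
(* [U] and [V] integrate e^(-a|x - t|) psi(t) over t > x and over t < x; each solves a first-order
   equation, which avoids differentiating the absolute value. *)
pose U x := expR (a * x) * (A - prim (w (- a)) x).
pose V x := expR (- a * x) * prim (w a) x.
have ee x : expR (a * x) * expR (- a * x) = 1.
  by rewrite -expRD mulNr addrN expR0.
have dU : deriv_of U (fun x => a * U x - psi x).
  have := deriv_ofM (deriv_of_expR a) (deriv_ofB (deriv_of_cst A) (dE (- a))).
  move=> d x; apply: is_derive_eq (d x) _; rewrite /U /w /=.
  exact: resolvent_algebra.
have dV : deriv_of V (fun x => - a * V x + psi x).
  have := deriv_ofM (deriv_of_expR (- a)) (dE a).
  move=> d x; apply: is_derive_eq (d x) _; rewrite /V /w /=.
  by rewrite [X in _ + X]mulrA [expR (- a * x) * expR _]mulrC ee mul1r; ring.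
pose B0 := expR (a * Z) * A + prim (w a) Z.
have UB x : 0 <= U x <= expR (a * Z) * A.
  rewrite /U mulr_ge0 ?expR_ge0 ?subr_ge0 ?EZ//=.
  case: (leP x Z) => xZ.
    apply: ler_pM; rewrite ?expR_ge0 ?subr_ge0 ?EZ//.
      by rewrite ler_expR ler_pM2l.
    by rewrite gerBl.
  rewrite (prim_ge (cw _) (w0 _)) ?(ltW xZ)// subrr mulr0.
  by rewrite mulr_ge0 ?expR_ge0 ?E0.
have VB x : 0 <= V x <= prim (w a) Z.
  rewrite /V mulr_ge0 ?expR_ge0//=.
  case: (leP x 0) => x0; first by rewrite (prim_le0 (w0 a))// mulr0.
  rewrite -[leRHS]mul1r ler_pM ?expR_ge0//.
  by rewrite -expR0 ler_expR mulNr oppr_le0 mulr_ge0// ltW.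
pose phi x := (2 * a)^-1 * (U x + V x).
pose eta x := 2^-1 * (U x - V x).
have an0 : a != 0 by rewrite gt_eqF.
have dphi : deriv_of phi eta.
  move=> x; apply: is_derive_eq (deriv_ofZ (2 * a)^-1 (deriv_ofD dU dV) x) _.
  by rewrite /eta; field.
have deta : deriv_of eta (fun x => a ^+ 2 * phi x - psi x).
  move=> x; apply: is_derive_eq (deriv_ofZ 2^-1 (deriv_ofB dU dV) x) _.
  by rewrite /phi; field.
(* Smoothness bootstraps, since the derivative of [eta] is a^2 phi - psi. *)
have cn n : Cn n phi /\ Cn n eta.
  elim: n => [//|n [c1 c2]]; split; first by exists eta.
  exists (fun x => a ^+ 2 * phi x - psi x) => //.
  by apply: CnB; [exact: CnZ|exact: sp].
exists phi, eta, (((2 * a)^-1 + 2^-1) * B0); split => //.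
- by move=> n; have [] := cn n.
- by move=> x; exact: resolvent_bound.
rewrite /phi /V /U (prim_le0 (w0 _) (lexx 0)) (prim_le0 (w0 _) (lexx 0)).
rewrite !mulr0 expR0 mul1r addr0 subr0 [LHS]mulrC; congr (_ * _).
rewrite /A /prim /laplace [LHS]Rintegral_mkcond [RHS]Rintegral_mkcond.
apply: eq_Rintegral => t _; rewrite !patchE.
have E1 : (t \in (`]-oo, Z]%classic : set R)) = (t <= Z).
  by apply/idP/idP; rewrite inE /= in_itv.
have E2 : (t \in pos) = (0 < t).
  by apply/idP/idP; rewrite inE /= in_itv /= andbT.
rewrite E1 E2 /w mulNr; case: (leP t 0) => t0.
  by rewrite (le_trans t0 (ltW Z0)) p0 ?mulr0//; left.
by case: (leP t Z) => // tZ; rewrite p0 ?mulr0//; right; exact: ltW.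
Qed.

End step_functions.

(** * Transforms of the fundamental solution *)

Section bounded_convergence.
Context {R : realType} d (T : measurableType d) (mu : {measure set T -> \bar R}).

Lemma Rintegral_dominated_cvg (D : set T) (fn : nat -> T -> R) (f g : T -> R) :
  measurable D -> (forall n, measurable_fun D (fn n)) ->
  (forall x, D x -> fn ^~ x @ \oo --> f x) ->
  mu.-integrable D (EFin \o g) ->
  (forall n x, D x -> `|fn n x| <= g x) ->
  [/\ measurable_fun D f, mu.-integrable D (EFin \o f) &
    (\int[mu]_(x in D) fn n x) @[n --> \oo] --> \int[mu]_(x in D) f x].
Proof.
move=> mD mfn fnf ig fng.
have mf : measurable_fun D f by apply: measurable_fun_cvg mfn fnf.
have [||||i _ c] := @dominated_convergence _ T R mu D mD (fun n => EFin \o fn n)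
  (EFin \o f) (EFin \o g) _ _ _ ig.
- by move=> n; exact/measurable_EFinP.
- exact/measurable_EFinP.
- apply: aeW => x Dx; apply: cvg_EFin; first exact: nearW.
  exact: fnf.
- by apply: aeW => x n Dx; rewrite /= lee_fin; exact: fng.
split=> //; apply: fine_cvg; rewrite /Rintegral fineK; first exact: c.
exact: integrable_fin_num.
Qed.

End bounded_convergence.

Section laplace_convergence.
Context {R : realType}.
Local Notation mu := (@lebesgue_measure R).
Local Notation pos := (`]0, +oo[%classic : set R).

Lemma laplace_cvg (fn : nat -> R -> R) (f : R -> R) (M s : R) : 0 < s ->
  (forall n, measurable_fun pos (fn n)) ->
  (forall t, 0 < t -> fn ^~ t @ \oo --> f t) ->
  (forall n, bounded_on_pos (fn n) M) ->
  measurable_fun pos f /\ laplace (fn n) s @[n --> \oo] --> laplace f s.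
Proof.
move=> s0 mfn fnf fnM.
have i1 := (laplaceZ M (laplace1 s0).1).1.
have P t : pos t -> 0 < t by rewrite /= in_itv /= andbT.
have mf : measurable_fun pos f.
  by apply: measurable_fun_cvg mfn _ => t /P; exact: fnf.
split=> //.
have [|||_ _] := @Rintegral_dominated_cvg R _ _ mu pos
  (fun n t => expR (- (s * t)) * fn n t) (fun t => expR (- (s * t)) * f t)
  (fun t => expR (- (s * t)) * (M * 1)) (measurable_itvR _) _ _ i1.
- by move=> n; apply: measurable_funM; [exact: measurable_expNM|exact: mfn].
- by move=> t /P t0; apply: cvgMr; exact: fnf.
- by move=> n t /P t0; rewrite normrM mulr1 ger0_norm ?expR_ge0// ler_wpM2l ?expR_ge0// fnM.
- exact.
Qed.

Lemma laplace_scale (f : R -> R) (c s : R) : 0 < c ->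
  laplace_integrable f (s / c) ->
  laplace (fun t => f (c * t)) s = c^-1 * laplace f (s / c).
Proof.
move=> c0 lf; have cn0 : c != 0 by rewrite gt_eqF.
have := @Rintegral_affine R c 0 pos _ cn0 (measurable_itv _) lf.
rewrite preimage_affine_pos// gtr0_norm// => E.
rewrite [laplace f _]E mulKf//.
apply: eq_Rintegral => t _; rewrite addr0; congr (expR (- _) * _).
by rewrite mulrA divfK.
Qed.

End laplace_convergence.

Section test_functions.
Context {R : realType}.
Implicit Types (f : R -> R).

Lemma test_functionP f : test_function f -> deriv_of f (derive1 f).
Proof. by move=> [df _] x; apply: DeriveDef; [exact: (df 0%N)|rewrite -derive1E]. Qed.

Lemma test_function_derive1 f : test_function f -> test_function (derive1 f).
Proof.
move=> tf; have [df [M fM]] := tf; split.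
  by move=> j x; have := df j.+1 x; rewrite derive1Sn.
exists M => x Mx; rewrite derive1E (@near_eq_derive _ _ _ _ (cst 0)) ?derive_cst//.
have : {for x, continuous (fun y : R => `|y|)} by exact: norm_continuous.
by move=> /(cvgr_gt _) /(_ _ Mx); apply: filterS => y /fM.
Qed.

Lemma test_function_derive2 f : test_function f -> test_function (derive1n 2 f).
Proof.
by move=> /test_function_derive1 /test_function_derive1; rewrite derive1nS derive1n1.
Qed.

Lemma test_function_continuous f x : test_function f -> {for x, continuous f}.
Proof. by move=> /test_functionP; exact: deriv_of_continuous. Qed.

Lemma test_function_measurable f : test_function f -> measurable_fun setT f.
Proof.
by move=> tf; apply: continuous_measurable_fun => x; exact: test_function_continuous.
Qed.

Lemma test_function_bounded f : test_function f -> exists B, forall x, `|f x| <= B.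
Proof.
move=> tf; have [_ [M fM]] := tf.
have cf : {within `[- `|M|, `|M|], continuous (fun x => `|f x|)}.
  apply: continuous_subspaceT => x; apply: continuous_comp.
    exact: test_function_continuous.
  exact: norm_continuous.
have MM : - `|M| <= `|M| by rewrite ge0_cp.
have [c _ Hc] := EVT_max MM cf.
exists `|f c| => x; case: (leP `|x| `|M|) => xM.
  by apply: Hc; rewrite in_itv /= -ler_norml.
by rewrite fM ?normr0// (le_lt_trans (ler_norm _)).
Qed.

End test_functions.

Section fundamental_solution.
Context {R : realType} (alpha : R) (u : R -> probability (measurableTypeR R) R).
Hypothesis alpha01 : 0 < alpha <= 1.
Hypothesis solu : fundamental_solution alpha u.
Local Notation mu := (@lebesgue_measure R).
Local Notation pos := (`]0, +oo[%classic : set R).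
Implicit Types (f g phi psi : R -> R) (t s x y z r c B : R).

Definition mean phi t := \int[u t]_x phi x.

Lemma integrable_mean phi t B : measurable_fun setT phi -> (forall x, `|phi x| <= B) ->
  (u t).-integrable setT (EFin \o phi).
Proof.
move=> mphi phiB; apply: measurable_bounded_integrable => //.
  by rewrite /= probability_setT ltry.
exists B; split; first exact: num_real.
by move=> y By x _; apply: (le_trans (phiB x)); exact: ltW.
Qed.

Lemma mean_bounded phi t B : measurable_fun setT phi -> (forall x, `|phi x| <= B) ->
  `|mean phi t| <= B.
Proof.
move=> mphi phiB; have i := integrable_mean t mphi phiB.
apply: (le_trans (le_normr_Rintegral _ i)) => //.
have -> : B = \int[u t]_x B by rewrite Rintegral_cst//= [X in fine X](@probability_setT _ _ _ (u t)) mulr1.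
apply: le_Rintegral => //; first exact: integrable_norm.
apply: (@integrable_mean _ _ `|B|) => //.
Qed.

Lemma mean_cvg (fn : nat -> R -> R) f B t : (forall n, measurable_fun setT (fn n)) ->
  (forall x, fn ^~ x @ \oo --> f x) -> (forall n x, `|fn n x| <= B) ->
  measurable_fun setT f /\ mean (fn n) t @[n --> \oo] --> mean f t.
Proof.
move=> mfn fnf fnB.
have i : (u t).-integrable setT (EFin \o (cst B : R -> R)).
  exact: (@integrable_mean _ _ `|B|).
have [m _ c] := @Rintegral_dominated_cvg R _ _ (u t) setT fn f (cst B)
  measurableT mfn (fun x _ => fnf x) i (fun n x _ => fnB n x).
by split.
Qed.

Lemma norm_lim_le (fn : nat -> R -> R) f B : (forall x, fn ^~ x @ \oo --> f x) ->
  (forall n x, `|fn n x| <= B) -> forall x, `|f x| <= B.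
Proof.
move=> fnf fnB x; have : (fun n => `|fn n x|) @ \oo --> `|f x|.
  exact: cvg_norm.
by move=> /cvgr_to_le; apply; apply: nearW => n.
Qed.

Lemma meanB f g t B B' : measurable_fun setT f -> (forall x, `|f x| <= B) ->
  measurable_fun setT g -> (forall x, `|g x| <= B') ->
  mean (fun x => f x - g x) t = mean f t - mean g t.
Proof.
move=> mf fB mg gB; rewrite /mean RintegralB//.
  exact: integrable_mean fB.
exact: integrable_mean gB.
Qed.

Lemma meanZ f t c B : measurable_fun setT f -> (forall x, `|f x| <= B) ->
  mean (fun x => c * f x) t = c * mean f t.
Proof.
by move=> mf fB; rewrite /mean RintegralZl//; exact: integrable_mean fB.
Qed.

Lemma double_order_bounds : 0 < 2 * alpha <= 2.
Proof. by move: alpha01; lra. Qed.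

Lemma mean_test_continuous phi t : test_function phi -> 0 < t ->
  {for t, continuous (mean phi)}.
Proof.
move=> /(solu.2) [ac _ _]; apply: (locally_abs_cont_continuous (c0 := phi 0)).
apply: (ac 0%N); have [b1|b1] := leP (2 * alpha) 1.
  by rewrite caputo_order1//; move: double_order_bounds; lra.
by rewrite caputo_order2//; move: double_order_bounds; lra.
Qed.

Lemma mean_test_measurable phi : test_function phi -> measurable_fun pos (mean phi).
Proof.
by move=> tp; apply: continuous_pos_measurable => t; exact: mean_test_continuous.
Qed.

(** The transformed equation equates s^(2 alpha) (L (mean phi) - phi(0) / s) with L (mean phi''). By
    linearity the unknown enters only through the mean of s^(2 alpha) phi - phi'', a function that
    can be prescribed by solving the resolvent equation. *)
Lemma laplace_mean_test phi s : test_function phi -> 0 < s ->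
  laplace (mean (fun x => s `^ (2 * alpha) * phi x - derive1n 2 phi x)) s =
    s `^ (2 * alpha) * (phi 0 / s) /\
  measurable_fun pos (mean (fun x => s `^ (2 * alpha) * phi x - derive1n 2 phi x)).
Proof.
move=> tp s0; have tp2 := test_function_derive2 tp.
have [B phiB] := test_function_bounded tp.
have [B2 phi2B] := test_function_bounded tp2.
have mp := test_function_measurable tp; have mp2 := test_function_measurable tp2.
have bp : bounded_on_pos (mean phi) B by move=> t _; exact: mean_bounded.
have bp2 : bounded_on_pos (mean (derive1n 2 phi)) B2 by move=> t _; exact: mean_bounded.
have mm := mean_test_measurable tp; have mm2 := mean_test_measurable tp2.
have c1 : (1 < caputo_order (2 * alpha))%N -> (if 1%N is 0%N then phi 0 else 0) = 0 by [].
have E := caputo_laplace double_order_bounds s0 (solu.2 phi tp) c1 bp mm2 bp2.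
have lp := laplace_integrable_bounded s0 mm bp.
have lp2 := laplace_integrable_bounded s0 mm2 bp2.
have [l1 e1] := laplaceZ (s `^ (2 * alpha)) lp.
have [l2 e2] := laplaceZ (-1) lp2.
have [_ e3] := laplaceD l1 l2.
have E4 t : s `^ (2 * alpha) * mean phi t + -1 * mean (derive1n 2 phi) t =
    mean (fun x => s `^ (2 * alpha) * phi x - derive1n 2 phi x) t.
  rewrite mulN1r -(meanZ _ _ mp phiB).
  apply/esym; apply: (@meanB _ _ _ (`|s `^ (2 * alpha)| * B)) phi2B => //.
    exact: measurable_funM.
  by move=> x; rewrite normrM; apply: ler_wpM2l; [|exact: phiB].
split.
  transitivity (laplace ((fun t => s `^ (2 * alpha) * mean phi t) \+
    (fun t => -1 * mean (derive1n 2 phi) t)) s).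
    by apply: eq_laplace => t t0 /=; rewrite E4.
  rewrite e3 e1 e2 -E mulN1r; ring.
rewrite (_ : mean _ = (fun t => s `^ (2 * alpha) * mean phi t + -1 * mean (derive1n 2 phi) t)).
  2: by apply/funext => t; rewrite E4.
by apply: measurable_funD; exact: measurable_funM.
Qed.

Lemma powR_ratio s : 0 < s -> forall v : R,
  s `^ (2 * alpha) * (v / (2 * s `^ alpha) / s) = s `^ (alpha - 1) / 2 * v.
Proof.
move=> s0 v; have sa : s `^ alpha != 0 by rewrite gt_eqF ?powR_gt0.
have sn0 : s != 0 by rewrite gt_eqF.
have -> : s `^ (2 * alpha) = s `^ alpha * s `^ alpha.
  by rewrite mulr2n mulrDl mul1r powRD// sn0 implybT.
have -> : s `^ (alpha - 1) = s `^ alpha / s.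
  by rewrite powRB ?sn0 ?implybT// powRr1// ltW.
by field; rewrite sa sn0.
Qed.

(* The equation for u is tested against cutoffs at scale 1 / k n of the bounded
   solution phi of s^(2 alpha) phi - phi'' = psi. *)
Lemma laplace_mean_smooth psi Z s : 0 < Z -> smooth psi -> supp0 Z psi ->
  (forall x, 0 <= psi x <= 1) -> 0 < s ->
  laplace (mean psi) s = s `^ (alpha - 1) / 2 * laplace psi (s `^ alpha).
Proof.
move=> Z0 sp p0 p01 s0; pose a := s `^ alpha.
have a0 : 0 < a by rewrite powR_gt0.
have [phi [eta [B [dphi deta sphi phiB phi0]]]] :=
  resolvent Z0 a0 sp p0 (fun x => (andP (p01 x)).1).
(* Equal to 1 on [-1, 1] and to 0 outside ]-2, 2[. *)
pose chi : R -> R := plateau 1 (-2) 1.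
have tchi : test_function chi.
  apply: (@smooth_test _ _ 2); first exact: smooth_plateau.
  move=> x; rewrite ltr_normr => /orP[x2|x2].
    by apply: plateau_gt => //; rewrite ?invr1; lra.
  by apply: plateau_lt => //; lra.
have dchi := test_functionP tchi.
have tchi1 := test_function_derive1 tchi.
have dchi1 := test_functionP tchi1.
have tchi2 := test_function_derive1 tchi1.
set chi1 := derive1 chi in dchi tchi1 dchi1 tchi2.
set chi2 := derive1 chi1 in dchi1 tchi2.
have [b1 chi1b] := test_function_bounded tchi1.
have [b2 chi2b] := test_function_bounded tchi2.
have b10 : 0 <= b1 := le_trans (normr_ge0 _) (chi1b 0).
have b20 : 0 <= b2 := le_trans (normr_ge0 _) (chi2b 0).
have B0 : 0 <= B := le_trans (normr_ge0 _) (phiB 0).1.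
have chi0 : chi 0 = 1 by apply: plateau_in => //; rewrite invr1; lra.
pose k n : R := harmonic n.
have k0 n : 0 < k n by rewrite /k /= invr_gt0.
have k1 n : k n <= 1 by rewrite /k /= invf_le1// ler1n.
pose phin n x := phi x * chi (k n * x + 0).
have d1 n : deriv_of (phin n)
    (fun x => eta x * chi (k n * x + 0) + phi x * (k n * chi1 (k n * x + 0))).
  by apply: deriv_ofM => //; exact: deriv_of_comp_affine.
have d2 n : deriv_of
    (fun x => eta x * chi (k n * x + 0) + phi x * (k n * chi1 (k n * x + 0)))
    (fun x => ((a ^+ 2 * phi x - psi x) * chi (k n * x + 0) +
       eta x * (k n * chi1 (k n * x + 0))) +
      (eta x * (k n * chi1 (k n * x + 0)) +
       phi x * (k n * (k n * chi2 (k n * x + 0))))).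
  apply: deriv_ofD; apply: deriv_ofM => //; first exact: deriv_of_comp_affine.
  by apply: deriv_ofZ; exact: deriv_of_comp_affine.
have tphin n : test_function (phin n).
  apply: (@smooth_test _ _ (2 / k n)).
    move=> j; apply: CnM; first exact: sphi.
    by apply: Cn_comp_affine; exact: smooth_plateau.
  move=> x; rewrite ltr_pdivrMr// => x2.
  have [_ [M chiM]] := tchi.
  rewrite /phin (_ : chi _ = 0) ?mulr0//.
  have x2' : 2 < `|k n * x + 0| by rewrite addr0 normrM gtr0_norm// mulrC.
  move: x2'; rewrite ltr_normr => /orP[y2|y2].
    by apply: plateau_gt => //; rewrite ?invr1; lra.
  by apply: plateau_lt => //; lra.
(* Applying s^(2 alpha) - d^2/dx^2 to the truncated solution gives [psi] times the cutoff and
   commutator terms. Each of these carries a factor [k n], which tends to 0, and is bounded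
   uniformly in n. *)
pose psin n x := psi x * chi (k n * x + 0) -
  (eta x * (k n * chi1 (k n * x + 0)) + eta x * (k n * chi1 (k n * x + 0))) -
  phi x * (k n * (k n * chi2 (k n * x + 0))).
have psinE n : (fun x => s `^ (2 * alpha) * phin n x - derive1n 2 (phin n) x) = psin n.
  apply/funext => x.
  rewrite derive1nS derive1n1 (deriv_of_derive1 (d1 n)) (deriv_of_derive1 (d2 n)).
  have -> : s `^ (2 * alpha) = a ^+ 2.
    by rewrite expr2 mulr2n mulrDl mul1r powRD// (gt_eqF s0) implybT.
  by rewrite /phin /psin; ring.
(* The cutoff is 1 at 0, so the transform does not depend on n and passes to the limit unchanged. *)
have Ln n : laplace (mean (psin n)) s = s `^ (alpha - 1) / 2 * laplace psi a /\
    measurable_fun pos (mean (psin n)).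
  have := laplace_mean_test (tphin n) s0; rewrite psinE => -[-> ?]; split=> //.
  rewrite /phin mulr0 add0r chi0 mulr1 phi0.
  exact: powR_ratio.
pose K := 1 + (B * b1 + B * b1) + B * b2.
have psinB n x : `|psin n x| <= K.
  have /andP[p1 p2] := p01 x; have [ph1 et1] := phiB x.
  have kc y b : `|y| <= b -> `|k n * y| <= b.
    move=> yb; rewrite normrM gtr0_norm// (le_trans _ yb)// ler_piMl//.
  have c1 := chi1b (k n * x + 0); have c2 := chi2b (k n * x + 0).
  have M1 : `|eta x * (k n * chi1 (k n * x + 0))| <= B * b1.
    by rewrite normrM ler_pM// kc.
  have M2 : `|phi x * (k n * (k n * chi2 (k n * x + 0)))| <= B * b2.
    by rewrite normrM ler_pM// kc// kc.
  have M0 : `|psi x * chi (k n * x + 0)| <= 1.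
    rewrite normrM ger0_norm// -[leRHS]mulr1 ler_pM//.
    rewrite ger0_norm ?plateau_le1// plateau_ge0//; lra.
  rewrite /psin /K (le_trans (ler_normB _ _))// lerD//.
  rewrite (le_trans (ler_normB _ _))// lerD//.
  by rewrite (le_trans (ler_normD _ _))// lerD.
have kcvg x : (fun n => k n * x + 0) @ \oo --> (0 : R).
  have : (fun n => k n * x + 0) @ \oo --> 0 * x + 0.
    by apply: cvgD; [apply: cvgMl; exact: cvg_harmonic|exact: cvg_cst].
  by rewrite mul0r addr0.
have psincvg x : psin ^~ x @ \oo --> psi x.
  have C f : test_function f -> (fun n => f (k n * x + 0)) @ \oo --> f 0.
    move=> tf; apply: cvg_comp (kcvg x) _; exact: test_function_continuous.
  have H : psin ^~ x @ \oo --> psi x * chi 0 -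
      (eta x * (0 * chi1 0) + eta x * (0 * chi1 0)) - phi x * (0 * (0 * chi2 0)).
    apply: cvgB; last first.
      by apply: cvgMr; apply: cvgM; [exact: cvg_harmonic|
        apply: cvgM; [exact: cvg_harmonic|exact: C]].
    have e : (fun n => eta x * (k n * chi1 (k n * x + 0))) @ \oo --> eta x * (0 * chi1 0).
      by apply: cvgMr; apply: cvgM; [exact: cvg_harmonic|exact: C].
    by apply: cvgB; [apply: cvgMr; exact: C|apply: cvgD].
  by move: H; rewrite chi0 mulr1 !mul0r !mulr0 addr0 !subr0.
have mpsin n : measurable_fun setT (psin n).
  rewrite -psinE; apply: measurable_funB.
    by apply: measurable_funM => //; exact: test_function_measurable.
  by apply: test_function_measurable; exact: test_function_derive2.
have := @laplace_cvg R (fun n => mean (psin n)) (mean psi) K s s0 (fun n => (Ln n).2)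
  (fun t _ => (mean_cvg t mpsin psincvg psinB).2) (fun n t _ => mean_bounded t (mpsin n) (psinB n)).
move=> [_]; under eq_fun do rewrite (Ln _).1.
by move=> /(cvg_lim (@Rhausdorff R)) <-; rewrite lim_cst.
Qed.

End fundamental_solution.

(** * Self-similarity, and extension from plateaus to continuous functions *)

Section self_similarity.
Context {R : realType} (alpha : R) (u : R -> probability (measurableTypeR R) R).
Hypothesis alpha01 : 0 < alpha <= 1.
Hypothesis solu : fundamental_solution alpha u.
Local Notation mu := (@lebesgue_measure R).
Local Notation pos := (`]0, +oo[%classic : set R).
Local Notation mean := (mean u).
Implicit Types (f g phi psi : R -> R) (t s x y z r c B : R).

Lemma powR_div s c (a : R) : 0 < s -> 0 < c -> (s / c) `^ a = s `^ a / c `^ a.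
Proof.
move=> s0 c0; rewrite powRM ?invr_ge0 ?ltW//; congr (_ * _).
by rewrite -powR_inv1 ?ltW// -powRrM mulN1r powRN.
Qed.

Lemma plateau_scale r y z c x : c != 0 ->
  plateau r y z (c * x) = plateau (r * c) (y / c) (z / c) x.
Proof.
by move=> c0; rewrite /plateau -!mulrA !mulrBr ![c * (_ / c)]mulrC !divfK.
Qed.

Lemma plateau_norm_le1 r y z x : 0 <= r -> y <= z -> `|plateau r y z x| <= 1.
Proof. by move=> r0 yz; rewrite ger0_norm ?plateau_le1 ?plateau_ge0. Qed.

Lemma plateau_test r y z : 0 < r -> 0 <= y <= z -> test_function (plateau r y z).
Proof. by move=> r0 yz; apply: supp0_test (supp0_plateau r0 yz); exact: smooth_plateau. Qed.

Lemma plateau_measurable r y z : 0 < r -> 0 <= y <= z ->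
  measurable_fun setT (plateau r y z).
Proof. by move=> r0 yz; apply: test_function_measurable; exact: plateau_test. Qed.

Lemma laplace_mean_plateau r y z s : 0 < r -> 0 <= y <= z -> 0 < s ->
  laplace (mean (plateau r y z)) s =
  s `^ (alpha - 1) / 2 * laplace (plateau r y z) (s `^ alpha).
Proof.
move=> r0 yz s0; have /andP[y0 yz'] := yz.
apply: (laplace_mean_smooth alpha01 solu _ _ (supp0_plateau r0 yz)) => //.
- by rewrite ltr_wpDl ?invr_gt0// (le_trans y0).
- exact: smooth_plateau.
- by move=> x; rewrite plateau_ge0 ?plateau_le1// ltW.
Qed.

(** A rescaled plateau is again a plateau, hence a test function. So the mean of the plateau at time
    c t and the mean of the rescaled plateau at time t are both continuous in t; their transforms
    agree, and the resulting identity is read at t = 1. *)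
Lemma mean_plateau_scale r y z c : 0 < r -> 0 <= y <= z -> 0 < c ->
  mean (plateau r y z) c = mean (fun x => plateau r y z (c `^ alpha * x)) 1.
Proof.
move=> r0 yz c0; have k0 : 0 < c `^ alpha by exact: powR_gt0.
have /andP[y0 yz'] := yz.
set k := c `^ alpha in k0 *.
have kn0 : k != 0 by rewrite gt_eqF.
have -> : (fun x => plateau r y z (k * x)) = plateau (r * k) (y / k) (z / k).
  by apply/funext => x; exact: plateau_scale.
have rk0 : 0 < r * k by exact: mulr_gt0.
have yzk : 0 <= y / k <= z / k by rewrite ler_pM2r ?invr_gt0// yz' andbT divr_ge0// ltW.
have cm r' y' z' t : 0 < r' -> 0 <= y' <= z' -> 0 < t ->
    {for t, continuous (mean (plateau r' y' z'))}.
  by move=> *; apply: (mean_test_continuous alpha01 solu) => //; exact: plateau_test.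
have bm r' y' z' : 0 < r' -> 0 <= y' <= z' -> bounded_on_pos (mean (plateau r' y' z')) 1.
  move=> r'0 yz'' t _; have /andP[_ ?] := yz''.
  apply: mean_bounded => [|x]; first exact: plateau_measurable.
  by apply: plateau_norm_le1 => //; exact: ltW.
have mm : measurable_fun pos (mean (plateau r y z)).
  by apply: (mean_test_measurable alpha01 solu); exact: plateau_test.
pose f t := mean (plateau r y z) (c * t).
pose g := mean (plateau (r * k) (y / k) (z / k)).
suff : f 1 = g 1 by rewrite /f mulr1.
have cf t : 0 < t -> {for t, continuous f}.
  move=> t0; apply: (@continuous_comp _ _ _ (fun t => c * t)).
    by apply: cvgMr; exact: cvg_id.
  by apply: cm => //; exact: mulr_gt0.
have cg t : 0 < t -> {for t, continuous g} by exact: cm.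
have bf : bounded_on_pos f 1.
  by move=> t t0; apply: bm => //; exact: mulr_gt0.
have bg : bounded_on_pos g 1 by exact: bm.
apply: (laplace_inj cf cg bf bg) ltr01 => s s0.
have sc0 : 0 < s / c by exact: divr_gt0.
have lb r' y' z' (v : R) : 0 < v -> 0 < r' -> 0 <= y' <= z' ->
    laplace_integrable (plateau r' y' z') v.
  move=> v0 r'0 yz''; have /andP[_ ?] := yz''.
  apply: (@laplace_integrable_bounded _ _ 1) => //.
    by apply: measurable_funTS; exact: plateau_measurable.
  by move=> t _; apply: plateau_norm_le1 => //; exact: ltW.
rewrite laplace_scale//; last exact: (laplace_integrable_bounded sc0 mm (bm _ _ _ r0 yz)).
rewrite [in LHS](laplace_mean_plateau r0 yz sc0) [RHS](laplace_mean_plateau rk0 yzk s0).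
rewrite (powR_div _ s0 c0) (powR_div _ s0 c0) -/k.
have sk0 : 0 < s `^ alpha / k by rewrite divr_gt0// powR_gt0.
have -> : laplace (plateau (r * k) (y / k) (z / k)) (s `^ alpha) =
    k^-1 * laplace (plateau r y z) (s `^ alpha / k).
  rewrite -(laplace_scale k0 (lb _ _ _ _ sk0 r0 yz)).
  by apply: eq_laplace => t _; rewrite (plateau_scale _ _ _ _ kn0).
have -> : c `^ (alpha - 1) = k / c.
  by rewrite powRB ?(gt_eqF c0) ?implybT// powRr1// ltW.
by field; rewrite kn0 gt_eqF.
Qed.

(* This class contains the plateaus and is closed under sums and bounded pointwise
   limits, hence contains every bounded continuous function on the half-line. *)
Definition subordinable g := [/\ measurable_fun setT g, (exists B, forall x, `|g x| <= B),
  measurable_fun pos (mean g),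
  (forall s, 0 < s -> laplace (mean g) s = s `^ (alpha - 1) / 2 * laplace g (s `^ alpha)) &
  (forall t, 0 < t -> mean g t = mean (fun x => g (t `^ alpha * x)) 1)].

Lemma subordinable_plateau r y z : 0 < r -> 0 <= y <= z -> subordinable (plateau r y z).
Proof.
move=> r0 yz; have /andP[_ yz'] := yz; split.
- exact: plateau_measurable.
- by exists 1 => x; apply: plateau_norm_le1 => //; exact: ltW.
- by apply: (mean_test_measurable alpha01 solu); exact: plateau_test.
- by move=> s; exact: laplace_mean_plateau.
- by move=> t; exact: mean_plateau_scale.
Qed.

Lemma cvg_unique_seq (v w : nat -> R) (a b : R) : (forall n, v n = w n) ->
  v n @[n --> \oo] --> a -> w n @[n --> \oo] --> b -> a = b.
Proof.
move=> vw va wb; have E : v = w by exact/funext.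
by rewrite -(cvg_lim (@Rhausdorff R) va) -(cvg_lim (@Rhausdorff R) wb) E.
Qed.

Lemma measurable_scaled g c : measurable_fun setT g ->
  measurable_fun setT (fun x => g (c * x)).
Proof. by move=> mg; apply: measurableT_comp => //; exact: measurable_funM. Qed.

Lemma subordinable_cvg (fn : nat -> R -> R) f B : (forall n, subordinable (fn n)) ->
  (forall x, fn ^~ x @ \oo --> f x) -> (forall n x, `|fn n x| <= B) -> subordinable f.
Proof.
move=> gfn fnf fnB.
have mfn n : measurable_fun setT (fn n) by have [] := gfn n.
have [mf _] := mean_cvg u 1 mfn fnf fnB.
have mc t := (mean_cvg u t mfn fnf fnB).2.
have bm n : bounded_on_pos (mean (fn n)) B by move=> t _; exact: mean_bounded.
have mm n : measurable_fun pos (mean (fn n)) by have [] := gfn n.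
split=> //.
- by exists B; exact: norm_lim_le fnf fnB.
- by have [] := laplace_cvg (@ltr01 R) mm (fun t _ => mc t) bm.
- move=> s s0; have [_ c1] := laplace_cvg s0 mm (fun t _ => mc t) bm.
  have sa : 0 < s `^ alpha by exact: powR_gt0.
  have [_ c2] := laplace_cvg sa (fun n => measurable_funTS (mfn n)) (fun t _ => fnf t)
     (fun n t _ => fnB n t).
  have c3 : (s `^ (alpha - 1) / 2 * laplace (fn n) (s `^ alpha)) @[n --> \oo] -->
      s `^ (alpha - 1) / 2 * laplace f (s `^ alpha) by apply: cvgMr; exact: c2.
  apply: (cvg_unique_seq _ c1 c3) => n.
  by have [_ _ _ ->] := gfn n.
- move=> t t0; have [_ c2] := mean_cvg u 1 (fun n => measurable_scaled (t `^ alpha) (mfn n))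
     (fun x => fnf _) (fun n x => fnB n _).
  apply: (cvg_unique_seq _ (mc t) c2) => n.
  by have [_ _ _ _ ->] := gfn n.
Qed.

Lemma subordinableD f g : subordinable f -> subordinable g -> subordinable (fun x => f x + g x).
Proof.
move=> [mf [B fB] mmf lf sf] [mg [B' gB] mmg lg sg].
have meanD (h k : R -> R) t (b b' : R) : measurable_fun setT h -> (forall x, `|h x| <= b) ->
    measurable_fun setT k -> (forall x, `|k x| <= b') ->
    mean (fun x => h x + k x) t = mean h t + mean k t.
  by move=> mh hb mk kb; rewrite /mean RintegralD//;
    [exact: integrable_mean hb|exact: integrable_mean kb].
have ME : mean (fun x => f x + g x) = (mean f) \+ (mean g).
  by apply/funext => t; exact: meanD fB mg gB.
have bf : bounded_on_pos (mean f) B by move=> t _; exact: mean_bounded.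
have bg : bounded_on_pos (mean g) B' by move=> t _; exact: mean_bounded.
split.
- exact: measurable_funD.
- by exists (B + B') => x; rewrite (le_trans (ler_normD _ _))// lerD.
- by rewrite ME; exact: measurable_funD.
- move=> s s0; have sa : 0 < s `^ alpha by exact: powR_gt0.
  rewrite ME (laplaceD (laplace_integrable_bounded s0 mmf bf) (laplace_integrable_bounded s0 mmg bg)).2.
  rewrite lf// lg// -mulrDr; congr (_ * _); symmetry.
  apply: (laplaceD _ _).2.
    exact: (laplace_integrable_bounded sa (measurable_funTS mf) (fun t _ => fB t)).
  exact: (laplace_integrable_bounded sa (measurable_funTS mg) (fun t _ => gB t)).
- move=> t t0; rewrite ME /= sf// sg//; symmetry.
  by apply: meanD (fun x => fB _) _ (fun x => gB _); exact: measurable_scaled.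
Qed.

Lemma subordinableZ c f : subordinable f -> subordinable (fun x => c * f x).
Proof.
move=> [mf [B fB] mmf lf sf].
have ME : mean (fun x => c * f x) = (fun t => c * mean f t).
  by apply/funext => t; exact: meanZ fB.
have bf : bounded_on_pos (mean f) B by move=> t _; exact: mean_bounded.
split.
- exact: measurable_funM.
- by exists (`|c| * B) => x; rewrite normrM ler_wpM2l.
- by rewrite ME; exact: measurable_funM.
- move=> s s0; have sa : 0 < s `^ alpha by exact: powR_gt0.
  rewrite ME (laplaceZ _ (laplace_integrable_bounded s0 mmf bf)).2 lf// mulrCA.
  congr (_ * _); symmetry; apply: (laplaceZ _ _).2.
  exact: (laplace_integrable_bounded sa (measurable_funTS mf) (fun t _ => fB t)).
- move=> t t0; rewrite ME /= sf//; symmetry.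
  by apply: meanZ (fun x => fB _); exact: measurable_scaled.
Qed.

Lemma subordinable_sum (n : nat) (F : nat -> R -> R) : (forall i, subordinable (F i)) ->
  subordinable (fun x => \sum_(i < n) F i x).
Proof.
move=> gF; elim: n => [|n IH].
  have -> : (fun x => \sum_(i < 0) F i x) = (fun x => 0 * F 0%N x).
    by apply/funext => x; rewrite big_ord0 mul0r.
  exact: subordinableZ.
have -> : (fun x => \sum_(i < n.+1) F i x) = (fun x => \sum_(i < n) F i x + F n x).
  by apply/funext => x; rewrite big_ord_recr.
exact: subordinableD.
Qed.

Lemma subordinable_itv y z : 0 <= y <= z -> subordinable (fun x => (y < x <= z)%R%:R).
Proof.
move=> yz; have /andP[y0 yz'] := yz.
have r0 n : 0 < n.+1%:R :> R by [].
apply: (@subordinable_cvg (fun n => plateau n.+1%:R y z) _ 1).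
- by move=> n; exact: subordinable_plateau.
- move=> x; apply: cvg_near_cst.
  have N (e : R) : 0 < e -> \forall n \near \oo, n.+1%:R^-1 < e.
    by move=> e0; exact: (cvgr_lt _ cvg_harmonic).
  case: (leP x y) => [xy|yx] /=.
    by apply: nearW => n; apply: plateau_lt => //; exact: ltW.
  case: (leP x z) => [xz|zx] /=.
    have := N (x - y); rewrite subr_gt0 => /(_ yx); apply: filterS => n xy.
    by apply: plateau_in => //; rewrite xz andbT -lerBrDl ltW.
  have := N (x - z); rewrite subr_gt0 => /(_ zx); apply: filterS => n xy.
  by apply: plateau_gt => //; rewrite -lerBrDl ltW.
- by move=> n x; apply: plateau_norm_le1 => //; exact: ltW.
Qed.

Lemma nat_itv x : 0 < x -> exists j : nat, j%:R < x <= j.+1%:R.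
Proof.
move=> x0; have ex : exists n : nat, x <= n%:R.
  by exists (Num.truncn x).+1; rewrite ltW// truncnS_gt.
case: (ex_minnP ex) => -[|j] xj min; first by rewrite leNgt x0 in xj.
by exists j; rewrite xj andbT ltNge; apply/negP => /min; rewrite ltnn.
Qed.

Lemma subordinable_pos g B : (forall t, 0 < t -> {for t, continuous g}) ->
  bounded_on_pos g B -> subordinable (g \_ pos).
Proof.
move=> cg gB.
have B0 : 0 <= B by exact: le_trans (normr_ge0 _) (gB 1 ltr01).
(* Step functions on (n + 1)^2 cells of width 1 / (n + 1), which together cover ]0, n + 1]. Sampling
   at right endpoints keeps the argument of [g] positive, as nothing is assumed of [g] at 0. *)
pose S (n : nat) x := \sum_(i < n.+1 ^ 2)
  g (i.+1%:R / n.+1%:R) * (i%:R / n.+1%:R < x <= i.+1%:R / n.+1%:R)%R%:R.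
have r0 n : 0 < n.+1%:R :> R by [].
have S0 n x : x <= 0 -> S n x = 0.
  move=> x0; rewrite /S big1// => i _.
  have h : x <= i%:R / n.+1%:R by rewrite (le_trans x0)// divr_ge0// ltW.
  by rewrite [_ < x]ltNge h mulr0.
have SE n x j : j%:R < x * n.+1%:R <= j.+1%:R -> (j < n.+1 ^ 2)%N ->
    S n x = g (j.+1%:R / n.+1%:R).
  move=> /andP[jx xj] jn; rewrite /S (bigD1 (Ordinal jn))//= big1.
    by rewrite ltr_pdivrMr// ler_pdivlMr// jx xj mulr1 addr0.
  move=> i /eqP ij; rewrite ltr_pdivrMr// ler_pdivlMr//.
  case: (ltP i%:R _) => //= ix; last by rewrite mulr0.
  case: (leP _ i.+1%:R) => //= xi; last by rewrite mulr0.
  have i1 : (i < j.+1)%N by rewrite -(ltr_nat R) (lt_le_trans ix xj).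
  have i2 : (j < i.+1)%N by rewrite -(ltr_nat R) (lt_le_trans jx xi).
  by case: ij; apply: val_inj; apply: anti_leq; rewrite /= -ltnS i1 -ltnS.
have Sbig n x j : j%:R < x * n.+1%:R <= j.+1%:R -> ~~ (j < n.+1 ^ 2)%N -> S n x = 0.
  move=> /andP[jx xj] jn; rewrite /S big1// => i _.
  rewrite ltr_pdivrMr// ler_pdivlMr// [_ <= i.+1%:R]leNgt.
  have ij : i.+1%:R < x * n.+1%:R :> R.
    by rewrite (le_lt_trans _ jx)// ler_nat (leq_trans (ltn_ord i))// leqNgt.
  by rewrite ij andbF mulr0.
apply: (@subordinable_cvg S _ B).
- move=> n; pose F (i : nat) x := g (i.+1%:R / n.+1%:R) *
    (i%:R / n.+1%:R < x <= i.+1%:R / n.+1%:R)%R%:R.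
  apply: (@subordinable_sum _ F) => i; apply: subordinableZ; apply: subordinable_itv.
  apply/andP; split; first by rewrite divr_ge0.
  by rewrite ler_pM2r ?invr_gt0// ler_nat.
- move=> x; rewrite patch_posE; case: ltP => x0; last first.
    by apply: cvg_near_cst; apply: nearW => n; exact: S0.
  apply/cvgrPdist_lt => e e0.
  have /cvgrPdist_lt /(_ e e0) /nbhs_ballP[dl /= dl0 Hd] := cg x x0.
  have n1 : \forall n \near \oo, n.+1%:R^-1 < dl by exact: (cvgr_lt _ cvg_harmonic).
  have n2 : \forall n \near \oo, x <= n%:R by exact: nbhs_infty_ger.
  apply: filterS2 n1 n2 => n nd xn.
  have [j jx] := nat_itv (mulr_gt0 x0 (r0 n)).
  have /andP[jx1 jx2] := jx.
  have jn : (j < n.+1 ^ 2)%N.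
    rewrite -(ltr_nat R) (lt_le_trans jx1)// natrX expr2 ler_pM2r//.
    by rewrite (le_trans xn)// ler_nat.
  rewrite (SE _ _ _ jx jn); apply: Hd; rewrite /ball /= ltr_norml.
  have h1 : x <= j.+1%:R / n.+1%:R by rewrite ler_pdivlMr.
  have h2 : j.+1%:R / n.+1%:R < x + n.+1%:R^-1.
    by rewrite ltr_pdivrMr// mulrDl mulVf ?gt_eqF// -natr1 ltrD2r.
  have {}h2 : j.+1%:R / n.+1%:R < x + dl by rewrite (lt_trans h2)// ltrD2l.
  by rewrite ltrBrDr addrC ltrBlDr h2 (le_lt_trans _ dl0)// subr_le0.
- move=> n x; case: (ltP 0 x) => x0; last by rewrite S0// normr0.
  have [j jx] := nat_itv (mulr_gt0 x0 (r0 n)).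
  case: (boolP (j < n.+1 ^ 2)%N) => jn; last by rewrite (Sbig _ _ _ jx jn) normr0.
  by rewrite (SE _ _ _ jx jn) gB// divr_gt0.
Qed.

End self_similarity.

(** * Subordination of bounded continuous functions on the half-line *)

Section half_line.
Context {R : realType} (alpha : R) (u : R -> probability (measurableTypeR R) R).
Hypothesis alpha01 : 0 < alpha <= 1.
Hypothesis solu : fundamental_solution alpha u.
Local Notation mu := (@lebesgue_measure R).
Local Notation pos := (`]0, +oo[%classic : set R).
Implicit Types (f g : R -> R) (t s x B M : R).

Lemma mean_pos_bounded g B t : measurable_fun setT (g \_ pos) ->
  (bounded_on_pos g B) -> `|mean u (g \_ pos) t| <= B.
Proof.
move=> mg gB; apply: mean_bounded => // x.
rewrite patch_posE; case: ifP => [/gB//|_]; rewrite normr0.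
exact: le_trans (normr_ge0 _) (gB 1 ltr01).
Qed.

Lemma mean_pos_continuous g B t : (forall t, 0 < t -> {for t, continuous g}) ->
  bounded_on_pos g B -> 0 < t -> {for t, continuous (mean u (g \_ pos))}.
Proof.
move=> cg gB t0; have [mg _ _ _ ss] := subordinable_pos alpha01 solu cg gB.
have B0 : 0 <= B by exact: le_trans (normr_ge0 _) (gB 1 ltr01).
(* Time now sits in the integrand, under the fixed law [u 1], so dominated convergence along
   sequences applies. For x <= 0 the integrand is 0 at all times, so the jump of [g \_ pos] at 0
   does no harm. *)
pose h r := mean u (fun x => (g \_ pos) (r `^ alpha * x)) 1.
have hE : {near t, h =1 mean u (g \_ pos)}.
  by have := lt_nbhsr t0; apply: filterS => r r0; rewrite /h -ss.
have ch : {for t, continuous h}.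
  suff : h x @[x --> t] --> h t by [].
  apply: (@cvg_nbhsP R R^o h t (h t)).2 => v' vt'.
  pose v : nat -> R := v'; have vt : v @ \oo --> t := vt'.
  have vat : (fun n => v n `^ alpha) @ \oo --> t `^ alpha.
    by apply: (@cvg_comp _ _ _ v (fun x => x `^ alpha) _ _ _ vt); exact: continuous_powR.
  have c x : (fun n => (g \_ pos) (v n `^ alpha * x)) @ \oo --> (g \_ pos) (t `^ alpha * x).
    case: (ltP 0 x) => x0; last first.
      apply: cvg_near_cst; apply: nearW => n.
      by rewrite !patch_posE !ltNge !mulr_ge0_le0 ?powR_ge0.
    have tx0 : 0 < t `^ alpha * x by rewrite mulr_gt0// powR_gt0.
    have cG : {for t `^ alpha * x, continuous (g \_ pos)}.
      rewrite /prop_for /continuous_at patch_posE tx0.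
      apply: cvg_trans (cg _ tx0); apply: near_eq_cvg.
      by have := lt_nbhsr tx0; apply: filterS => y y0; rewrite patch_posE y0.
    apply: (@cvg_comp _ _ _ (fun n => v n `^ alpha * x) (g \_ pos) _ _ _ _ cG).
    by apply: cvgMl.
  have b n x : `|(g \_ pos) (v n `^ alpha * x)| <= B.
    by rewrite patch_posE; case: ifP => [/gB//|_]; rewrite normr0.
  exact: (mean_cvg u 1 (fun n => measurable_scaled (v n `^ alpha) mg) c b).2.
suff : mean u (g \_ pos) r @[r --> t] --> h t by rewrite /h -(ss t t0).
by apply: cvg_trans ch; apply: near_eq_cvg.
Qed.

(* Both sides have Laplace transform s^(alpha-1) (L g)(s^alpha). *)
Lemma laplace_subordination f g B M : (forall t, 0 < t -> {for t, continuous g}) ->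
  bounded_on_pos g B ->
  (forall t, 0 < t -> {for t, continuous f}) -> bounded_on_pos f M ->
  (forall s, 0 < s -> laplace f s = s `^ (alpha - 1) * laplace g (s `^ alpha)) ->
  forall t, 0 < t -> f t = 2 * mean u (g \_ pos) t.
Proof.
move=> cg gB cf fM Lf; have [mg _ mm Lm _] := subordinable_pos alpha01 solu cg gB.
have mB : bounded_on_pos (mean u (g \_ pos)) B.
  by move=> t _; exact: mean_pos_bounded.
apply: (laplace_inj (M := M) (M' := 2 * B)) => //.
- move=> t t0; apply: cvgMr; exact: mean_pos_continuous gB t0.
- by move=> t t0; rewrite normrM ger0_norm// ler_pM2l//; exact: mB.
move=> s s0; rewrite Lf// (laplaceZ _ (laplace_integrable_bounded s0 mm mB)).2 Lm//.
rewrite mulrA mulrCA divff// mulr1; congr (_ * _).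
by apply: eq_laplace => t t0; rewrite patch_posE t0.
Qed.

(** Since 1 / s = s^(alpha-1) / s^alpha, the constant 1 is subordinated to itself. *)
Lemma mean_pos1 t : 0 < t -> mean u ((cst 1 : R -> R) \_ pos) t = 2^-1.
Proof.
move=> t0; have c1 r : 0 < r -> {for r, continuous (cst 1 : R -> R)}.
  by move=> _; exact: cvg_cst.
have b1 : bounded_on_pos (cst 1 : R -> R) 1 by move=> r _; rewrite normr1.
have L s : 0 < s -> laplace (cst 1) s = s `^ (alpha - 1) * laplace (cst 1) (s `^ alpha).
  move=> s0; rewrite (laplace1 s0).2 (laplace1 (powR_gt0 alpha s0)).2.
  rewrite powRB ?(gt_eqF s0) ?implybT// powRr1 ?ltW//.
  by field; rewrite !gt_eqF// powR_gt0.
have := laplace_subordination c1 b1 c1 b1 L t0.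
by move=> /= E; apply: (@mulfI _ 2) => //; rewrite divff.
Qed.

End half_line.

(** * Birth processes and subordination *)

Section bounded_continuous.
Context {R : realType}.
Implicit Types (f g : R -> R) (t c : R).

Definition bounded_continuous f :=
  (forall t, 0 < t -> {for t, continuous f}) /\ exists B, bounded_on_pos f B.

Lemma bounded_continuousD f g : bounded_continuous f -> bounded_continuous g ->
  bounded_continuous (fun t => f t + g t).
Proof.
move=> [cf [B fB]] [cg [B' gB]]; split.
  by move=> t t0; apply: cvgD; [exact: cf|exact: cg].
by exists (B + B') => t t0; rewrite (le_trans (ler_normD _ _))// lerD ?fB ?gB.
Qed.

Lemma bounded_continuousZ c f : bounded_continuous f ->
  bounded_continuous (fun t => c * f t).
Proof.
move=> [cf [B fB]]; split; first by move=> t t0; apply: cvgMr; exact: cf.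
by exists (`|c| * B) => t t0; rewrite normrM ler_wpM2l ?fB.
Qed.

Lemma bounded_continuous_sum (r : seq nat) (F : nat -> R -> R) :
  (forall i, bounded_continuous (F i)) ->
  bounded_continuous (fun t => \sum_(i <- r) F i t).
Proof.
move=> cF; elim: r => [|i r IH].
  rewrite (_ : (fun t => _) = cst 0); last by apply/funext => t; rewrite big_nil.
  split; first by move=> t _; exact: cvg_cst.
  by exists 0 => t _; rewrite normr0.
rewrite (_ : (fun t => _) = (fun t => F i t + \sum_(j <- r) F j t)).
  exact: bounded_continuousD.
by apply/funext => t; rewrite big_cons.
Qed.

Lemma bounded_continuous_measurable f : bounded_continuous f ->
  measurable_fun (`]0, +oo[ : set R) f.
Proof. by move=> [cf _]; exact: continuous_pos_measurable. Qed.

Lemma bounded_continuous_laplace f s : 0 < s -> bounded_continuous f ->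
  laplace_integrable f s.
Proof.
move=> s0 bf; have [_ [B fB]] := bf.
exact: laplace_integrable_bounded s0 (bounded_continuous_measurable bf) fB.
Qed.

Lemma bounded_continuous_integrable f t : 0 < t -> bounded_continuous f ->
  (@lebesgue_measure R).-integrable `]0, t[ (EFin \o f).
Proof.
move=> t0 bf; have [_ [B fB]] := bf.
apply: (@integrable_itv_bounded _ _ _ B).
  by apply: measurable_pos_oo; exact: bounded_continuous_measurable.
by move=> r /andP[r0 _]; exact: fB.
Qed.

Lemma bounded_continuous_eq f g : (forall t, 0 < t -> f t = g t) ->
  bounded_continuous f -> bounded_continuous g.
Proof.
move=> fg [cf [B fB]]; split; last by exists B => t t0; rewrite -fg ?fB.
move=> t t0; suff : g r @[r --> t] --> f t by rewrite fg.
apply: cvg_trans (cf t t0); apply: near_eq_cvg.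
by have := lt_nbhsr t0; apply: filterS => r r0; rewrite fg.
Qed.

End bounded_continuous.

Section fractional_birth_process.
Context {R : realType} (alpha : R) (k n0 : nat) (lam : int -> nat -> R).
Context (d : measure_display) (T : measurableType d) (P : probability T R).
Context (X : R -> T -> option nat).
Hypothesis alpha01 : 0 < alpha <= 1.
Hypothesis procX : is_gfbp alpha k n0 lam P X.
Implicit Types (s t : R) (n m i : nat).
Local Notation p := (state_prob P X).
Local Notation mu := (@lebesgue_measure R).

Lemma state_prob_ge0 n t : 0 <= p n t.
Proof. exact: fine_ge0. Qed.

Lemma state_prob_bounded n : bounded_on_pos (p n) 1.
Proof.
move=> t t0; rewrite ger0_norm ?state_prob_ge0//.
have mX := gfbp_measurable procX n (ltW t0).
rewrite -lee_fin fineK; first exact: probability_le1.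
exact: fin_num_measure.
Qed.

Lemma state_prob_lac n : (n0 <= n)%N -> locally_abs_cont (p n 0) (p n).
Proof.
move=> n0n; have [ac _ _] := gfbp_equation procX n0n.
by apply: (ac 0%N); rewrite caputo_order1.
Qed.

Lemma state_prob_bc n : bounded_continuous (p n).
Proof.
case: (leqP n0 n) => n0n.
  split; last by exists 1; exact: state_prob_bounded.
  by move=> t; apply: locally_abs_cont_continuous; exact: state_prob_lac.
apply: (@bounded_continuous_eq _ (cst 0)).
  by move=> t t0; rewrite (gfbp_lt procX n0n (ltW t0)).
split; first by move=> t _; exact: cvg_cst.
by exists 0 => t _; rewrite normr0.
Qed.

Lemma birth_rhsE n t : birth_rhs k lam p n t =
  - (\sum_(1 <= i < k.+1) lam n i) * p n t +
  \sum_(1 <= i < (minn n k).+1) lam (n - i)%N i * p (n - i)%N t.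
Proof. by rewrite /birth_rhs mulNr mulr_suml. Qed.

Lemma birth_rhs_bc n : bounded_continuous (birth_rhs k lam p n).
Proof.
rewrite (_ : birth_rhs _ _ _ _ = (fun t => - (\sum_(1 <= i < k.+1) lam n i) * p n t +
  \sum_(1 <= i < (minn n k).+1) lam (n - i)%N i * p (n - i)%N t)); last first.
  by apply/funext => t; rewrite birth_rhsE.
apply: bounded_continuousD; first by apply: bounded_continuousZ; exact: state_prob_bc.
by apply: bounded_continuous_sum => i; apply: bounded_continuousZ; exact: state_prob_bc.
Qed.

Lemma state_prob_init n : p n 0 = (n == n0)%:R.
Proof.
case: ltngtP => [nn0|n0n|->]; last exact: gfbp_init procX.
- exact: (gfbp_lt procX).
- exact: (gfbp_init_gt procX).
Qed.

Lemma laplace_state_prob n s : (n0 <= n)%N -> 0 < s ->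
  (s `^ alpha + \sum_(1 <= i < k.+1) lam n i) * laplace (p n) s =
  s `^ (alpha - 1) * (n == n0)%:R +
  \sum_(1 <= i < (minn n k).+1) lam (n - i)%N i * laplace (p (n - i)%N) s.
Proof.
move=> n0n s0; have [_ [B FB]] := birth_rhs_bc n.
have alpha2 : 0 < alpha <= 2 by move: alpha01; lra.
have := caputo_laplace alpha2 s0 (gfbp_equation procX n0n) _ (@state_prob_bounded n)
  (bounded_continuous_measurable (birth_rhs_bc n)) FB.
rewrite caputo_order1// => H0.
have {H0} : s `^ alpha * (laplace (p n) s - p n 0 / s) = laplace (birth_rhs k lam p n) s by exact: H0.
have lp m := bounded_continuous_laplace s0 (state_prob_bc m).
have E1 := laplaceZ (- \sum_(1 <= i < k.+1) lam n i) (lp n).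
have E2 := laplace_sum (index_iota 1 (minn n k).+1)
  (fun i => (laplaceZ (lam (n - i)%N i) (lp (n - i)%N)).1).
have [_ E] := laplaceD E1.1 E2.1.
rewrite (@eq_laplace _ (birth_rhs _ _ _ _) _ s (fun t _ => birth_rhsE n t)).
rewrite E E1.2 E2.2 state_prob_init.
rewrite powRB ?(gt_eqF s0) ?implybT// powRr1 ?(ltW s0)// => H.
have E3 : \sum_(i <- index_iota 1 (minn n k).+1) laplace (fun t => lam (n - i)%N i * p (n - i)%N t) s =
    \sum_(1 <= i < (minn n k).+1) lam (n - i)%N i * laplace (p (n - i)%N) s.
  by apply: eq_bigr => i _; rewrite (laplaceZ _ (lp _)).2.
rewrite -E3.
move: H; set A := s `^ alpha; set L := laplace _ _; set M := \sum_(_ <= _ < _) _.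
set S := (X in _ * L + X) => H.
have -> : (A + M) * L = A * (L - (n == n0)%:R / s) + A * ((n == n0)%:R / s) + M * L by ring.
rewrite [RHS](_ : _ = A / s * (n == n0)%:R + S)// H; ring.
Qed.

End fractional_birth_process.

Section subordination.
Context {R : realType} (alpha : R) (k n0 : nat) (lam : int -> nat -> R).
Context (d : measure_display) (T : measurableType d) (P : probability T R).
Context (X : R -> T -> option nat).
Context (d' : measure_display) (T' : measurableType d') (P' : probability T' R).
Context (Xalpha : R -> T' -> option nat).
Context (u : R -> probability (measurableTypeR R) R).
Hypothesis alpha01 : 0 < alpha <= 1.
Hypothesis lam_gt0 : forall (n : int) (i : nat),
  n0%:Z <= n -> (1 <= i <= k)%N -> 0 < lam n i.
Hypothesis gbpX : is_gbp k n0 lam P X.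
Hypothesis gfbpX : is_gfbp alpha k n0 lam P' Xalpha.
Hypothesis solu : fundamental_solution alpha u.
Implicit Types (s t x : R) (n m i : nat).
Local Notation p := (state_prob P X).
Local Notation palpha := (state_prob P' Xalpha).
Local Notation mu := (@lebesgue_measure R).
Local Notation pos := (`]0, +oo[%classic : set R).

Lemma order1_bounds : 0 < (1 : R) <= 1.
Proof. by rewrite ltr01 lexx. Qed.

Lemma total_rate_ge0 n : (n0 <= n)%N -> 0 <= \sum_(1 <= i < k.+1) lam n i.
Proof.
move=> n0n; rewrite big_nat_cond; apply: sumr_ge0 => i; rewrite andbT ltnS => ik.
by rewrite ltW// lam_gt0.
Qed.

Lemma laplace_fractional n s : 0 < s ->
  laplace (palpha n) s = s `^ (alpha - 1) * laplace (p n) (s `^ alpha).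
Proof.
move=> s0; have sa : 0 < s `^ alpha by exact: powR_gt0.
have Z f : (forall t, 0 < t -> f t = 0) -> forall v, laplace f v = 0.
  move=> f0 v; rewrite (@eq_laplace _ f (fun t => 0 * cst 0 t) v).
    rewrite /laplace; under eq_Rintegral do rewrite mul0r mulr0.
    by rewrite Rintegral_cst//= mul0r.
  by move=> t /f0 ->; rewrite mul0r.
elim/ltn_ind: n => n IH; case: (leqP n0 n) => n0n; last first.
  rewrite !Z ?mulr0// => t t0.
    by rewrite (gfbp_lt gbpX n0n (ltW t0)).
  by rewrite (gfbp_lt gfbpX n0n (ltW t0)).
have H1 := laplace_state_prob order1_bounds gbpX n0n sa.
have H2 := laplace_state_prob alpha01 gfbpX n0n s0.
(* The equation of order 1 at s^alpha and that of order alpha at s share this positive coefficient,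
   so it suffices to compare the right-hand sides. *)
have D0 : s `^ alpha + \sum_(1 <= i < k.+1) lam n i != 0.
  by rewrite gt_eqF// ltr_wpDr// total_rate_ge0.
apply: (mulfI D0); rewrite H2 mulrCA.
rewrite powRr1 ?(ltW sa)// subrr powRr0 mul1r in H1.
rewrite H1 mulrDr; congr (_ + _); rewrite mulr_sumr.
rewrite big_nat_cond [RHS]big_nat_cond; apply: eq_bigr => i.
rewrite andbT ltnS leq_min => /and3P[i1 ni _].
rewrite mulrCA -IH// ltn_subrL i1; exact: leq_trans ni.
Qed.

Lemma subordination n t : 0 < t -> palpha n t = 2 * mean u (p n \_ pos) t.
Proof.
move=> t0; have [cp _] := state_prob_bc order1_bounds gbpX n.
have [cq _] := state_prob_bc alpha01 gfbpX n.
apply: (laplace_subordination alpha01 solu cp (@state_prob_bounded _ _ _ _ _ _ _ _ _ gbpX n)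
  cq (@state_prob_bounded _ _ _ _ _ _ _ _ _ gfbpX n)) t0 => s.
exact: laplace_fractional.
Qed.

Lemma state_prob_patch_measurable n : measurable_fun setT (p n \_ pos).
Proof.
apply: measurable_patch_pos; apply: bounded_continuous_measurable.
exact: state_prob_bc order1_bounds gbpX n.
Qed.

Lemma state_prob_patch_bounded n x : `|(p n \_ pos) x| <= 1.
Proof.
rewrite patch_posE; case: ifP => [x0|_]; last by rewrite normr0.
exact: state_prob_bounded gbpX n x x0.
Qed.

Lemma state_prob_patch_mean n t : (\int[u t]_(x in pos) (p n x)%:E)%E =
  (mean u (p n \_ pos) t)%:E.
Proof.
rewrite integral_mkcond /mean /Rintegral fineK; last first.
  apply: integrable_fin_num => //.
  apply: (@integrable_mean _ _ _ _ 1); first exact: state_prob_patch_measurable.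
  exact: state_prob_patch_bounded.
by apply: eq_integral => x _; rewrite patchE /= patchE; case: ifP.
Qed.

Lemma subordination_folded n t : 0 < t -> (palpha n t)%:E =
  (\int[folded_measure (u t)]_(x in `]0%R, +oo[) (p n x)%:E)%E.
Proof.
move=> t0; have mp : measurable_fun pos (EFin \o p n).
  apply/measurable_EFinP; apply: bounded_continuous_measurable.
  exact: state_prob_bc order1_bounds gbpX n.
rewrite /folded_measure ge0_integral_mscale//.
- rewrite subordination// EFinM; congr (_ * _)%E.
  rewrite -state_prob_patch_mean.
  apply/esym/eq_measure_integral => A mA Ap.
  by rewrite /= /mrestr setIidl.
- by move=> x _; rewrite lee_fin; exact: state_prob_ge0.
Qed.

End subordination.

(** * Integration against a density *)

Section density.
Context {R : realType} (nu : probability (measurableTypeR R) R) (f : R -> R).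
Hypothesis nuf : has_density nu f.
Local Notation mu := (@lebesgue_measure R).

(* The density may be negative on a null set, hence the detour through the
   Radon-Nikodym derivative, which is nonnegative everywhere. *)
Lemma integral_density (g : R -> R) : measurable_fun setT g -> (forall x, 0 <= g x) ->
  (\int[mu]_x (g x * f x)%:E = \int[nu]_x (g x)%:E)%E.
Proof.
move=> mg g0; have [mf nuE] := nuf.
have mEf : measurable_fun setT (EFin \o f) by exact/measurable_EFinP.
have numu : nu `<< mu.
  apply/null_content_dominatesP => A mA mA0; rewrite nuE//.
  by rewrite null_set_integral//; exact: measurable_funTS.
pose h := Radon_Nikodym_SigmaFinite.f nu mu.
have ih : mu.-integrable setT h by exact: Radon_Nikodym_SigmaFinite.f_integrable.
(* Both functions integrate to [nu] over every measurable set, hence they agree almost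
   everywhere. *)
have hf : ae_eq mu setT h (EFin \o f).
  apply: integral_ae_eq => // A _ mA; rewrite -nuE//.
  by apply/esym; exact: Radon_Nikodym_SigmaFinite.f_integral.
rewrite -(@Radon_Nikodym_SigmaFinite.change_of_variables _ _ _ nu mu numu (EFin \o g) setT)//.
apply: ae_eq_integral => //.
- by apply/measurable_EFinP; exact: measurable_funM.
- apply: emeasurable_funM; [exact/measurable_EFinP|exact: measurable_int ih].
- by apply: filterS hf => x hx _; rewrite /= -/h (hx I) EFinM.
exact/measurable_EFinP.
Qed.

End density.

Section subordination_density.
Context {R : realType} (nu : probability (measurableTypeR R) R) (f g : R -> R).
Local Notation mu := (@lebesgue_measure R).
Local Notation pos := (`]0, +oo[%classic : set R).

Lemma integral_folded : has_density nu f ->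
  measurable_fun setT (g \_ pos) -> (forall x, 0 <= g x) ->
  (\int[mu]_(x in `]0%R, +oo[) (g x * folded f x)%:E =
   2%:E * \int[nu]_(x in `]0%R, +oo[) (g x)%:E)%E.
Proof.
move=> nuf mg g0; rewrite integral_mkcond [in RHS]integral_mkcond.
have p0 x : 0 <= (g \_ pos) x by rewrite patch_posE; case: ifP.
transitivity (\int[mu]_x (2 * (g \_ pos) x * f x)%:E)%E.
  apply: eq_integral => x _; rewrite patchE /= patch_posE /folded mem_setE in_itv /= andbT.
  by case: ltP => _; [congr EFin; ring|rewrite mulr0 mul0r].
rewrite (integral_density nuf (g := fun x => 2 * (g \_ pos) x)); last 2 first.
- exact: measurable_funM.
- by move=> x; rewrite mulr_ge0.
transitivity (\int[nu]_x (2%:E * ((g \_ pos) x)%:E))%E => [//|].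
rewrite ge0_integralZl_EFin//.
- congr (_ * _)%E; apply: eq_integral => x _.
  by rewrite patchE /= patchE; case: ifP.
- by move=> x _; rewrite lee_fin.
- exact/measurable_EFinP.
Qed.

End subordination_density.

(** * Total mass *)

Section total_mass.
Context {R : realType} (k n0 : nat) (lam : int -> nat -> R).
Context (d : measure_display) (T : measurableType d) (P : probability T R).
Context (X : R -> T -> option nat).
Hypothesis lam_gt0 : forall (n : int) (i : nat),
  n0%:Z <= n -> (1 <= i <= k)%N -> 0 < lam n i.
Hypothesis lam_eq0 : forall (n : int) (i : nat), n < n0%:Z -> lam n i = 0.
Hypothesis gbpX : is_gbp k n0 lam P X.
Implicit Types (s t x y : R) (n m i N : nat).
Local Notation p := (state_prob P X).
Local Notation mu := (@lebesgue_measure R).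
Local Notation pos := (`]0, +oo[%classic : set R).

(** A jump of size [i] from [n < N] crosses level [N] exactly when [n >= N - i]. Truncated
    subtraction is right here: if [i > N], every state below [N] qualifies. *)
Definition flux N t := \sum_(1 <= i < k.+1) \sum_(N - i <= n < N) lam n i * p n t.

Lemma rate_ge0 (n : int) i : (1 <= i <= k)%N -> 0 <= lam n i.
Proof.
by move=> ik; case: (leP n0%:Z n) => [/lam_gt0/(_ ik)/ltW//|/lam_eq0 ->].
Qed.

(** Jumps between two states below [N] cancel in the sum, which leaves the outflow across [N]. *)
Lemma sum_birth_rhs N t : \sum_(0 <= n < N) birth_rhs k lam p n t = - flux N t.
Proof.
elim: N => [|N IH].
  by rewrite big_geq// /flux big1 ?oppr0// => i _; rewrite big_geq.
rewrite big_nat_recr//= IH /birth_rhs.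
have E : \sum_(1 <= i < (minn N k).+1) lam (N - i)%N i * p (N - i)%N t =
    \sum_(1 <= i < k.+1) if (i <= N)%N then lam (N - i)%N i * p (N - i)%N t else 0.
  rewrite (big_nat_widen _ _ k.+1)/= ?ltnS ?geq_minr// big_mkcond/=.
  rewrite big_nat_cond [RHS]big_nat_cond; apply: eq_bigr => i.
  by rewrite andbT ltnS => /andP[_ ik]; rewrite ltnS leq_min ik andbT.
suff H : flux N t + \sum_(1 <= i < k.+1) lam N i * p N t =
    flux N.+1 t + \sum_(1 <= i < k.+1) if (i <= N)%N then lam (N - i)%N i * p (N - i)%N t else 0.
  by rewrite E addrA -opprD H; ring.
(* From [N] to [N.+1] the window of sources for jumps of size i gains the state N and loses N - i;
   when i > N there is nothing to lose. *)
rewrite /flux -!big_split /= big_nat_cond [RHS]big_nat_cond; apply: eq_bigr => i.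
rewrite andbT ltnS => /andP[i1 _].
have Ni : (N.+1 - i <= N)%N by rewrite leq_subLR -add1n leq_add2r.
rewrite (@big_nat_recr _ _ _ _ (N.+1 - i))//=; case: leqP => iN; last first.
  have -> : (N.+1 - i = 0)%N by apply/eqP; rewrite subn_eq0.
  have -> : (N - i = 0)%N by apply/eqP; rewrite subn_eq0 ltnW.
  by rewrite addr0.
rewrite [in LHS]big_ltn ?ltn_subrL ?i1 ?(leq_trans i1)//= subSn//; ring.
Qed.

Lemma state_prob_integral n t : 0 < t ->
  p n t = (n == n0)%:R + \int[mu]_(s in `]0, t[) birth_rhs k lam p n s.
Proof.
move=> t0; rewrite -(state_prob_init gbpX); case: (leqP n0 n) => n0n.
  have lac := state_prob_lac order1_bounds gbpX n0n.
  have := locally_abs_contE lac t0; rewrite (eq_hconv _ (w := birth_rhs k lam p n)).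
    by rewrite hconv1E => <-; ring.
  move=> r /andP[r0 _]; have [_ _ /(_ r r0)] := gfbp_equation gbpX n0n.
  by rewrite /caputo caputo_order1 ?order1_bounds// eqxx derive1n1.
(* Below [n0] the rates vanish by convention, so both sides are 0 and the formula may be summed from
   0. *)
rewrite (gfbp_lt gbpX n0n (ltW t0)) (gfbp_lt gbpX n0n (lexx 0)) add0r.
under eq_Rintegral => r.
  rewrite inE /= in_itv /= => /andP[r0 _].
  rewrite (_ : birth_rhs k lam p n r = 0); last first.
    rewrite /birth_rhs !big1 ?oppr0 ?addr0// => i _.
      by rewrite lam_eq0 ?mul0r// ltz_nat (leq_ltn_trans (leq_subr _ _)).
    by rewrite lam_eq0 ?mul0r.
  over.
by rewrite Rintegral_cst//= mul0r.
Qed.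

Lemma state_prob_bc1 n : bounded_continuous (p n).
Proof. exact: state_prob_bc order1_bounds gbpX n. Qed.

Lemma flux_bc N : bounded_continuous (flux N).
Proof.
apply: bounded_continuous_sum => i; apply: bounded_continuous_sum => n.
by apply: bounded_continuousZ; exact: state_prob_bc1.
Qed.

Lemma flux_ge0 N t : 0 <= flux N t.
Proof.
rewrite /flux big_nat_cond; apply: sumr_ge0 => i; rewrite andbT ltnS => ik.
by apply: sumr_ge0 => n _; rewrite mulr_ge0 ?rate_ge0// state_prob_ge0.
Qed.

Lemma total_mass_integral N t : 0 < t ->
  \sum_(0 <= n < N) p n t = (n0 < N)%N%:R - \int[mu]_(s in `]0, t[) flux N s.
Proof.
move=> t0; have I F : bounded_continuous F -> mu.-integrable `]0, t[ (EFin \o F).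
  exact: bounded_continuous_integrable.
have -> : \int[mu]_(s in `]0, t[) flux N s =
    - \int[mu]_(s in `]0, t[) \sum_(0 <= n < N) birth_rhs k lam p n s.
  rewrite -[RHS]mulN1r -RintegralZl//.
    by apply: eq_Rintegral => s _; rewrite sum_birth_rhs mulN1r opprK.
  apply: I; apply: bounded_continuous_sum => n.
  exact: birth_rhs_bc order1_bounds gbpX n.
rewrite opprK; elim: N => [|N IH].
  rewrite big_geq// ltn0 add0r; under eq_Rintegral do rewrite big_geq//.
  by rewrite Rintegral_cst//= mul0r.
have brc n : bounded_continuous (birth_rhs k lam p n).
  exact: birth_rhs_bc order1_bounds gbpX n.
have E : \int[mu]_(s in `]0, t[) \sum_(0 <= n < N.+1) birth_rhs k lam p n s =
    \int[mu]_(s in `]0, t[) \sum_(0 <= n < N) birth_rhs k lam p n s +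
    \int[mu]_(s in `]0, t[) birth_rhs k lam p N s.
  rewrite -(@RintegralD _ _ _ mu _ (fun s => \sum_(0 <= n < N) birth_rhs k lam p n s)
    (birth_rhs k lam p N))//; [|apply: I|exact: I].
    by apply: eq_Rintegral => s _; rewrite big_nat_recr.
  exact: bounded_continuous_sum.
rewrite big_nat_recr//= IH state_prob_integral// E.
have -> : (n0 < N.+1)%N%:R = (n0 < N)%N%:R + (N == n0)%:R :> R.
  by rewrite ltnS leq_eqVlt eq_sym; case: ltngtP; rewrite ?addr0 ?add0r.
ring.
Qed.

Lemma total_mass_le1 N t : 0 < t -> \sum_(0 <= n < N) p n t <= 1.
Proof.
move=> t0; rewrite total_mass_integral// lerBlDr (@le_trans _ _ 1)//.
  by case: (n0 < N)%N.
by rewrite lerDl; apply: Rintegral_ge0 => // s _; exact: flux_ge0.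
Qed.

Lemma total_mass_decreasing N x y : 0 < x -> x <= y ->
  \sum_(0 <= n < N) p n y <= \sum_(0 <= n < N) p n x.
Proof.
move=> x0 xy; have y0 := lt_le_trans x0 xy.
rewrite !total_mass_integral// lerD2l lerN2; apply: le_Rintegral_itv0 => //.
- by move=> s _; exact: flux_ge0.
- by apply: bounded_continuous_integrable => //; exact: flux_bc.
Qed.

Lemma total_mass_nondecreasing t : nondecreasing_seq (fun N => \sum_(0 <= n < N) p n t).
Proof.
by apply/nondecreasing_seqP => N; rewrite big_nat_recr//= lerDl state_prob_ge0.
Qed.

Lemma total_mass_limit t : 0 < t -> exists l, [/\
  (fun N => \sum_(0 <= n < N) p n t) @ \oo --> l, l <= 1 &
  forall N, \sum_(0 <= n < N) p n t <= l].
Proof.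
move=> t0; have c : cvgn (fun N => \sum_(0 <= n < N) p n t).
  apply: nondecreasing_is_cvgn; first exact: total_mass_nondecreasing.
  by exists 1 => _ [N _ <-]; exact: total_mass_le1.
exists (lim ((fun N => \sum_(0 <= n < N) p n t) @ \oo)); split => //.
  by apply: limr_le => //; apply: nearW => N; exact: total_mass_le1.
by move=> N; apply: nondecreasing_cvgn_le => //; exact: total_mass_nondecreasing.
Qed.

End total_mass.

Lemma nneseries_eq1 (R : realType) (f : nat -> R) (n0 : nat) : (forall m, 0 <= f m) ->
  ((\sum_(n0 <= m <oo) (f m)%:E)%E = 1%E) <->
  ((fun N => \sum_(n0 <= m < N) f m) @ \oo --> (1 : R)).
Proof.
move=> f0; pose S N := \sum_(n0 <= m < N) f m.
have E : (fun N => \sum_(n0 <= m < N) (f m)%:E)%E = EFin \o S.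
  by apply/funext => N; rewrite /= sumEFin.
split=> [H|H].
- have c : cvgn (EFin \o S).
    by rewrite -E; apply: is_cvg_nneseries => m _ _; rewrite lee_fin.
  have {}c : (EFin \o S) @ \oo --> 1%:E by rewrite -H E.
  exact: (fine_cvg c).
- by rewrite E; apply: cvg_lim => //; apply: cvg_EFin => //; exact: nearW.
Qed.

(** * Transfer of total mass between the two processes *)

Section tail.
Context {R : realType} (alpha : R) (u : R -> probability (measurableTypeR R) R).
Hypothesis alpha01 : 0 < alpha <= 1.
Hypothesis solu : fundamental_solution alpha u.
Local Notation pos := (`]0, +oo[%classic : set R).
Implicit Types (t x y : R).

Lemma subordinable_tail y : 0 <= y -> subordinable alpha u (fun x => (y < x)%R%:R).
Proof.
move=> y0; apply: (@subordinable_cvg _ _ _ (fun n x => (y < x <= y + n%:R)%R%:R) _ 1).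
- by move=> n; apply: (subordinable_itv alpha01 solu); rewrite y0 lerDl ler0n.
- move=> x; apply: cvg_near_cst.
  have : \forall n \near \oo, x - y <= n%:R by exact: nbhs_infty_ger.
  by apply: filterS => n; rewrite lerBlDl => ->; rewrite andbT.
- by move=> n x; case: (_ && _); rewrite ?normr1 ?normr0.
Qed.

Lemma mean_tail_gt0 y : 0 < y -> exists2 t, 0 < t & 0 < mean u (fun x => (y < x)%R%:R) t.
Proof.
move=> y0; have a0 : 0 < alpha by case/andP: alpha01.
have [mg _ _ _ ss] := subordinable_tail (ltW y0).
(* Times with t^alpha = n + 1. By self-similarity the mass of ]y, +oo[ at such a time is that of ]y
   / (n + 1), +oo[ at time 1, which tends to 1/2. *)
pose tn n : R := n.+1%:R `^ alpha^-1.
have tn0 n : 0 < tn n by exact: powR_gt0.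
have tna n : tn n `^ alpha = n.+1%:R.
  by rewrite -powRrM mulVf ?gt_eqF// powRr1.
have c x : (fun n => (y < n.+1%:R * x)%R%:R) @ \oo --> (((cst 1 : R -> R) \_ pos) x).
  rewrite patch_posE; apply: cvg_near_cst; case: ltP => x0; last first.
    apply: nearW => n; rewrite ltNge (le_trans _ (ltW y0))//.
    by rewrite mulr_ge0_le0.
  have : \forall n \near \oo, y / x <= n%:R by exact: nbhs_infty_ger.
  apply: filterS => n yx; rewrite -ltr_pdivrMr// (le_lt_trans yx)//.
  by rewrite ltr_nat.
have b n x : `|(y < n.+1%:R * x)%R%:R| <= 1 :> R.
  by case: (_ < _); rewrite ?normr1 ?normr0.
have [_ H] := mean_cvg u 1 (fun n => measurable_scaled n.+1%:R mg) c b.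
rewrite (mean_pos1 alpha01 solu ltr01) in H.
have h0 : 0 < 2^-1 :> R by rewrite invr_gt0.
have [n Hn] := filter_ex (cvgr_gt _ H _ h0).
by exists (tn n) => //; rewrite ss// tna.
Qed.

End tail.

Section mass_transfer.
Context {R : realType} (alpha : R) (k n0 : nat) (lam : int -> nat -> R).
Context (d : measure_display) (T : measurableType d) (P : probability T R).
Context (X : R -> T -> option nat).
Context (d' : measure_display) (T' : measurableType d') (P' : probability T' R).
Context (Xalpha : R -> T' -> option nat).
Context (u : R -> probability (measurableTypeR R) R).
Hypothesis alpha01 : 0 < alpha <= 1.
Hypothesis lam_gt0 : forall (n : int) (i : nat),
  n0%:Z <= n -> (1 <= i <= k)%N -> 0 < lam n i.
Hypothesis lam_eq0 : forall (n : int) (i : nat), n < n0%:Z -> lam n i = 0.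
Hypothesis gbpX : is_gbp k n0 lam P X.
Hypothesis gfbpX : is_gfbp alpha k n0 lam P' Xalpha.
Hypothesis solu : fundamental_solution alpha u.
Implicit Types (s t x y : R) (n m i N : nat).
Local Notation p := (state_prob P X).
Local Notation palpha := (state_prob P' Xalpha).
Local Notation mu := (@lebesgue_measure R).
Local Notation pos := (`]0, +oo[%classic : set R).

Lemma state_prob_sum_from (a : R) (e : measure_display) (S : measurableType e)
    (Q : probability S R) (Y : R -> S -> option nat) N t :
  is_gfbp a k n0 lam Q Y -> 0 < t ->
  \sum_(n0 <= n < N) state_prob Q Y n t = \sum_(0 <= n < N) state_prob Q Y n t.
Proof.
move=> procY t0; have z n : (n < n0)%N -> state_prob Q Y n t = 0.
  by move=> nn0; rewrite (gfbp_lt procY nn0 (ltW t0)).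
case: (leqP n0 N) => n0N.
  have E : \sum_(0 <= n < n0) state_prob Q Y n t = 0.
    by rewrite big_nat_cond big1// => n; rewrite andbT => /andP[_ /z].
  by rewrite [RHS](big_cat_nat (n := n0))//= E add0r.
rewrite big_geq ?(ltnW n0N)// big_nat_cond big1// => n.
by rewrite andbT => /andP[_ nN]; rewrite z// (ltn_trans nN).
Qed.

Lemma mass_eq1P (a : R) (e : measure_display) (S : measurableType e)
    (Q : probability S R) (Y : R -> S -> option nat) t :
  is_gfbp a k n0 lam Q Y -> 0 < t ->
  ((\sum_(n0 <= m <oo) (state_prob Q Y m t)%:E)%E = 1%E) <->
  ((fun N => \sum_(0 <= m < N) state_prob Q Y m t) @ \oo --> (1 : R)).
Proof.
move=> procY t0; rewrite nneseries_eq1; last by move=> m; exact: state_prob_ge0.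
by under eq_fun do rewrite (state_prob_sum_from _ procY t0).
Qed.

Let G N x := \sum_(0 <= n < N) (p n \_ pos) x.

Lemma partial_mass_measurable N : measurable_fun setT (G N).
Proof.
by apply: measurable_sum => n; exact: (state_prob_patch_measurable gbpX).
Qed.

Lemma partial_massE N x : G N x = if 0 < x then \sum_(0 <= n < N) p n x else 0.
Proof.
rewrite /G; case: ifP => x0.
  by apply: eq_bigr => n _; rewrite patch_posE x0.
by rewrite big1// => n _; rewrite patch_posE x0.
Qed.

Lemma partial_mass_bounded N x : `|G N x| <= 1.
Proof.
rewrite partial_massE; case: ifP => x0; last by rewrite normr0.
rewrite ger0_norm; first exact: (total_mass_le1 lam_gt0 lam_eq0 gbpX).
by apply: sumr_ge0 => n _; exact: state_prob_ge0.
Qed.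

Lemma subordination_sum N t : 0 < t ->
  \sum_(0 <= n < N) palpha n t = 2 * mean u (G N) t.
Proof.
move=> t0; elim: N => [|N IH].
  rewrite big_geq// /mean /G; under eq_Rintegral do rewrite big_geq//.
  by rewrite Rintegral_cst//= mul0r mulr0.
rewrite big_nat_recr//= IH (subordination alpha01 lam_gt0 gbpX gfbpX solu)// -mulrDr.
congr (_ * _); rewrite /mean -RintegralD//.
- by apply: eq_Rintegral => x _; rewrite /G big_nat_recr.
- apply: (integrable_mean u t (partial_mass_measurable N) (@partial_mass_bounded N)).
- apply: (integrable_mean u t (state_prob_patch_measurable gbpX N)).
  exact: (state_prob_patch_bounded gbpX).
Qed.

(** The partial masses converge boundedly to 1 on the positive half-line, whose mass 1/2 under [u t]
    cancels the factor 2. *)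
Lemma fractional_mass1 :
  (forall x, 0 < x -> (fun N => \sum_(0 <= n < N) p n x) @ \oo --> (1 : R)) ->
  forall t, 0 < t -> (fun N => \sum_(0 <= n < N) palpha n t) @ \oo --> (1 : R).
Proof.
move=> H t t0; under eq_fun do rewrite subordination_sum//.
have c x : G ^~ x @ \oo --> ((cst 1 : R -> R) \_ pos) x.
  under eq_fun do rewrite partial_massE.
  by rewrite patch_posE; case: ltP => x0; [exact: H|exact: cvg_cst].
have [_] := mean_cvg u t partial_mass_measurable c partial_mass_bounded.
rewrite (mean_pos1 alpha01 solu t0) => {}c.
have : (2 * mean u (G N) t) @[N --> \oo] --> (2 * 2^-1 : R) by exact: cvgMr.
by rewrite divff.
Qed.

(* If the mass of X at time x is at most l < 1, it stays so after x, while u t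
   charges the half-line above x for some t. *)
Lemma birth_mass1 :
  (forall t, 0 < t -> (fun N => \sum_(0 <= n < N) palpha n t) @ \oo --> (1 : R)) ->
  forall x, 0 < x -> (fun N => \sum_(0 <= n < N) p n x) @ \oo --> (1 : R).
Proof.
move=> H x x0; have [l [cl l1 Gl]] := total_mass_limit lam_gt0 lam_eq0 gbpX x0.
move: (l1); rewrite le_eqVlt => /predU1P[<-//|{}l1].
have [t t0 ht] := mean_tail_gt0 alpha01 solu x0.
pose h y : R := (x < y)%R%:R.
have mh : measurable_fun setT h by have [] := subordinable_tail alpha01 solu (ltW x0).
have hb y : `|h y| <= 1 by rewrite /h; case: (_ < _); rewrite ?normr1 ?normr0.
pose one := (cst 1 : R -> R) \_ pos.
have mone : measurable_fun setT one by apply: measurable_patch_pos.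
have oneb y : `|one y| <= 1.
  by rewrite /one patch_posE; case: ifP; rewrite ?normr1 ?normr0.
have mlh : measurable_fun setT (fun y => (1 - l) * h y) by exact: measurable_funM.
have lhb y : `|(1 - l) * h y| <= `|1 - l|.
  by rewrite normrM ler_piMr.
(* The partial mass is at most 1 up to [x] and, being decreasing in time, at most [l] beyond it. So
   it lies below the indicator of the positive half-line minus 1 - l times that of ]x, +oo[. *)
have U N : \sum_(0 <= n < N) palpha n t <= 1 - 2 * (1 - l) * mean u h t.
  rewrite subordination_sum//.
  suff : mean u (G N) t <= mean u (fun y => one y - (1 - l) * h y) t.
    rewrite (meanB u t mone oneb mlh lhb) (meanZ u t _ mh hb) (mean_pos1 alpha01 solu t0).
    by move: (mean u h t) (mean u (G N) t) => a b; nra.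
  apply: le_Rintegral => //.
  - exact: (integrable_mean u t (partial_mass_measurable N) (@partial_mass_bounded N)).
  - apply: (@integrable_mean _ _ _ _ (1 + `|1 - l|)); first exact: measurable_funB.
    by move=> y; rewrite (le_trans (ler_normB _ _))// lerD.
  - move=> y _; rewrite partial_massE /one patch_posE /h.
    case: (ltP 0 y) => y0; last first.
      by rewrite (ltNge x) (le_trans y0 (ltW x0)) mulr0 subr0.
    case: (ltP x y) => xy.
      rewrite mulr1 opprB addrC subrK (le_trans _ (Gl N))//.
      by apply: (total_mass_decreasing lam_gt0 lam_eq0 gbpX) => //; exact: ltW.
    by rewrite mulr0 subr0; exact: (total_mass_le1 lam_gt0 lam_eq0 gbpX).
have : 1 <= 1 - 2 * (1 - l) * mean u h t.
  by apply: (cvgr_to_le (H t t0)); exact: nearW.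
rewrite leNgt ltrBlDr ltrDl => /negP[].
by rewrite mulr_gt0// mulr_gt0// subr_gt0.
Qed.

End mass_transfer.

(** * Divergence of the series of inverse rate norms *)

Lemma bounded_continuous_Rintegral_sum (R : realType) (r : seq nat) (F : nat -> R -> R) (t : R) :
  0 < t -> (forall i, bounded_continuous (F i)) ->
  \int[@lebesgue_measure R]_(s in `]0, t[) (\sum_(i <- r) F i s) =
  \sum_(i <- r) \int[@lebesgue_measure R]_(s in `]0, t[) F i s.
Proof.
move=> t0 cF; elim: r => [|i r IH].
  rewrite big_nil; under eq_Rintegral do rewrite big_nil.
  by rewrite Rintegral_cst//= mul0r.
rewrite big_cons -IH -RintegralD//.
- by apply: eq_Rintegral => s _; rewrite big_cons.
- exact: bounded_continuous_integrable.
- apply: bounded_continuous_integrable => //; exact: bounded_continuous_sum.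
Qed.

(** Telescoping with lag [i]: only the last [i] values survive, since truncated subtraction sends
    the low indices to 0, where [g] vanishes. *)
Lemma sum_lag (R : realType) (g : nat -> R) (i M : nat) : g 0%N = 0 -> (0 < i)%N ->
  \sum_(0 <= m < M) (g m.+1 - g (m.+1 - i)%N) = \sum_(0 <= j < i) g (M - j)%N.
Proof.
case: i => // i g0 _; elim: M => [|M IH].
  by rewrite big_geq// big1// => j _; rewrite sub0n.
rewrite big_nat_recr//= IH big_nat_recr//= [RHS]big_nat_recl//= subn0 subSS.
rewrite [LHS]addrC -addrA; congr (_ + _); rewrite addrC addrK.
by apply: eq_bigr => j _; rewrite subSS.
Qed.

Section divergence.
Context {R : realType} (k n0 : nat) (lam : int -> nat -> R).
Context (d : measure_display) (T : measurableType d) (P : probability T R).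
Context (X : R -> T -> option nat).
Hypothesis lam_gt0 : forall (n : int) (i : nat),
  n0%:Z <= n -> (1 <= i <= k)%N -> 0 < lam n i.
Hypothesis lam_eq0 : forall (n : int) (i : nat), n < n0%:Z -> lam n i = 0.
Hypothesis gbpX : is_gbp k n0 lam P X.
Implicit Types (s t x y : R) (n m i j N M : nat).
Local Notation p := (state_prob P X).
Local Notation mu := (@lebesgue_measure R).

(** The index m - j + 1 with 1 <= j <= i runs over the sources of jumps of size i across level m +
    1, the very rates that enter [flux] at [m.+1]. Computed in [int], it may be negative. *)
Definition rate_sqr_sum m :=
  \sum_(1 <= i < k.+1) \sum_(1 <= j < i.+1) lam (m%:Z - j%:Z + 1) i ^+ 2.

Lemma rate_weight_le1 m i n : (1 <= i <= k)%N -> (m.+1 - i <= n < m.+1)%N ->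
  rate_sqr_sum m `^ (- 2^-1) * lam n i <= 1.
Proof.
move=> /andP[i1 ik] /andP[nl nm]; set c := rate_sqr_sum m.
have jb : (1 <= m.+1 - n <= i)%N by rewrite subn_gt0 nm leq_subCl.
have lc : lam n i ^+ 2 <= c.
  rewrite /c /rate_sqr_sum (bigD1_seq i) ?mem_index_iota ?i1 ?ltnS ?iota_uniq//=.
  rewrite (bigD1_seq (m.+1 - n)%N) ?mem_index_iota ?ltnS ?iota_uniq//=.
  have -> : m%:Z - (m.+1 - n)%N%:Z + 1 = n :> int.
    by rewrite -subzn ?(ltnW nm)// -addn1 PoszD; ring.
  rewrite -addrA lerDl addr_ge0// sumr_ge0// => ? _; first exact: sqr_ge0.
  by apply: sumr_ge0 => ? _; exact: sqr_ge0.
have c0 : 0 <= c by exact: le_trans (sqr_ge0 _) lc.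
(* If the sum of squares is 0, the weight is 0 as well, by the value of [powR] at 0. *)
move: c0; rewrite le_eqVlt => /predU1P[<-|c0].
  by rewrite powR0 ?mul0r// oppr_eq0 invr_eq0.
rewrite powRN powR12_sqrt ?(ltW c0)// mulrC ler_pdivrMr ?sqrtr_gt0// mul1r.
rewrite (le_trans (ler_norm _))// -sqrtr_sqr.
exact: ler_wsqrtr.
Qed.

(** Each rate is at most the norm that divides it, so the weighted flux at level m + 1 is at most
    the sum over i of the mass on the window [m + 1 - i, m]. A state lies in at most i of the
    windows of length i, so the total is at most the sum of all i <= k, hence at most k^2, uniformly
    in M and s. *)
Lemma weighted_flux_le M s : 0 < s ->
  \sum_(n0 <= m < M) rate_sqr_sum m `^ (- 2^-1) * flux k lam P X m.+1 s <= (k * k)%:R.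
Proof.
move=> s0; pose g N := \sum_(0 <= n < N) p n s.
have g1 N : g N <= 1 by exact: (total_mass_le1 lam_gt0 lam_eq0 gbpX).
apply: (@le_trans _ _ (\sum_(0 <= m < M) \sum_(1 <= i < k.+1) (g m.+1 - g (m.+1 - i)%N))).
  have nn m i : 0 <= g m.+1 - g (m.+1 - i)%N.
    by rewrite subr_ge0; apply: (total_mass_nondecreasing P X s); exact: leq_subr.
  apply: (@le_trans _ _ (\sum_(n0 <= m < M) \sum_(1 <= i < k.+1) (g m.+1 - g (m.+1 - i)%N))).
    apply: ler_sum => m _; rewrite /flux mulr_sumr big_nat_cond [leRHS]big_nat_cond.
    apply: ler_sum => i; rewrite andbT ltnS => ik.
    have -> : g m.+1 - g (m.+1 - i)%N = \sum_(m.+1 - i <= n < m.+1) p n s.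
      rewrite /g (big_cat_nat (leq0n _) (leq_subr i m.+1))/=.
      by rewrite addrAC subrr add0r.
    rewrite mulr_sumr big_nat_cond [leRHS]big_nat_cond.
    apply: ler_sum => n; rewrite andbT => nb.
    by rewrite mulrA ler_piMl ?state_prob_ge0// rate_weight_le1.
  case: (leqP n0 M) => n0M; last first.
    by rewrite big_geq ?(ltnW n0M)//; apply: sumr_ge0 => m _; exact: sumr_ge0.
  rewrite [leRHS](big_cat_nat (n := n0))//= lerDr.
  by apply: sumr_ge0 => m _; exact: sumr_ge0.
rewrite exchange_big /=.
apply: (@le_trans _ _ (\sum_(1 <= i < k.+1) k%:R)); last first.
  by rewrite sumr_const_nat subn1 /= -mulrnA.
rewrite big_nat_cond [leRHS]big_nat_cond; apply: ler_sum => i.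
rewrite andbT ltnS => /andP[i1 ik]; rewrite sum_lag//; last by rewrite /g big_geq.
apply: (@le_trans _ _ (\sum_(0 <= j < i) 1)).
  by apply: ler_sum => j _; exact: g1.
by rewrite sumr_const_nat subn0 ler_nat.
Qed.

(* As long as the total mass at time t is at most l < 1, every level above n0 has
   been crossed with probability at least 1 - l, so the weights are summable. *)
Lemma birth_mass1_divergence :
  (\sum_(n0 <= m <oo) (rate_sqr_sum m `^ (- 2^-1))%:E = +oo)%E ->
  forall t, 0 < t -> (fun N => \sum_(0 <= n < N) p n t) @ \oo --> (1 : R).
Proof.
move=> div t t0; have [l [cl l1 Gl]] := total_mass_limit lam_gt0 lam_eq0 gbpX t0.
move: (l1); rewrite le_eqVlt => /predU1P[<-//|{}l1].
have dl : 0 < 1 - l by rewrite subr_gt0.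
have cflux N : bounded_continuous (flux k lam P X N) by exact: flux_bc gbpX N.
pose w m := rate_sqr_sum m `^ (- 2^-1).
have w0 m : 0 <= w m by exact: powR_ge0.
(* For m >= n0 the initial state lies below level m + 1, so what has crossed that level by time t is
   1 minus a partial mass, and that partial mass is at most l. *)
have fl m : (n0 <= m)%N -> 1 - l <= \int[mu]_(s in `]0, t[) flux k lam P X m.+1 s.
  move=> n0m; have := Gl m.+1.
  rewrite (total_mass_integral lam_eq0 gbpX)// ltnS n0m lerBlDr => H.
  by rewrite lerBlDr addrC.
(* The pointwise bound on the weighted flux, integrated over ]0, t[, bounds all partial sums of the
   weights independently of M. *)
have S M : (1 - l) * \sum_(n0 <= m < M) w m <= (k * k)%:R * t.
  apply: (@le_trans _ _ (\int[mu]_(s in `]0, t[)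
      (\sum_(n0 <= m < M) w m * flux k lam P X m.+1 s))).
    rewrite bounded_continuous_Rintegral_sum//; last first.
      by move=> m; exact: bounded_continuousZ.
    rewrite mulr_sumr big_nat_cond [leRHS]big_nat_cond; apply: ler_sum => m.
    rewrite andbT => /andP[n0m _].
    rewrite RintegralZl//; last exact: bounded_continuous_integrable.
    by rewrite mulrC ler_wpM2l// fl.
  have -> : (k * k)%:R * t = \int[mu]_(s in `]0, t[) (k * k)%:R.
    rewrite Rintegral_cst//= lebesgue_measure_itv/= lte_fin t0 /=.
    by rewrite subr0.
  apply: le_Rintegral => //.
  - apply: bounded_continuous_integrable => //; apply: bounded_continuous_sum => m.
    exact: bounded_continuousZ.
  - apply: bounded_continuous_integrable => //; split; first by move=> *; exact: cvg_cst.
    by exists `|(k * k)%:R| => r _.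
  - by move=> s /=; rewrite in_itv /= => /andP[s0 _]; exact: weighted_flux_le.
have : (\sum_(n0 <= m <oo) (w m)%:E <= ((k * k)%:R * t / (1 - l))%:E)%E.
  apply: lime_le; first by apply: is_cvg_nneseries => m _ _; rewrite lee_fin.
  by apply: nearW => M; rewrite sumEFin lee_fin ler_pdivlMr// mulrC.
by rewrite div leye_eq.
Qed.

End divergence.

Unset Implicit Arguments.
Set Strict Implicit.
Set Printing Implicit Defensive.

Theorem mainTheorem5 (R : realType) (k n0 : nat) (alpha : R)
    (lam : int -> nat -> R)
    (d : measure_display) (T : measurableType d) (P : probability T R)
    (X : R -> T -> option nat)
    (d' : measure_display) (T' : measurableType d') (P' : probability T' R)
    (Xalpha : R -> T' -> option nat)
    (u : R -> probability (measurableTypeR R) R)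
    (k_ge1 : (1 <= k)%N)
    (alpha_bounds : 0 < alpha <= 1)
    (lam_gt0 : forall (n : int) (i : nat),
       n0%:Z <= n -> (1 <= i <= k)%N -> 0 < lam n i)
    (lam_eq0 : forall (n : int) (i : nat), n < n0%:Z -> lam n i = 0)
    (gbpX : is_gbp k n0 lam P X)
    (gfbpX : is_gfbp alpha k n0 lam P' Xalpha)
    (solu : fundamental_solution alpha u)
    (mu_distinct : forall (m : nat) (x : 'rV[R]_m), (1 <= m)%N -> Theta k x ->
       forall l l' : nat, (1 <= l <= size (Lambda x))%N ->
         (1 <= l' <= size (Lambda x))%N -> l <> l' ->
         mu_rate k n0 lam x l <> mu_rate k n0 lam x l') :
  let p := state_prob P X in
  let palpha := state_prob P' Xalpha in
  [/\ forall (m : nat) (t : R), (n0 <= m)%N -> 0 < t ->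
        (palpha m t)%:E
          = (\int[folded_measure (u t)]_(xi in `]0%R, +oo[) (p m xi)%:E)%E,
      forall udens : R -> R -> R,
        (forall t : R, 0 < t -> has_density (u t) (udens ^~ t)) ->
        forall (m : nat) (t : R), (n0 <= m)%N -> 0 < t ->
        (palpha m t)%:E
          = (\int[@lebesgue_measure R]_(xi in `]0%R, +oo[)
               (p m xi * folded (udens ^~ t) xi)%:E)%E,
      (forall t : R, 0 < t -> (\sum_(n0 <= m <oo) (palpha m t)%:E = 1)%E) <->
      (forall t : R, 0 < t -> (\sum_(n0 <= m <oo) (p m t)%:E = 1)%E)
    & (\sum_(n0 <= m <oo)
         ((\sum_(1 <= i < k.+1) \sum_(1 <= j < i.+1)
             lam (m%:Z - j%:Z + 1) i ^+ 2) `^ (- 2^-1))%:E = +oo)%E ->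
      forall t : R, 0 < t -> (\sum_(n0 <= m <oo) (palpha m t)%:E = 1)%E].
Proof.
move=> p palpha.
have claim1 m t : 0 < t -> (palpha m t)%:E
    = (\int[folded_measure (u t)]_(xi in `]0%R, +oo[) (p m xi)%:E)%E.
  exact: (subordination_folded alpha_bounds lam_gt0 gbpX gfbpX solu).
(* The claim concerns extended-real series starting at [n0], the mass lemmas real partial sums
   starting at 0; [mass_eq1P] passes between them. *)
have iff3 : (forall t : R, 0 < t -> (\sum_(n0 <= m <oo) (palpha m t)%:E = 1)%E) <->
    (forall t : R, 0 < t -> (\sum_(n0 <= m <oo) (p m t)%:E = 1)%E).
  split=> H t t0.
    apply/(mass_eq1P gbpX t0).
    apply: (birth_mass1 alpha_bounds lam_gt0 lam_eq0 gbpX gfbpX solu) => // x x0.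
    by apply/(mass_eq1P gfbpX x0); exact: H.
  apply/(mass_eq1P gfbpX t0).
  apply: (fractional_mass1 alpha_bounds lam_gt0 lam_eq0 gbpX gfbpX solu) => // x x0.
  by apply/(mass_eq1P gbpX x0); exact: H.
split=> //.
- by move=> m t _; exact: claim1.
- move=> udens dens m t _ t0.
  rewrite (integral_folded (dens t t0) (state_prob_patch_measurable gbpX m)); last first.
    by move=> x; exact: state_prob_ge0.
  by rewrite (state_prob_patch_mean u gbpX) /palpha (subordination alpha_bounds lam_gt0 gbpX gfbpX solu).
- move=> div; apply/iff3 => t t0; apply/(mass_eq1P gbpX t0).
  exact: (birth_mass1_divergence lam_gt0 lam_eq0 gbpX div).
Qed.
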